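(* Assume: (A) $\partial\Omega$ has a local parabolic support of order $\tau$ at every point, for a fixed $0\le\tau<\infty$; (B) $R\in L^1_{loc}(\mathbb{R}^d)$ and $R(\boldsymbol{p})\ge C_0|\boldsymbol{p}|^{-2k}$ for $|\boldsymbol{p}|\ge r_0$, with constants $k\ge0$, $C_0>0$, $r_0>0$; (C) $\mu(\Omega)<\int_{\mathbb{R}^d}R(\boldsymbol{p})\,d\boldsymbol{p}$. Then there exists a unique generalised solution $u\in W^+(\Omega)$ of the Dirichlet problem with weak boundary condition. Moreover, let $I$ be an admissible mesh family for $\Omega$ and, for $\delta>0$ and $h\in I$, let $u_h^\delta$ be the solution of the finite element problem on $\mathcal T_h$ with $\mu$ replaced by $\mu^\delta(e):=\mu(e\cap\Omega_\delta)$. Then for every $\sigma>0$, $$\lim_{\delta\to0^+}\Big(\lim_{I\ni h\to0}\|u_h^\delta-u\|_{L^\infty(\overline{\Omega_\sigma})}\Big)=0.$$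
   Context: $\Omega\subset\mathbb{R}^d$ is a bounded open convex domain; $g\in C(\partial\Omega)$; $R:\mathbb{R}^d\to(0,\infty)$ with $R>0$; $\mu$ a nonnegative Borel measure on $\Omega$; $W^+(U)$ the convex real-valued functions on open convex $U$; $\partial u(\boldsymbol{x})=\{\boldsymbol{p}:\ u(\boldsymbol{y})\ge u(\boldsymbol{x})+\boldsymbol{p}\cdot(\boldsymbol{y}-\boldsymbol{x})\ \forall\boldsymbol{y}\in U\}$, $\partial u(E)=\bigcup_{\boldsymbol{x}\in E}\partial u(\boldsymbol{x})$; $\Omega_\delta=\{\boldsymbol{x}\in\Omega:\operatorname{dist}(\boldsymbol{x},\partial\Omega)>\delta\}$. Generalised solution with weak Dirichlet boundary condition: $u\in W^+(\Omega)$ such that (i) $\int_{\partial u(e)}R\,d\boldsymbol{p}=\mu(e)$ for every Borel $e\subset\Omega$, (ii) $\limsup_{\Omega\ni\boldsymbol{x}'\to\boldsymbol{x}}u(\boldsymbol{x}')\le g(\boldsymbol{x})$ for every $\boldsymbol{x}\in\partial\Omega$, and (iii) $u\ge v$ on $\Omega$ for every $v\in W^+(\Omega)$ satisfying (i) and (ii). Local parabolic support of order $\tau$ at $\boldsymbol{a}_0\in\partial\Omega$: in Cartesian coordinates with $\boldsymbol{a}_0=0$, supporting hyperplane $\{x^d=0\}$ and $x^d$ along the interior normal, $\partial\Omega$ near $\boldsymbol{a}_0$ is a graph $x^d=g_0(x^1,\dots,x^{d-1})$ over its projection $\Pi$, with $g_0\ge\eta(\boldsymbol{a}_0)(\sum_{i<d}|x^i|^2)^{(\tau+2)/2}$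 on $\Pi$ for some $\eta(\boldsymbol{a}_0)>0$. Mesh: finite set $\mathcal T_h$ of closed $d$-simplices in $\overline\Omega$, pairwise meeting in common sub-simplices of dimension $\le d-1$, $h=\max\operatorname{diam}T$, $\Omega_h:=\operatorname{Int}(\bigcup T)$ convex, all vertices of $\mathcal T_h$ on $\partial\Omega_h$ lying on $\partial\Omega$; interior vertices $\boldsymbol{A}_i$ ($1\le i\le k_h$), vertices on $\partial\Omega_h$: $\boldsymbol{B}_j$. $H_h$: functions $v\in W^+(\Omega_h)\cap C(\overline{\Omega_h})$ with $v(\boldsymbol{x})=\inf\{t:(\boldsymbol{x},t)\in M_h(z)\}$, $M_h(z)$ the convex hull of $\{(\boldsymbol{A}_i,z_i)\}\cup\{(\boldsymbol{B}_j,g(\boldsymbol{B}_j))\}$, for some $z\in\mathbb{R}^{k_h}$. $\phi_{i,h}$: continuous, affine on each simplex, $\phi_{i,h}(\boldsymbol{A}_j)=\delta_{ij}$, $\phi_{i,h}(\boldsymbol{B}_j)=0$. Finite element problem with measure $\nu$: find $u_h\in H_h$ with $\int_{\partial u_h(\boldsymbol{A}_i)}R\,d\boldsymbol{p}=\int_{\Omega_h}\phi_{i,h}\,d\nu$ for all $i$ (sub-differential relative to $\Omega_h$). Admissible mesh family: $I\subset(0,1)$ with $0$ as unique accumulation point, a mesh $\mathcal T_h$ for each $h\in I$, and for every $\delta>0$ some $h_\delta>0$ with $\overline{\Omega_\delta}\subset\Omega_h$ for $h\in I$, $h<h_\delta$. *)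

(* Defs.v *)
From mathcomp Require Import all_boot all_order all_algebra.
From mathcomp Require Import all_classical all_reals all_analysis.
Import Order.TTheory GRing.Theory Num.Theory.
Import numFieldTopology.Exports numFieldNormedType.Exports.

Set Implicit Arguments.
Unset Strict Implicit.
Unset Printing Implicit Defensive.

Local Open Scope ring_scope.
Local Open Scope classical_set_scope.

Section Defs.
Variable R : realType.

Definition dotp {d} (p y : 'rV[R]_d) : R := \sum_(i < d) p 0 i * y 0 i.
Definition enorm {d} (x : 'rV[R]_d) : R := Num.sqrt (dotp x x).

Definition bdry {d} (A : set 'rV[R]_d) : set 'rV[R]_d := closure A `\` interior A.

Definition distE {d} (x : 'rV[R]_d) (A : set 'rV[R]_d) : R :=
  inf [set enorm (x - y) | y in A].

Definition inner_set {d} (Om : set 'rV[R]_d) (delta : R) : set 'rV[R]_d :=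
  [set x | Om x /\ delta < distE x (bdry Om)].

Definition convex_setE {V : lmodType R} (A : set V) : Prop :=
  forall x y, A x -> A y -> forall t : R, 0 <= t <= 1 ->
    A (t *: x + (1 - t) *: y).

Definition bdd_setE {d} (A : set 'rV[R]_d) : Prop :=
  exists M : R, forall x, A x -> enorm x <= M.

Definition convex_fun_on {d} (U : set 'rV[R]_d) (u : 'rV[R]_d -> R) : Prop :=
  forall x y, U x -> U y -> forall t : R, 0 <= t <= 1 ->
    u (t *: x + (1 - t) *: y) <= t * u x + (1 - t) * u y.

Definition subdiff {d} (U : set 'rV[R]_d) (u : 'rV[R]_d -> R) (x : 'rV[R]_d)
  : set 'rV[R]_d :=
  [set p | forall y, U y -> u x + dotp p (y - x) <= u y].

Definition subdiff_img {d} (U : set 'rV[R]_d) (u : 'rV[R]_d -> R)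
  (E : set 'rV[R]_d) : set 'rV[R]_d :=
  \bigcup_(x in E) subdiff U u x.

Definition convhull {V : lmodType R} (S : set V) : set V :=
  [set x | exists (n : nat) (p : 'I_n -> V) (c : 'I_n -> R),
      (forall i, S (p i)) /\ (forall i, 0 <= c i) /\
      \sum_(i < n) c i = 1 /\ x = \sum_(i < n) c i *: p i].

(* Iterated (lower) Lebesgue integral over R^d with respect to the completed
   one-dimensional Lebesgue measure; for nonnegative Lebesgue measurable
   integrands this is the d-dimensional Lebesgue integral (Fubini-Tonelli). *)
Fixpoint lint (d : nat) : ('rV[R]_d -> \bar R) -> \bar R :=
  match d with
  | 0 => fun f => f 0
  | d'.+1 => fun f =>
      (\int[@completed_lebesgue_measure R]_x
         lint (fun y : 'rV[R]_d' => f (row_mx (const_mx x : 'rV[R]_1) y)))%E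
  end.

Definition wint {d} (A : set 'rV[R]_d) (f : 'rV[R]_d -> R) : \bar R :=
  lint (fun p => (\1_A p * f p)%:E).

Definition lebd {d} (A : set 'rV[R]_d) : \bar R := lint (fun p => (\1_A p)%:E).

Definition BorelRd d := g_sigma_algebraType (@open 'rV[R]_d).
Definition BorelSet {d} (A : set 'rV[R]_d) : Prop := <<s (@open 'rV[R]_d) >> A.

Definition LebMeas {d} (A : set 'rV[R]_d) : Prop :=
  exists B1 B2, BorelSet B1 /\ BorelSet B2 /\ B1 `<=` A /\ A `<=` B2 /\
    lebd (B2 `\` B1) = 0%E.

Definition LebMeasFun {d} (f : 'rV[R]_d -> R) : Prop :=
  forall a : R, LebMeas [set x | a < f x].

Definition L1loc {d} (f : 'rV[R]_d -> R) : Prop :=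
  LebMeasFun f /\
  forall K : set 'rV[R]_d, compact K -> (wint K (fun p => `|f p|%R) < +oo)%E.

Definition proj_orth {d} (nu y : 'rV[R]_d) : 'rV[R]_d := y - dotp nu y *: nu.

(* nu is the interior unit normal of a supporting hyperplane at a0 (the x^d axis),
   near a0 the boundary is a graph over its projection on the hyperplane
   (projection injective) and x^d >= eta |x'|^(tau+2) on it. *)
Definition parabolic_support {d} (Om : set 'rV[R]_d) (tau : R) (a0 : 'rV[R]_d)
  : Prop :=
  exists (nu : 'rV[R]_d) (rho eta : R),
    enorm nu = 1 /\ 0 < rho /\ 0 < eta /\
    (forall x, Om x -> 0 <= dotp nu (x - a0)) /\
    (forall x y, bdry Om x -> bdry Om y ->
        enorm (x - a0) < rho -> enorm (y - a0) < rho ->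
        proj_orth nu (x - a0) = proj_orth nu (y - a0) -> x = y) /\
    (forall x, bdry Om x -> enorm (x - a0) < rho ->
        eta * powR (enorm (proj_orth nu (x - a0))) (tau + 2) <= dotp nu (x - a0)).

Definition weak_bc {d} (Om : set 'rV[R]_d) (g u : 'rV[R]_d -> R) : Prop :=
  forall x, bdry Om x -> forall eps : R, 0 < eps ->
    exists eta : R, 0 < eta /\
      forall x', Om x' -> enorm (x' - x) < eta -> u x' <= g x + eps.

Definition MA_eq {d} (Om : set 'rV[R]_d) (Rf : 'rV[R]_d -> R)
  (mu : set 'rV[R]_d -> \bar R) (u : 'rV[R]_d -> R) : Prop :=
  forall e, BorelSet e -> e `<=` Om -> wint (subdiff_img Om u e) Rf = mu e.

Definition gen_sol {d} (Om : set 'rV[R]_d) (g Rf : 'rV[R]_d -> R)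
  (mu : set 'rV[R]_d -> \bar R) (u : 'rV[R]_d -> R) : Prop :=
  [/\ convex_fun_on Om u, MA_eq Om Rf mu u, weak_bc Om g u &
      forall v, convex_fun_on Om v -> MA_eq Om Rf mu v -> weak_bc Om g v ->
        forall x, Om x -> v x <= u x].

Definition simplex_set {d} (T : 'M[R]_(d.+1, d)) : set 'rV[R]_d :=
  convhull [set row i T | i in [set: 'I_d.+1]].

Definition aff_indep {d} (T : 'M[R]_(d.+1, d)) : Prop :=
  forall c : 'I_d.+1 -> R, \sum_i c i = 0 -> \sum_i c i *: row i T = 0 ->
    forall i, c i = 0.

Definition diamE {d} (A : set 'rV[R]_d) : R :=
  sup [set r | exists x y, A x /\ A y /\ r = enorm (x - y)].

Definition mesh_union {d} (M : seq 'M[R]_(d.+1, d)) : set 'rV[R]_d :=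
  \bigcup_(T in [set T | T \in M]) simplex_set T.

Definition mesh_dom {d} (M : seq 'M[R]_(d.+1, d)) : set 'rV[R]_d :=
  interior (mesh_union M).

Definition mesh_verts {d} (M : seq 'M[R]_(d.+1, d)) : set 'rV[R]_d :=
  [set v | exists T i, T \in M /\ v = row i T].

Definition meshsize {d} (M : seq 'M[R]_(d.+1, d)) : R :=
  sup [set diamE (simplex_set T) | T in [set T | T \in M]].

Definition is_mesh {d} (Om : set 'rV[R]_d) (M : seq 'M[R]_(d.+1, d)) (h : R)
  : Prop :=
  [/\ (forall T, T \in M -> aff_indep T /\ simplex_set T `<=` closure Om),
      (forall T T', T \in M -> T' \in M -> T != T' ->
         exists s : seq 'rV[R]_d,
           (forall v, v \in s -> exists i j, v = row i T /\ v = row j T') /\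
           (size (undup s) <= d)%N /\
           simplex_set T `&` simplex_set T' = convhull [set v | v \in s]),
      meshsize M = h,
      convex_setE (mesh_dom M) &
      (forall v, mesh_verts M v -> bdry (mesh_dom M) v -> bdry Om v)].

Definition acc_point (I : set R) (a : R) : Prop :=
  forall eps : R, 0 < eps -> exists h, I h /\ h != a /\ `|h - a| < eps.

Definition admissible {d} (Om : set 'rV[R]_d) (I : set R)
  (Mh : R -> seq 'M[R]_(d.+1, d)) : Prop :=
  [/\ (forall h, I h -> 0 < h < 1),
      acc_point I 0 /\ (forall a, acc_point I a -> a = 0),
      (forall h, I h -> is_mesh Om (Mh h) h) &
      forall delta : R, 0 < delta -> exists hd : R, 0 < hd /\
        forall h, I h -> h < hd -> closure (inner_set Om delta) `<=` mesh_dom (Mh h)].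

Definition lifted_pts {d} (g : 'rV[R]_d -> R) (M : seq 'M[R]_(d.+1, d))
  (z : 'rV[R]_d -> R) : set ('rV[R]_d * R) :=
  [set q | mesh_verts M q.1 /\
     ((mesh_dom M q.1 /\ q.2 = z q.1) \/ (bdry (mesh_dom M) q.1 /\ q.2 = g q.1))].

Definition in_FE_space {d} (g : 'rV[R]_d -> R) (M : seq 'M[R]_(d.+1, d))
  (v : 'rV[R]_d -> R) : Prop :=
  [/\ convex_fun_on (mesh_dom M) v,
      {within closure (mesh_dom M), continuous v} &
      exists z : 'rV[R]_d -> R, forall x, closure (mesh_dom M) x ->
        v x = inf [set t | convhull (lifted_pts g M z) (x, t)]].

Definition is_hat {d} (M : seq 'M[R]_(d.+1, d)) (A : 'rV[R]_d)
  (phi : 'rV[R]_d -> R) : Prop :=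
  [/\ {within closure (mesh_dom M), continuous phi},
      (forall T, T \in M -> exists (a : 'rV[R]_d) (b : R),
          forall x, simplex_set T x -> phi x = dotp a x + b),
      phi A = 1 &
      forall v, mesh_verts M v -> v != A -> phi v = 0].

(* u_h solves the finite element problem; load phi = \int_{Omega_h} phi dnu *)
Definition fe_sol {d} (g Rf : 'rV[R]_d -> R) (M : seq 'M[R]_(d.+1, d))
  (load : ('rV[R]_d -> R) -> \bar R) (v : 'rV[R]_d -> R) : Prop :=
  in_FE_space g M v /\
  forall A, mesh_verts M A -> mesh_dom M A ->
    forall phi, is_hat M A phi -> wint (subdiff (mesh_dom M) v A) Rf = load phi.

(* L^infinity norm (sup norm; functions are continuous) on D *)
Definition Linf {d} (D : set 'rV[R]_d) (f : 'rV[R]_d -> R) : \bar R :=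
  ereal_sup ([set 0%E] `|` [set (`|f x|)%:E | x in D]).

End Defs.

(* Main.v *)
From HB Require Import structures.
Require Import Defs.
From mathcomp Require Import all_boot all_order all_algebra.
From mathcomp Require Import all_classical all_reals all_analysis measurable_realfun.
From mathcomp Require Import ring lra.
Import Order.TTheory GRing.Theory Num.Theory.
Import numFieldTopology.Exports numFieldNormedType.Exports.
Set Implicit Arguments.
Unset Strict Implicit.
Unset Printing Implicit Defensive.
Local Open Scope ring_scope.
Local Open Scope classical_set_scope.

(** A slope that supports a convex function at two points lies in a null set, so the subdifferential
    of a convex [u] transports the density [Rf] to a Borel measure on the domain.  This measure is
    stable under locally uniform convergence, and uniformly bounded convex functions have locally
    uniform cluster points, so it suffices to bound solutions and to identify their limits.

    Identification is by comparison.  Suppose the measure of [u] is at most that of [v], and [v <= u]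
    at the boundary, but [M = max (v - u) > 0].  The slopes of [v] on superlevel sets of [v - u] are
    slopes of [u] there, hence almost all of them agree and have the same contact points.  The
    Legendre transforms then differ by a locally constant function, so the slopes of [v] on
    [{v - u = M}] form a nonempty set that is both compact and open.

    Parabolic supports make the domain strictly convex, which yields affine barriers from above, and
    also from below when the mass stays away from the boundary.  For point masses [m_i] at nodes one
    minimises the sum of the nodal heights among those whose cells have [rho]-measure at most [m_i].
    Discretising [mu] on an inner set gives [u^delta]; it decreases to the maximal solution [u] as
    [delta] tends to 0.  A finite element solution charges only interior vertices, because its graph
    is a lower convex hull; the hat functions being a partition of unity, its measure is close to
    that of [u^delta], and the barriers force every cluster point to be [u^delta]. *)

(** * The measure with density Rf *)

(** The strict inequality in (C) is spent once: it gives a radius [rad] such that [mu Om] is less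
    than [rho] of the ball of radius [rad]. A convex function with boundary values at least [gm]
    that is too low somewhere attains every slope of that ball inside, which costs more mass than
    there is. The resulting bound [lo = gm - 2 * (d * rad * B)] depends neither on the
    discretisation nor on the mesh, and the lower affine barriers start from it.

    Boundary behaviour has to survive limits in which the domain varies with the mesh. It is
    therefore recorded as inequalities against affine functions ([barrier_bounds]), which pass to
    pointwise limits; boundary values are recovered only on [Om], from its strict convexity.

    Images of Borel sets under the subdifferential are shown to be Borel only after removal of a
    null set, while [wint] is an iterated integral defined for every set; [is_density] bridges the
    two. No rates are used: cluster points along filters are identified by uniqueness, or by
    monotonicity in [delta]. The norm of vectors is the sup norm, hence the factors [d] next to
    inner products and Euclidean distances. *)

Section SupNorm.
Context {R : realType} {d : nat}.
Implicit Types (x y p : 'rV[R]_d) (e : R).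

Lemma rV_norm_le x e : (`|x| <= e) <-> (0 <= e /\ forall i, `|x 0 i| <= e).
Proof.
rewrite /Num.Def.normr /= mx_normrE; split.
  move=> /bigmax_leP [e0 H]; split=> // i.
  exact: (H (0, i)).
move=> [e0 H]; apply/bigmax_leP; split => // -[i j] _ /=.
by rewrite ord1; exact: H.
Qed.

Lemma rV_norm_lt x e : (`|x| < e) <-> (0 < e /\ forall i, `|x 0 i| < e).
Proof.
rewrite /Num.Def.normr /= mx_normrE; split.
  move=> /bigmax_ltP [e0 H]; split=> // i.
  exact: (H (0, i)).
move=> [e0 H]; apply/bigmax_ltP; split => // -[i j] _ /=.
by rewrite ord1; exact: H.
Qed.

Lemma rV_subE x p i : (x - p) 0 i = x 0 i - p 0 i.
Proof. by rewrite !mxE. Qed.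

Lemma rV_coord_le x i : `|x 0 i| <= `|x|.
Proof. by have /rV_norm_le [_] : `|x| <= `|x| by []. Qed.

Lemma ball_rVE x e : ball x e = [set y | `|x - y| < e].
Proof. by rewrite -ball_normE. Qed.

Lemma rat_dense_rV x e : 0 < e ->
  exists q : 'rV[rat]_d, `|x - map_mx ratr q| < e.
Proof.
move=> e0.
have H i : exists q : rat, `|x 0 i - ratr q| < e.
  have [q] := @rat_in_itvoo R (x 0 i - e) (x 0 i + e) ltac:(lra).
  rewrite in_itv /= => /andP[h1 h2]; exists q.
  by rewrite ltr_norml; apply/andP; split; lra.
have [q Hq] := choice H.
exists (\row_i q i); apply/rV_norm_lt; split => // i.
by rewrite !mxE.
Qed.

(** Rational centres and radii [1/(n+1)] keep the union countable; the inclusion in [O] is put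
    inside the indexed set, so that a ball not contained in [O] contributes the empty set. *)
Lemma open_countable_balls (O : set 'rV[R]_d) : open O ->
  O = \bigcup_(qn : 'rV[rat]_d * nat)
    [set y | `|map_mx ratr qn.1 - y| < qn.2.+1%:R^-1 /\
      [set z | `|map_mx ratr qn.1 - z| < qn.2.+1%:R^-1] `<=` O].
Proof.
move=> oO; apply/seteqP; split; last by move=> y [[q n] _ [/= h]]; apply.
move=> y Oy.
have [e /= e0 He] := (@nbhs_ballP R 'rV[R]_d y O).1 (open_nbhs_nbhs (conj oO Oy)).
have [n Hn] : exists n : nat, n.+1%:R^-1 < e / 2.
  have e2 : 0 < e / 2 by lra.
  by have [n] := ltr_add_invr e2; rewrite add0r; exists n.
have n0 : 0 < n.+1%:R^-1 :> R by rewrite invr_gt0 ltr0n.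
have [q Hq] := rat_dense_rV y n0.
exists (q, n) => //=; split; first by rewrite distrC.
move=> z /= Hz; apply: He; rewrite ball_rVE /=.
rewrite (_ : y - z = (y - map_mx ratr q) + (map_mx ratr q - z)); last first.
  by rewrite addrA subrK.
have Hz' : `|map_mx ratr q - z| < n.+1%:R^-1 by exact: Hz.
by apply: le_lt_trans (ler_normD _ _) _; move: Hz' Hq Hn; set w := _^-1; lra.
Qed.

Lemma measurable_fun_rV dT (T : measurableType dT) (f : T -> 'rV[R]_d) :
  (forall x e, measurable (f @^-1` [set y | `|x - y| < e])) ->
  measurable_fun setT (f : T -> BorelRd R d).
Proof.
move=> mf; apply: (@measurability _ _ T (BorelRd R d) setT f (@open 'rV[R]_d)) => //.
move=> _ [W oO <-]; rewrite setTI (open_countable_balls oO) preimage_bigcup.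
apply: countable_bigcupT_measurable; first exact: countableP.
move=> [q n] /=.
have [H|H] := pselect ([set z | `|map_mx ratr q - z| < n.+1%:R^-1] `<=` W).
  have := mf (map_mx ratr q) n.+1%:R^-1; congr measurable.
  by apply/seteqP; split => t /=; [split|case].
rewrite (_ : _ @^-1` _ = set0) //.
by apply/seteqP; split => t //= -[].
Qed.

Lemma open_borel (A : set 'rV[R]_d) : open A -> measurable (A : set (BorelRd R d)).
Proof. exact: sub_sigma_algebra. Qed.

Lemma closed_borel (A : set 'rV[R]_d) : closed A -> measurable (A : set (BorelRd R d)).
Proof. by move=> cA; rewrite -(setCK A); apply: measurableC; apply: open_borel; rewrite openC. Qed.

Lemma continuous_distl x : continuous (fun y : 'rV[R]_d => `|x - y| : R).
Proof.
move=> y; apply: (@cvg_norm R _ _ (nbhs y) _ (fun z => x - z) (x - y)).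
apply: (@cvgB R _ _ (nbhs y) _ (fun=> x) (fun z => z) x y); last exact: cvg_id.
exact: cvg_cst.
Qed.

Lemma cball_closed x e : closed [set y | `|x - y| <= e].
Proof.
rewrite (_ : [set _ | _] = (fun y => `|x - y|) @^-1` [set t | t <= e]) //.
apply: closed_comp; last exact: closed_le.
by move=> y _; exact: continuous_distl.
Qed.

Lemma oball_open x e : open [set y | `|x - y| < e].
Proof.
rewrite (_ : [set _ | _] = (fun y => `|x - y|) @^-1` [set t | t < e]) //.
apply: open_comp; last exact: open_lt.
by move=> y _; exact: continuous_distl.
Qed.

End SupNorm.

(** * Splitting off the first coordinate *)

Section ConsVector.
Context {R : realType} {d : nat}.

(** The same [row_mx] term as in the recursion of [lint], so that slices of an integrand unfold to
    it. In the sup norm preimages of balls are products, which makes it measurable for the product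
    sigma-algebra. *)
Definition consv (z : R * 'rV[R]_d) : 'rV[R]_d.+1 :=
  row_mx (const_mx z.1 : 'rV[R]_1) z.2.

Lemma consv0 z : consv z 0 ord0 = z.1.
Proof.
have h := row_mxEl (const_mx z.1 : 'rV[R]_1) z.2 0 ord0.
rewrite [RHS]mxE in h; rewrite -[RHS]h.
by congr (fun_of_matrix _ _ _); exact: val_inj.
Qed.

Lemma consvS z i : consv z 0 (lift ord0 i) = z.2 0 i.
Proof.
have h := row_mxEr (const_mx z.1 : 'rV[R]_1) z.2 0 i.
by rewrite -h; congr (fun_of_matrix _ _ _); exact: val_inj.
Qed.

Lemma consv_sub_lt z x e : (`|x - consv z| < e) <->
  (`|x 0 ord0 - z.1| < e /\ `|(\row_i x 0 (lift ord0 i)) - z.2| < e).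
Proof.
rewrite !rV_norm_lt; split.
  move=> [e0 H]; split; first by have := H ord0; rewrite rV_subE consv0.
  by split=> // i; have := H (lift ord0 i); rewrite !rV_subE consvS mxE.
move=> [h [e0 H]]; split=> // i.
case: (unliftP ord0 i) => [j|] ->.
  by have := H j; rewrite !rV_subE consvS mxE.
by rewrite rV_subE consv0.
Qed.

Lemma consv_norm_le z e : (`|consv z| <= e) <-> (`|z.1| <= e /\ `|z.2| <= e).
Proof.
rewrite !rV_norm_le; split.
  move=> [e0 H]; split; first by have := H ord0; rewrite consv0.
  by split=> // i; have := H (lift ord0 i); rewrite consvS.
move=> [h [e0 H]]; split=> // i.
case: (unliftP ord0 i) => [j|] ->; last by rewrite consv0.
by have := H j; rewrite consvS.
Qed.

Lemma measurable_consv :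
  measurable_fun setT (consv : measurableTypeR R * BorelRd R d -> BorelRd R d.+1).
Proof.
apply: measurable_fun_rV => x e.
rewrite (_ : _ @^-1` _ = [set t : measurableTypeR R | `|x 0 ord0 - t| < e] `*`
   [set y : BorelRd R d | `|(\row_i x 0 (lift ord0 i)) - y| < e]); last first.
  by apply/seteqP; split => -[t y] h; apply/(consv_sub_lt (t, y) x e).
apply: measurableX; last by apply: open_borel; exact: oball_open.
rewrite (_ : [set _ | _] = `](x 0 ord0 - e), (x 0 ord0 + e)[%classic); first exact: measurable_itv.
by apply/funext => t; rewrite /mkset /= in_itv /= -ltr_distl distrC.
Qed.

Lemma measurable_consv2 (x : R) :
  measurable_fun setT (fun y : BorelRd R d => consv (x, y) : BorelRd R d.+1).
Proof.
apply: (measurableT_comp measurable_consv).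
exact: (@measurable_pair1 _ _ (measurableTypeR R)).
Qed.

End ConsVector.

Lemma negligible_countable dT (T : measurableType dT) (R : realType)
  (m : {measure set T -> \bar R}) (I : countType) (F : I -> set T) :
  (forall i, m.-negligible (F i)) -> m.-negligible (\bigcup_i F i).
Proof.
move=> HF.
pose G (n : nat) := if @unpickle I n is Some i then F i else set0.
apply: (@negligibleS _ _ _ _ (\bigcup_n G n)).
  move=> x [q _ Hx]; exists (pickle q); first exact: Logic.I.
  by rewrite /G pickleK.
apply: negligible_bigcup => n; rewrite /G; case: unpickle => [q|] //.
exact: negligible_set0.
Qed.

(** * The iterated integral as integration against a Borel measure *)

Section IteratedIntegral.
Context {R : realType}.
Local Open Scope ereal_scope.

Lemma measurable_id_completed : measurable_fun setT
  (fun x : caratheodory_type ((wlength (@idfun R))^*)%mu => x : measurableTypeR R).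
Proof.
by move=> _ Y mY; rewrite setTI; exact: sub_caratheodory.
Qed.

Lemma pushforward_measure_ex d1 d2 (T1 : measurableType d1) (T2 : measurableType d2)
  (m : {measure set T1 -> \bar R}) (f : T1 -> T2) : measurable_fun setT f ->
  exists nu : {measure set T2 -> \bar R}, forall A, nu A = m (f @^-1` A).
Proof.
move=> mf.
by exists (measure_function_pushforward__canonical__measure_function_Measure m mf).
Qed.

(** The completed measure lives on a larger sigma-algebra. Pushed forward along the identity it
    becomes a measure on Borel sets equal to [lebesgue_measure], and integrals of nonnegative Borel
    functions are unchanged. *)
Lemma integral_completed_lebesgue (f : measurableTypeR R -> \bar R) :
  measurable_fun setT f -> (forall x, 0 <= f x) ->
  \int[@completed_lebesgue_measure R]_x f x = \int[@lebesgue_measure R]_x f x.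
Proof.
move=> mf f0.
have := ge0_integral_pushforward measurable_id_completed
  (@completed_lebesgue_measure R) measurableT mf (fun x _ => f0 x).
rewrite preimage_setT => <-.
have [nu Hnu] := pushforward_measure_ex
  (@completed_lebesgue_measure R) measurable_id_completed.
transitivity (\int[nu]_x f x).
  by congr integral; apply/funext => A; rewrite Hnu.
by apply: eq_measure_integral => A mA _; rewrite Hnu.
Qed.

Section SigmaFiniteMeasure.
Context d1 (T1 : measurableType d1) (m : {measure set T1 -> \bar R})
  (sm : sigma_finite setT m).

(** The proof of sigma-finiteness is a phantom argument: it lets the instances below attach that
    structure to a measure obtained from an existential. *)
Definition sigma_finite_pack of sigma_finite setT m : set T1 -> \bar R := m.

HB.instance Definition _ := Measure.on (sigma_finite_pack sm).
HB.instance Definition _ :=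
  Measure_isSigmaFinite.Build _ _ _ (sigma_finite_pack sm) sm.

End SigmaFiniteMeasure.

(** By induction on [d], pushing the product of [lebesgue_measure] and the measure in dimension [d]
    through [consv]. Finiteness on balls is carried along because it yields the sigma-finiteness
    that Fubini-Tonelli requires in the next dimension. *)
Lemma lintE d : exists lam : {sigma_finite_measure set (BorelRd R d) -> \bar R},
  [/\ (forall f : BorelRd R d -> \bar R, measurable_fun setT f ->
        (forall x, 0 <= f x) -> lint f = \int[lam]_x f x) &
      (forall n : R, lam [set x | `|x| <= n]%R < +oo)].
Proof.
elim: d => [|d [lam [IH1 IH2]]].
  exists (dirac (0%R : BorelRd R 0)); split.
    by move=> f mf f0 /=; rewrite integral_dirac // diracT mul1e.
  by move=> n; rewrite /= /dirac indicE; case: (_ \in _) => //=; exact: ltry.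
pose phi := (consv : measurableTypeR R * BorelRd R d -> BorelRd R d.+1).
have mphi : measurable_fun setT phi by exact: measurable_consv.
have [nu Hnu] := pushforward_measure_ex
  ((@lebesgue_measure R \x lam)%E) mphi.
have nufin (n : R) : nu [set x | `|x| <= n]%R < +oo.
  rewrite Hnu (_ : _ @^-1` _ = `[(- n)%R, n]%classic `*` [set y | `|y| <= n]%R); last first.
    apply/seteqP; split => -[t y] /=.
      by move=> /consv_norm_le /= [h1 h2]; rewrite in_itv /= -ler_norml.
    rewrite in_itv /= -ler_norml => -[h1 h2].
    by apply/consv_norm_le.
  have mn : measurable ([set y | `|y| <= n]%R : set (BorelRd R d)).
    apply: closed_borel; have := @cball_closed R d 0%R n; congr closed.
    by apply/funext => y; rewrite /mkset sub0r normrN.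
  have mi : measurable (`[(- n)%R, n]%classic : set (measurableTypeR R)) by exact: measurable_itv.
  have E := product_measure1E lebesgue_measure lam mi mn.
  apply: (le_lt_trans (y := (lebesgue_measure `[(- n)%R, n]%classic * lam [set y | `|y| <= n]%R))).
    by move: E => /eqP; rewrite eq_le => /andP [].
  rewrite lte_mul_pinfty //=.
    by rewrite lebesgue_measure_itv /=; case: ifP.
have snu : sigma_finite setT nu.
  exists (fun n : nat => [set x | `|x| <= n%:R]%R).
    apply/seteqP; split => // x _.
    have [n hn] : exists n : nat, (`|x| <= n%:R)%R.
      by exists (Num.bound `|x|); rewrite ltW // archi_boundP.
    by exists n.
  move=> i; split; last exact: nufin.
  apply: closed_borel; have := @cball_closed R d.+1 0%R i%:R; congr closed.
  by apply/funext => y; rewrite /mkset sub0r normrN.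
pose nu' : {sigma_finite_measure set (BorelRd R d.+1) -> \bar R} := sigma_finite_pack snu.
have Hnu' A : nu' A = nu A by [].
exists nu'; split; last by move=> n; rewrite Hnu'; exact: nufin.
move=> f mf f0.
transitivity (\int[nu]_x f x); last by [].
transitivity (\int[pushforward (@lebesgue_measure R \x lam) phi]_x f x); last first.
  by congr integral; apply/funext => A; rewrite Hnu.
rewrite ge0_integral_pushforward // preimage_setT.
have mfp : measurable_fun setT (f \o phi) by exact: measurableT_comp.
rewrite fubini_tonelli1 //=.
have mF := measurable_fun_fubini_tonelli_F (m2 := lam) (f \o phi) mfp (fun x => f0 (phi x)).
rewrite /fubini_F in mF *.
rewrite -integral_completed_lebesgue //; last first.
  by move=> x; apply: integral_ge0 => y _; exact: f0.
apply: eq_integral => x _.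
rewrite IH1 //.
exact: (measurableT_comp mf (measurable_consv2 x)).
Qed.

Definition leb d : {sigma_finite_measure set (BorelRd R d) -> \bar R} :=
  projT1 (cid (lintE d)).

Lemma leb_lint d (f : BorelRd R d -> \bar R) : measurable_fun setT f ->
  (forall x, 0 <= f x) -> lint f = \int[leb d]_x f x.
Proof. by rewrite /leb; case: cid => lam /= [h _]; exact: h. Qed.

Lemma measurable_EFin_indic d (A : set (BorelRd R d)) : measurable A ->
  measurable_fun setT (fun x : BorelRd R d => (\1_A x)%:E : \bar R).
Proof. by move=> mA; apply/measurable_EFinP; exact: measurable_indic. Qed.

Lemma indic_ge0 T (A : set T) (x : T) : 0%:E <= (\1_A x : R)%:E.
Proof. by rewrite lee_fin indicE. Qed.
Hint Resolve indic_ge0 : core.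

Lemma measure_int_indic dT (T : measurableType dT) (m : {measure set T -> \bar R})
  (A : set T) : measurable A -> m A = \int[m]_x (\1_A x)%:E.
Proof. by move=> mA; rewrite integral_indic // setIT. Qed.

Lemma lebE d (A : set (BorelRd R d)) : measurable A -> lebd A = leb d A.
Proof.
move=> mA; rewrite /lebd leb_lint //; last exact: measurable_EFin_indic.
by rewrite integral_indic // setIT.
Qed.

Lemma measurable_slice d (f : BorelRd R d.+1 -> \bar R) (x : R) :
  measurable_fun setT f ->
  measurable_fun setT (fun y : BorelRd R d => f (consv (x, y))).
Proof. move=> mf; exact: (measurableT_comp mf (measurable_consv2 x)). Qed.

Lemma measurable_sliceset d (A : set (BorelRd R d.+1)) (x : R) :
  measurable A -> measurable ([set y | A (consv (x, y))] : set (BorelRd R d)).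
Proof.
move=> mA; have := measurable_consv2 (d := d) x measurableT mA.
by rewrite setTI.
Qed.

Lemma measurable_consint d (f : BorelRd R d.+1 -> \bar R) :
  measurable_fun setT f -> (forall x, 0 <= f x) ->
  measurable_fun setT (fun x : measurableTypeR R => \int[leb d]_y f (consv (x, y))).
Proof.
move=> mf f0.
have mphi := @measurable_consv R d.
pose phi := (consv : measurableTypeR R * BorelRd R d -> BorelRd R d.+1).
have mfp : measurable_fun setT (f \o phi) by exact: measurableT_comp.
exact: (measurable_fun_fubini_tonelli_F (m2 := leb d) (f \o phi) mfp (fun x => f0 (phi x))).
Qed.

Lemma leb_cons_int d (f : BorelRd R d.+1 -> \bar R) :
  measurable_fun setT f -> (forall x, 0 <= f x) ->
  \int[leb d.+1]_x f x =
  \int[@lebesgue_measure R]_x \int[leb d]_y f (consv (x, y)).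
Proof.
move=> mf f0; rewrite -leb_lint //= -integral_completed_lebesgue //.
- by apply: eq_integral => x _; rewrite leb_lint //; exact: measurable_slice.
- exact: measurable_consint.
- by move=> x; exact: integral_ge0.
Qed.

Lemma leb_cons_int_swap d (f : BorelRd R d.+1 -> \bar R) :
  measurable_fun setT f -> (forall x, 0 <= f x) ->
  \int[leb d.+1]_x f x =
  \int[leb d]_y \int[@lebesgue_measure R]_x f (consv (x, y)).
Proof.
move=> mf f0; rewrite leb_cons_int //.
have mphi := @measurable_consv R d.
pose phi := (consv : measurableTypeR R * BorelRd R d -> BorelRd R d.+1).
have mfp : measurable_fun setT (f \o phi) by exact: measurableT_comp.
exact: (fubini_tonelli (m1 := @lebesgue_measure R) (m2 := leb d) (f \o phi) mfp (fun x => f0 (phi x))).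
Qed.

Lemma leb_cons d (A : set (BorelRd R d.+1)) : measurable A ->
  leb d.+1 A = \int[@lebesgue_measure R]_x leb d [set y | A (consv (x, y))].
Proof.
move=> mA.
have mi := measurable_EFin_indic mA.
rewrite [LHS]measure_int_indic // leb_cons_int //.
apply: eq_integral => x _.
by rewrite [RHS]measure_int_indic //; exact: measurable_sliceset.
Qed.

Lemma lint_ge0 d (f : 'rV[R]_d -> \bar R) : (forall x, 0 <= f x) -> 0 <= lint f.
Proof.
elim: d f => [|d IH] f f0 /=; first exact: f0.
by apply: integral_ge0 => t _; apply: IH => y; exact: f0.
Qed.

(** No measurability is asked of [f], since indicators of subdifferential images are known to be
    measurable only up to a null set. Almost every slice of [N] is null, so by induction the slice
    integrals of [f] and [g] agree almost everywhere. *)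
Lemma lint_ae d (f g : 'rV[R]_d -> \bar R) (N : set (BorelRd R d)) :
  measurable N -> leb d N = 0 ->
  measurable_fun setT (g : BorelRd R d -> \bar R) ->
  (forall x, 0 <= f x) -> (forall x, 0 <= g x) ->
  (forall x, ~ N x -> f x = g x) -> lint f = lint g.
Proof.
elim: d f g N => [|d IH] f g N mN N0 mg f0 g0 fg.
  rewrite /=; apply: fg => N0'.
  have : lebd N = 0 by rewrite lebE.
  rewrite /lebd /= indicE (mem_set (N0' : (N : set 'rV[R]_0) 0%R)) => /eqP.
  by rewrite eqe oner_eq0.
have mi := measurable_EFin_indic mN.
pose NN x := leb d [set y | N (consv (x, y))].
have NE x : \int[leb d]_y (\1_N (consv (x, y)))%:E = NN x.
  by rewrite /NN [RHS]measure_int_indic //; exact: measurable_sliceset.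
have mNN : measurable_fun setT (NN : measurableTypeR R -> \bar R).
  have := measurable_consint mi (fun x => indic_ge0 _ _).
  by congr measurable_fun; apply/funext => x; exact: NE.
have NNae : ae_eq (@lebesgue_measure R) setT NN (cst 0).
  apply/ae_eq_integral_abs => //.
  rewrite -[RHS]N0 leb_cons //; apply: eq_integral => x _.
  by rewrite gee0_abs // /NN measure_ge0.
pose F x := lint (fun y => f (consv (x, y))).
pose G x := lint (fun y => g (consv (x, y))).
have FG x : NN x = 0 -> F x = G x.
  move=> NNx; apply: (IH _ _ [set y | N (consv (x, y))]) => //.
  - exact: measurable_sliceset.
  - exact: measurable_slice.
  - by move=> y Ny; apply: fg.
have F0 x : 0 <= F x.
  by rewrite /F; apply: lint_ge0 => y; exact: f0.
have GE x : G x = \int[leb d]_y g (consv (x, y)).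
  by rewrite /G leb_lint //; exact: measurable_slice.
have G0 x : 0 <= G x by rewrite GE; exact: integral_ge0.
have mG : measurable_fun setT (G : measurableTypeR R -> \bar R).
  rewrite (_ : G = (fun x => \int[leb d]_y g (consv (x, y)))); last exact/funext.
  exact: measurable_consint.
pose CT := caratheodory_type ((wlength (@idfun R))^*)%mu.
have mGc : measurable_fun setT (G : CT -> \bar R).
  exact: (measurableT_comp mG measurable_id_completed).
have FGae : ae_eq (@completed_lebesgue_measure R) setT (G : CT -> \bar R) F.
  case: NNae => M [mM M0 HM]; exists M; split => //.
    exact: sub_caratheodory.
  apply: subset_trans HM => x /= H H2; apply: H => _; symmetry; apply: FG.
  exact: H2.
(* Completeness of the one-dimensional measure makes [F] measurable although [f] need not be. *)
have mF := ae_measurable_fun completed_lebesgue_measure_is_complete FGae mGc.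
apply: ge0_ae_eq_integral.
- exact: measurableT.
- exact: mF.
- exact: mGc.
- by move=> x _; exact: F0.
- by move=> x _; exact: G0.
- exact: ae_eq_sym.
Qed.

(** Fubini with coordinate [i] integrated innermost: a line parallel to that axis meets [S] in at
    most one point. Coordinates before [i] are removed by slicing. *)
Lemma leb_line_null d (S : set (BorelRd R d)) (i : 'I_d) : measurable S ->
  (forall x y : 'rV[R]_d, S x -> S y -> (forall j, j != i -> x 0%R j = y 0%R j) -> x = y) ->
  leb d S = 0.
Proof.
elim: d S i => [S []//|d IH] S i mS HS.
case: (unliftP ord0 i) => [j ij|i0].
  rewrite leb_cons // -[RHS](integral0 (@lebesgue_measure R) setT).
  apply: eq_integral => x _; apply: (IH _ j); first exact: measurable_sliceset.
  move=> y y' /= Sy Sy' yy'.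
  have E : consv (x, y) = consv (x, y').
    apply: HS => // k; rewrite ij.
    case: (unliftP ord0 k) => [l|] -> kj; last by rewrite !consv0.
    by rewrite !consvS yy' //; apply: contra kj => /eqP ->.
  apply/rowP => l.
  by have := congr1 (fun v : 'rV[R]_d.+1 => v 0%R (lift ord0 l)) E; rewrite /= !consvS.
have mi := measurable_EFin_indic mS.
rewrite [LHS]measure_int_indic // leb_cons_int_swap //.
rewrite -[RHS](integral0 (leb d) setT); apply: eq_integral => y _.
have [[x0 Sx0]|nS] := pselect (exists x, S (consv (x, y))).
  rewrite -[RHS](@lebesgue_measure_set1 R x0) [RHS]measure_int_indic //.
  apply: eq_integral => x _; congr (_%:E).
  rewrite !indicE; congr (_%:R); congr nat_of_bool.
  apply/idP/idP; rewrite !inE /=; last by move=> ->.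
  move=> Sx; have E : consv (x, y) = consv (x0, y).
    apply: HS => // k; rewrite i0.
    by case: (unliftP ord0 k) => [l|] -> //; rewrite !consvS.
  by have := congr1 (fun v : 'rV[R]_d.+1 => v 0%R ord0) E; rewrite /= !consv0.
rewrite -[RHS](integral0 (@lebesgue_measure R) setT); apply: eq_integral => x _.
by rewrite indicE memNset //= => Sx; apply: nS; exists x.
Qed.

Lemma leb_ball_gt0 d (x : 'rV[R]_d) (e : R) : (0 < e)%R ->
  0 < leb d [set y | `|x - y| < e]%R.
Proof.
move=> e0; elim: d x => [|d IH] x.
  have mB := open_borel (@oball_open R 0 x e).
  rewrite -lebE // /lebd /= indicE mem_set // /=.
  by apply/rV_norm_lt; split => // -[].
have mB := open_borel (@oball_open R d.+1 x e).
pose x' : 'rV[R]_d := (\row_i x 0%R (lift ord0 i))%R.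
pose I : set (measurableTypeR R) := `](x 0%R ord0 - e)%R, (x 0%R ord0 + e)%R[%classic.
have mI : measurable I by exact: measurable_itv.
rewrite leb_cons // (eq_integral (fun t => (\1_I t)%:E * leb d [set y | `|x' - y| < e]%R)).
  rewrite ge0_integralZr //; last exact/measurable_EFinP/measurable_indic.
  rewrite integral_indic // setIT; apply: mule_gt0 => //.
  apply: (lt_le_trans (y := (e + e)%:E)); first by rewrite lte_fin; lra.
  have := @lebesgue_measure_itv R (Interval (BRight (x 0%R ord0 - e)%R) (BLeft (x 0%R ord0 + e)%R)).
  rewrite /= lte_fin ifT; last by lra.
  by move=> E; move: (eq_refl (lebesgue_measure I)); rewrite {1}/I E eq_le => /andP [E1 _]; apply: le_trans E1; rewrite -EFinB lee_fin; lra.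
move=> t _; rewrite indicE; have [tI|tI] := boolP (t \in I).
  rewrite mul1e; congr (leb d _); apply/funext => y; apply/propext.
  rewrite /= consv_sub_lt /=; split => [[]//|h]; split => //.
  by move: tI; rewrite inE /I /= in_itv /= -ltr_distl distrC.
rewrite mul0e (_ : [set y | _] = set0) ?measure0 //.
apply/seteqP; split => // y /consv_sub_lt [h _]; move: tI => /negP; apply.
by rewrite inE /I /= in_itv /= -ltr_distl distrC.
Qed.

(** Sandwich the superlevel sets at rational levels between Borel sets. The countable union [N] of
    the gaps is null, and [f] set to 0 on [N] is Borel: at nonnegative levels its superlevel sets
    are unions, over rationals, of the inner approximations without [N]. *)
Lemma leb_fun_borel d (f : 'rV[R]_d -> R) : (forall p, 0 < f p)%R -> LebMeasFun f ->
  exists (fb : BorelRd R d -> R) (N : set (BorelRd R d)),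
    [/\ measurable N, leb d N = 0, measurable_fun setT fb,
       (forall x, 0 <= fb x)%R & forall x, ~ N x -> fb x = f x].
Proof.
move=> f0 mf.
have H (q : rat) : exists BB : set (BorelRd R d) * set (BorelRd R d),
    [/\ measurable BB.1, measurable BB.2, BB.1 `<=` [set x | ratr q < f x]%R,
      [set x | ratr q < f x]%R `<=` BB.2 & leb d (BB.2 `\` BB.1) = 0].
  have [B1 [B2 [mB1 [mB2 [h1 [h2 h3]]]]]] := mf (ratr q).
  exists (B1, B2); split => //=.
  by rewrite -h3 lebE //; exact: measurableD.
have [BB HB] := choice H.
pose N := \bigcup_q ((BB q).2 `\` (BB q).1).
have mN : measurable N.
  apply: countable_bigcupT_measurable; first exact: countableP.
  by move=> q; apply: measurableD; have [] := HB q.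
have N0 : leb d N = 0.
  apply/negligibleP => //.
  apply: negligible_countable => q.
  have [m1 m2 _ _ h] := HB q.
  by apply/negligibleP => //; exact: measurableD.
pose fb (x : BorelRd R d) := (f x * \1_(~` N) x)%R.
exists fb, N; split => //.
- apply: (measurability _ (RGenOInfty.measurableE R)) => // _ [_ [a ->] <-].
  rewrite setTI; have [a0|a0] := ltP a 0%R.
    rewrite (_ : _ @^-1` _ = setT); first exact: measurableT.
    apply/seteqP; split => // x _ /=; rewrite in_itv /= andbT.
    by apply: lt_le_trans a0 _; rewrite /fb indicE mulr_ge0 // ltW.
  rewrite (_ : _ @^-1` _ = \bigcup_q (if (a < ratr q)%R then (BB q).1 `\` N else set0)).
    apply: countable_bigcupT_measurable; first exact: countableP.
    move=> q; case: ifP => _; last exact: measurable0.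
    by apply: measurableD => //; have [] := HB q.
  apply/seteqP; split => x /=.
    rewrite in_itv /= andbT /fb indicE; have [xN|xN] := boolP (x \in ~` N); last first.
      by rewrite mulr0 => /(le_lt_trans a0); rewrite ltxx.
    rewrite mulr1 => afx; have [q] := rat_in_itvoo afx.
    rewrite in_itv /= => /andP [h1 h2]; exists q => //; rewrite h1.
    move: xN; rewrite inE => xN; split => //.
    apply: contrapT => nB; apply: xN; exists q => //; split => //.
    by have [_ _ _ h _] := HB q; apply: h.
  move=> [q _]; case: ifPn => // aq [Bx Nx].
  rewrite in_itv /= andbT /fb indicE mem_set // mulr1.
  by apply: lt_trans aq _; have [_ _ h _ _] := HB q; apply: h.
- by move=> x; rewrite /fb indicE mulr_ge0 // ltW.
- by move=> x Nx; rewrite /fb indicE mem_set // mulr1.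
Qed.

End IteratedIntegral.

Section Density.
Context {R : realType} {d : nat}.
Local Open Scope ereal_scope.

(* [lint] uses the completed measure, so [wint A Rf] is matched with [rho] for [A] Borel up to a null set.
   The last clause kills sets that meet every line parallel to some axis at most once. *)
Definition is_density (Rf : 'rV[R]_d -> R)
    (rho : {measure set (BorelRd R d) -> \bar R}) : Prop :=
  [/\ (forall (A : set 'rV[R]_d) (B N : set (BorelRd R d)), measurable B -> measurable N ->
          rho N = 0 -> B `<=` A -> A `<=` B `|` N -> wint A Rf = rho B),
      (forall n : R, rho [set x | `|x| <= n]%R < +oo),
      (forall (x : 'rV[R]_d) (e : R), (0 < e)%R -> 0 < rho [set y | `|x - y| < e]%R) &
      (forall (S : set (BorelRd R d)) (i : 'I_d), measurable S ->
        (forall x y : 'rV[R]_d, S x -> S y ->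
            (forall j, j != i -> x 0%R j = y 0%R j) -> x = y) -> rho S = 0)].

(** Integrate a Borel version [Rb] of [Rf] against Lebesgue measure. As [Rf] is positive, [rho] and
    Lebesgue measure have the same Borel null sets; this gives both the positivity on balls and the
    comparison of [wint] with [rho]. *)
Lemma density_exists (Rf : 'rV[R]_d -> R) : (forall p, 0 < Rf p)%R -> L1loc Rf ->
  exists rho, is_density Rf rho.
Proof.
move=> Rf0 [mRf iRf].
have [Rb [N0 [mN0 N00 mRb Rb0 RbE]]] := leb_fun_borel Rf0 mRf.
pose Re (x : BorelRd R d) := (Rb x)%:E.
have mRe : measurable_fun setT Re by exact/measurable_EFinP.
have Re0 x : 0 <= Re x by rewrite lee_fin.
pose nu A := \int[leb d]_(x in A) Re x.
have nu0 : nu set0 = 0 by exact: integral_set0.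
have nu_ge0 A : 0 <= nu A by apply: integral_ge0 => x _.
have nu_sa : semi_sigma_additive nu by exact: semi_sigma_additive_nng_induced.
pose nuM := isMeasure.Build _ _ _ nu nu0 nu_ge0 nu_sa.
pose rho : {measure set (BorelRd R d) -> \bar R} := HB.pack nu nuM.
have null1 (N : set (BorelRd R d)) : measurable N -> leb d N = 0 -> rho N = 0.
  move=> mN hN; have := @integral_abs_eq0 _ _ _ (leb d) N Re mN (measurable_funTS mRe) hN.
  by under eq_integral do rewrite gee0_abs //.
have null2 (N : set (BorelRd R d)) : measurable N -> rho N = 0 -> leb d N = 0.
  move=> mN hN.
  have mReN : measurable_fun N Re by exact: measurable_funTS.
  have : \int[leb d]_(x in N) `|Re x| = 0.
    by rewrite -hN; apply: eq_integral => x _; rewrite gee0_abs.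
  move=> /(ae_eq_integral_abs _ mN mReN) [M [mM M0 HM]].
  apply/negligibleP => //; apply: (@negligibleS _ _ _ _ (M `|` N0)).
    move=> x Nx; apply: contrapT => /not_orP [Mx Nx0]; apply: Mx; apply: HM => /= /(_ Nx).
    rewrite /Re RbE // => /eqP; rewrite eqe => /eqP E.
    by have := Rf0 x; rewrite E ltxx.
  by apply: negligibleU; apply/negligibleP.
exists rho.
have sand (A : set 'rV[R]_d) (B N : set (BorelRd R d)) : measurable B -> measurable N ->
    rho N = 0 -> B `<=` A -> A `<=` B `|` N -> wint A Rf = rho B.
  move=> mB mN hN BA ABN; rewrite /wint.
  rewrite (lint_ae (g := fun x => (\1_B x * Rb x)%:E) (N := N `|` N0)).
  - rewrite leb_lint; last 2 first.
    + apply/measurable_EFinP; apply: measurable_funM => //; exact: measurable_indic.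
    + by move=> x; rewrite lee_fin indicE mulr_ge0.
    rewrite /rho /= /nu [RHS]integral_mkcond epatch_indic; apply: eq_integral => x _.
    by rewrite /Re -EFinM mulrC.
  - exact: measurableU.
  - apply/negligibleP; first exact: measurableU.
    by apply: negligibleU; apply/negligibleP => //; exact: null2.
  - by apply/measurable_EFinP; apply: measurable_funM => //; exact: measurable_indic.
  - by move=> x; rewrite lee_fin indicE mulr_ge0 // ltW.
  - by move=> x; rewrite lee_fin indicE mulr_ge0.
  - move=> x /not_orP [Nx N0x]; rewrite RbE // !indicE; congr ((_%:R * _)%:E).
    congr nat_of_bool; apply/idP/idP; rewrite !inE; last exact: BA.
    by move=> /ABN [].
have cK (n : R) : closed [set x : 'rV[R]_d | `|x| <= n]%R.
  have := @cball_closed R d 0%R n; congr closed.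
  by apply/funext => y; rewrite /mkset sub0r normrN.
split => //.
- move=> n; have mK := closed_borel (cK n).
  have <- : wint [set x | `|x| <= n]%R Rf = rho [set x | `|x| <= n]%R.
    by apply: (sand _ _ set0) => // x; left.
  have := iRf [set x | `|x| <= n]%R; rewrite (_ : (fun p => `|Rf p|)%R = Rf); last first.
    by apply/funext => p; rewrite gtr0_norm.
  apply; apply: bounded_closed_compact => //.
  by exists n; split; [exact: num_real|move=> M nM x /= /le_trans; apply; exact: ltW].
- move=> x e e0; rewrite lt0e nu_ge0 andbT; apply/eqP => /null2 h.
  have := leb_ball_gt0 x e0; rewrite h ?ltxx //.
  by apply: open_borel; exact: oball_open.
- by move=> S i mS HS; apply: null1 => //; exact: leb_line_null HS.
Qed.

End Density.

(** * Bounded convex functions *)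

Lemma continuous_rVP {R : realType} {d : nat} (f : 'rV[R]_d -> R) x :
  (forall e, 0 < e -> exists2 r, 0 < r & forall y, `|y - x| < r -> `|f y - f x| < e) ->
  {for x, continuous f}.
Proof.
move=> H; apply/(@cvgrPdist_lt R R 'rV[R]_d (nbhs x) (nbhs_filter x) f (f x)) => e e0.
have [r r0 Hr] := H e e0.
apply/nbhs_ballP; exists r => //= y; rewrite ball_rVE /= distrC => /Hr.
by rewrite distrC.
Qed.

Section DotProduct.
Context {R : realType} {d : nat}.
Implicit Types (x y z p q : 'rV[R]_d).

Lemma dotpDr p x y : dotp p (x + y) = dotp p x + dotp p y.
Proof.
rewrite /dotp -big_split /=; apply: eq_bigr => i _.
by rewrite !mxE mulrDr.
Qed.

Lemma dotpC p x : dotp p x = dotp x p.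
Proof. by rewrite /dotp; apply: eq_bigr => i _; rewrite mulrC. Qed.

Lemma dotpZr p x a : dotp p (a *: x) = a * dotp p x.
Proof.
rewrite /dotp mulr_sumr; apply: eq_bigr => i _.
by rewrite !mxE mulrCA.
Qed.

Lemma dotpNr p x : dotp p (- x) = - dotp p x.
Proof. by rewrite -scaleN1r dotpZr mulN1r. Qed.

Lemma dotpBr p x y : dotp p (x - y) = dotp p x - dotp p y.
Proof. by rewrite dotpDr dotpNr. Qed.

Lemma dotpDl p q x : dotp (p + q) x = dotp p x + dotp q x.
Proof. by rewrite dotpC dotpDr ![dotp x _]dotpC. Qed.

Lemma dotpZl p x a : dotp (a *: p) x = a * dotp p x.
Proof. by rewrite dotpC dotpZr dotpC. Qed.

Lemma dotpNl p x : dotp (- p) x = - dotp p x.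
Proof. by rewrite dotpC dotpNr dotpC. Qed.

Lemma dotpBl p q x : dotp (p - q) x = dotp p x - dotp q x.
Proof. by rewrite dotpDl dotpNl. Qed.

Lemma dotp0r p : dotp p 0 = 0.
Proof. by rewrite -(scale0r 0) dotpZr mul0r. Qed.

Lemma dotp0l p : dotp 0 p = 0.
Proof. by rewrite dotpC dotp0r. Qed.

Lemma dotp_le p x : `|dotp p x| <= d%:R * `|p| * `|x|.
Proof.
apply: le_trans (ler_norm_sum _ _ _) _.
apply: (@le_trans _ _ (\sum_(i < d) `|p| * `|x|)).
  by apply: ler_sum => i _; rewrite normrM ler_pM // rV_coord_le.
by rewrite sumr_const card_ord -[X in X <= _]mulr_natl mulrA.
Qed.

Lemma dotp_delta p i a : dotp p (a *: delta_mx 0 i) = a * p 0 i.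
Proof.
rewrite dotpZr; congr (_ * _); rewrite /dotp (bigD1 i) //= mxE !eqxx mulr1.
by rewrite big1 ?addr0 // => j ji; rewrite mxE (negbTE ji) andbF mulr0.
Qed.

Lemma norm_delta_le (i : 'I_d) : `|delta_mx 0 i : 'rV[R]_d| <= 1.
Proof.
apply/rV_norm_le; split => // j; rewrite mxE.
by case: (_ && _) => /=; rewrite ?normr1 ?normr0.
Qed.

Lemma dotp_continuous p : continuous (fun x : 'rV[R]_d => dotp p x : R).
Proof.
move=> x; apply: continuous_rVP => e e0.
pose k := (d%:R * `|p| + 1 : R).
have k0 : 0 < k by rewrite /k ltr_wpDl // mulr_ge0.
exists (e / k); first exact: divr_gt0.
move=> y xy; rewrite -dotpBr.
apply: le_lt_trans (dotp_le _ _) _.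
apply: (@le_lt_trans _ _ (k * `|y - x|)); first by rewrite ler_wpM2r // /k lerDl.
by rewrite mulrC -ltr_pdivlMr.
Qed.

Lemma dotp_near p e : 0 < e ->
  exists2 r, 0 < r & forall x y, `|x - y| < r -> `|dotp p x - dotp p y| <= e.
Proof.
move=> e0; pose L := d%:R * `|p| + 1.
have L0 : 0 < L by rewrite /L ltr_wpDl // mulr_ge0.
exists (e / L); first by rewrite divr_gt0.
move=> x y xy; rewrite -dotpBr; apply: le_trans (dotp_le p (x - y)) _.
apply: le_trans (_ : L * `|x - y| <= _); first by rewrite ler_wpM2r // /L lerDl.
by rewrite mulrC -ler_pdivlMr // ltW.
Qed.

End DotProduct.

(** * Erosions and compact exhaustion *)

Section Erosion.
Context {R : realType} {d : nat}.
Implicit Types (x y z p q : 'rV[R]_d) (A K D : set 'rV[R]_d) (r s : R).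

(** The points at sup-distance at least [r] from the complement of [A]. With open balls this set is
    closed whatever [A] is, so a bounded open set is exhausted by compact erosions. *)
Definition erode A r : set 'rV[R]_d := [set x | forall y, `|y - x| < r -> A y].

Lemma erode_sub A r : 0 < r -> erode A r `<=` A.
Proof. by move=> r0 x; apply; rewrite subrr normr0. Qed.

Lemma erode_mono A A' r s : A `<=` A' -> s <= r -> erode A r `<=` erode A' s.
Proof. by move=> AA' sr x Hx y yx; apply: AA'; apply: Hx; exact: lt_le_trans yx sr. Qed.

Lemma erode_near A r s x y : erode A r x -> `|y - x| <= s -> erode A (r - s) y.
Proof.
move=> Hx yx z zy; apply: Hx.
rewrite (_ : z - x = (z - y) + (y - x)); last by rewrite addrA subrK.
by apply: le_lt_trans (ler_normD _ _) _; lra.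
Qed.

Lemma closed_seqP A : (forall x, (forall e, 0 < e -> exists y, A y /\ `|y - x| < e) -> A x) ->
  closed A.
Proof.
move=> H x cx; apply: H => e e0.
have [y [Ay]] := cx _ (nbhsx_ballx x e e0).
by rewrite ball_rVE /= => xy; exists y; rewrite distrC.
Qed.

Lemma open_ballP A : open A <-> (forall x, A x -> exists2 e, 0 < e & forall y, `|y - x| < e -> A y).
Proof.
split.
  move=> oA x Ax; have [e /= e0 He] := (@nbhs_ballP R _ x A).1 (open_nbhs_nbhs (conj oA Ax)).
  by exists e => // y yx; apply: He; rewrite ball_rVE /= distrC.
move=> H; rewrite openE => x Ax; have [e e0 He] := H x Ax.
apply/nbhs_ballP; exists e => //= y; rewrite ball_rVE /= distrC; exact: He.
Qed.

Lemma erode_closed A r : closed (erode A r).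
Proof.
apply: closed_seqP => x H y yx.
have [z [Hz zx]] := H (r - `|y - x|) ltac:(lra).
apply: Hz; rewrite (_ : y - z = (y - x) + (x - z)); last by rewrite addrA subrK.
by apply: le_lt_trans (ler_normD _ _) _; rewrite (distrC x z); lra.
Qed.

Lemma bounded_compact A B : closed A -> (forall x, A x -> `|x| <= B) -> compact A.
Proof.
move=> cA bA; apply: bounded_closed_compact => //.
by exists B; split; [exact: num_real|move=> M nM x /bA /le_trans; apply; exact: ltW].
Qed.

Lemma erode_compact A B r : 0 < r -> (forall x, A x -> `|x| <= B) -> compact (erode A r).
Proof.
move=> r0 bA; apply: (@bounded_compact _ B); first exact: erode_closed.
by move=> x /(erode_sub r0); exact: bA.
Qed.

Lemma open_erode A x : open A -> A x -> exists n : nat, erode A n.+1%:R^-1 x.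
Proof.
move=> /open_ballP /[apply] -[e e0 He].
have [n] := ltr_add_invr e0; rewrite add0r => ne.
by exists n => y yx; apply: He; exact: lt_trans ne.
Qed.

Lemma open_bigcup_erode A : open A -> A = \bigcup_n erode A n.+1%:R^-1.
Proof.
move=> oA; apply/seteqP; split.
  by move=> x Ax; have [n] := open_erode oA Ax; exists n.
by move=> x [n _]; apply: erode_sub; rewrite invr_gt0 ltr0n.
Qed.

Lemma compact_erode K A : compact K -> open A -> K `<=` A ->
  exists2 r, 0 < r & K `<=` erode A r.
Proof.
move=> cK oA KA.
have := (@compact_near_coveringP _ K).1 cK R (0^'+) (fun r x => erode A r x) _.
have H : forall x, K x -> \forall x' \near x & i \near 0^'+, erode A i x'.
  move=> x Kx; have [e e0 He] := (open_ballP A).1 oA x (KA x Kx).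
  have e2 : 0 < e / 2 by lra.
  exists (ball x (e / 2), [set r | r < e / 2]); first split => /=.
  - exact: nbhsx_ballx.
  - exact: nbhs_right_lt.
  move=> [y r] /= []; rewrite ball_rVE /= => xy re z zy; apply: He.
  rewrite (_ : z - x = (z - y) + (y - x)); last by rewrite addrA subrK.
  by apply: le_lt_trans (ler_normD _ _) _; rewrite (distrC y x); lra.
move=> /(_ _ H) HH.
have [r [r0 Hr]] : exists r, 0 < r /\ K `<=` erode A r.
  have h0 : \forall r \near 0^'+, 0 < r :> R by exact: nbhs_right_gt.
  have [r [? ?]] := @filter_ex _ _ (at_right_proper_filter (0 : R)) _ (filterI h0 HH).
    by exists r.
by exists r.
Qed.

End Erosion.

Section BoundedConvex.
Context {R : realType} {d : nat}.
Implicit Types (x y z p q : 'rV[R]_d) (A K D : set 'rV[R]_d) (u v : 'rV[R]_d -> R).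

Definition bcf D u := [/\ open D, convex_setE D, (exists B, forall x, D x -> `|x| <= B),
  convex_fun_on D u & exists m M, forall x, D x -> m <= u x <= M].

(** Prolong the segment from [x] to [y] beyond [y] by a length [s'], staying in [D]: convexity
    bounds the slope up to [y] by the slope after [y]. Only [y] has to be deep inside [D]. *)
Lemma convex_lip D u m M (s : R) x y : convex_fun_on D u ->
  (forall x, D x -> m <= u x <= M) -> 0 < s -> D x -> erode D s y ->
  u y - u x <= (M - m) / s * `|y - x|.
Proof.
move=> cu bu s0 Dx Hy.
have mM : m <= M by have /andP [h1 h2] := bu x Dx; exact: le_trans h1 h2.
have [->|yx] := eqVneq y x; first by rewrite !subrr normr0 mulr0.
pose t := `|y - x|.
have t0 : 0 < t by rewrite normr_gt0 subr_eq0.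
have key (s' : R) : 0 < s' -> s' < s -> s' * (u y - u x) <= (M - m) * t.
  move=> s'0 s's.
  pose z := y + (s' / t) *: (y - x).
  have zy : `|z - y| = s'.
    rewrite /z addrC addKr normrZ ger0_norm ?divr_ge0 // ?ltW //.
    by rewrite -mulrA mulVf ?mulr1 // gt_eqF.
  have Dz : D z by apply: Hy; rewrite zy.
  have st0 : s' + t != 0 by rewrite gt_eqF // addr_gt0.
  have yE : y = (s' / (s' + t)) *: x + (1 - s' / (s' + t)) *: z.
    rewrite /z; apply/rowP => i; rewrite !mxE; field.
    by rewrite st0 gt_eqF.
  have h01 : 0 <= s' / (s' + t) <= 1.
    have st1 : 0 < s' + t by exact: addr_gt0.
    apply/andP; split; first by rewrite divr_ge0 // ltW.
    by rewrite ler_pdivrMr // mul1r lerDl ltW.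
  have := cu x z Dx Dz _ h01; rewrite -yE => h.
  have /andP [_ uz] := bu z Dz; have /andP [ux _] := bu x Dx.
  have h2 : (s' + t) * u y <= s' * u x + t * u z.
    rewrite -ler_pdivlMl ?addr_gt0 //; apply: le_trans h _.
    by rewrite le_eqVlt; apply/orP; left; apply/eqP; field.
  have h3 : t * u z <= t * M by rewrite ler_wpM2l // ltW.
  have h4 : t * (u x - m) >= 0 by rewrite mulr_ge0 ?subr_ge0 // ltW.
  have [uyx|uyx] := leP (u y - u x) 0.
    apply: (@le_trans _ _ 0); first by rewrite mulr_ge0_le0 // ltW.
    by rewrite mulr_ge0 ?subr_ge0 // ltW.
  have h5 : 0 < t * (u y - u x) by rewrite mulr_gt0.
  lra.
(* [erode] only controls lengths [s' < s]; let [s'] tend to [s]. *)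
have : s * (u y - u x) <= (M - m) * t.
  have [h0|h0] := leP (u y - u x) 0.
    apply: (@le_trans _ _ 0); first by rewrite mulr_ge0_le0 // ltW.
    by rewrite mulr_ge0 ?subr_ge0 // ltW.
  apply/ler_addgt0Pr => e e0.
  pose s' := Num.max (s / 2) (s - e / (u y - u x)).
  have e1 : 0 < e / (u y - u x) by rewrite divr_gt0.
  have s'0 : 0 < s' by rewrite /s' lt_max; apply/orP; left; lra.
  have s's : s' < s by rewrite /s' gt_max; apply/andP; split; lra.
  have h := key s' s'0 s's.
  have h1 : s - e / (u y - u x) <= s' by rewrite /s' le_max lexx orbT.
  have h2 : (s - e / (u y - u x)) * (u y - u x) <= s' * (u y - u x) by rewrite ler_wpM2r // ltW.
  have h3 : (s - e / (u y - u x)) * (u y - u x) = s * (u y - u x) - e.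
    by rewrite mulrBl mulfVK // gt_eqF.
  by rewrite h3 in h2; lra.
by move=> h; rewrite mulrAC ler_pdivlMr // mulrC.
Qed.

Lemma bcf_lip D u m M (s : R) x y : convex_fun_on D u ->
  (forall x, D x -> m <= u x <= M) -> 0 < s -> erode D s x -> erode D s y ->
  `|u y - u x| <= (M - m) / s * `|y - x|.
Proof.
move=> cu bu s0 ex ey.
have Dx := erode_sub s0 ex; have Dy := erode_sub s0 ey.
rewrite ler_norml; apply/andP; split; last exact: convex_lip cu bu s0 Dx ey.
by rewrite -lerN2 opprK opprB distrC; exact: convex_lip cu bu s0 Dy ex.
Qed.

Lemma bcf_cont D u x (e : R) : bcf D u -> D x -> 0 < e ->
  exists2 r, 0 < r & forall y, `|y - x| < r -> D y /\ `|u y - u x| < e.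
Proof.
move=> [oD cD bD cu [m [M bu]]] Dx e0.
have [s s0 Hs] := (open_ballP D).1 oD x Dx.
have mM : m <= M by have /andP [h1 h2] := bu x Dx; exact: le_trans h1 h2.
pose k := (M - m) / (s / 2) + 1.
have k0 : 0 < k by rewrite /k ltr_wpDl // divr_ge0 ?subr_ge0 //; lra.
have ek : 0 < e / k by rewrite divr_gt0.
exists (Num.min (s / 2) (e / k)); first by rewrite lt_min ek andbT; lra.
move=> y; rewrite lt_min => /andP [y1 y2].
have ex : erode D (s / 2) x by move=> z zx; apply: Hs; lra.
have ey : erode D (s / 2) y.
  rewrite (_ : s / 2 = s - s / 2); last by lra.
  by apply: (@erode_near _ _ _ _ _ x) => //; exact: ltW.
have s2 : 0 < s / 2 by lra.
split; first exact: (erode_sub s2 ey).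
have := bcf_lip cu bu s2 ex ey => /le_lt_trans; apply.
apply: (@le_lt_trans _ _ (k * `|y - x|)); first by rewrite ler_wpM2r // /k lerDl.
by rewrite mulrC -ltr_pdivlMr.
Qed.

Lemma bcf_continuous D u x : bcf D u -> D x -> {for x, continuous u}.
Proof.
move=> bu Dx; apply: continuous_rVP => e e0.
by have [r r0 Hr] := bcf_cont bu Dx e0; exists r => // y /Hr [_].
Qed.

Lemma bcf_within D u K : bcf D u -> K `<=` D -> {within K, continuous u}.
Proof.
move=> bu KD; apply: continuous_in_subspaceT => x; rewrite inE => /KD Dx.
exact: bcf_continuous bu Dx.
Qed.

Lemma compact_min K u p : K !=set0 -> compact K -> {within K, continuous u} ->
  exists2 x, K x & forall y, K y -> u x - dotp p x <= u y - dotp p y.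
Proof.
move=> K0 cK cu.
have [|x xK Hx] := @EVT_min_rV R d (fun x => u x - dotp p x) K K0 cK.
  move=> x; apply: cvgB; first exact: cu.
  by apply: continuous_subspaceT; exact: dotp_continuous.
exists x; first by rewrite inE in xK.
by move=> y Ky; apply: Hx; rewrite inE.
Qed.

(** A local minimum of the convex function [u] minus its tilt is global: shrink the segment from [x]
    to [y] into the ball of radius [r]. *)
Lemma subdiff_local D u x p (r : R) : convex_setE D -> convex_fun_on D u -> D x -> 0 < r ->
  (forall y, D y -> `|y - x| < r -> u x - dotp p x <= u y - dotp p y) -> subdiff D u x p.
Proof.
move=> cD cu Dx r0 H y Dy.
have [->|yx] := eqVneq y x; first by rewrite subrr dotp0r addr0.
have n0 : 0 < `|y - x| by rewrite normr_gt0 subr_eq0.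
pose t := Num.min 1 (r / (2 * `|y - x|)).
have t0 : 0 < t by rewrite lt_min ltr01 divr_gt0 // mulr_gt0.
have t1 : t <= 1 by rewrite ge_min lexx.
have t01 : 0 <= t <= 1 by rewrite ltW.
pose z := t *: y + (1 - t) *: x.
have zx : z - x = t *: (y - x) by apply/rowP => i; rewrite !mxE; ring.
have Dz : D z by apply: cD.
have hz : `|z - x| < r.
  rewrite zx normrZ gtr0_norm //.
  apply: (@le_lt_trans _ _ (r / (2 * `|y - x|) * `|y - x|)).
    by rewrite ler_wpM2r // ge_min lexx orbT.
  rewrite invfM mulrA mulfVK ?gt_eqF //; lra.
have := H z Dz hz; have := cu y x Dy Dx t t01; rewrite -/z => h1 h2.
have h3 : dotp p z = dotp p x + t * dotp p (y - x).
  by rewrite -dotpZr -zx -dotpDr addrC subrK.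
rewrite h3 in h2.
have h4 : t * (u x + dotp p (y - x)) <= t * u y by lra.
by rewrite ler_pM2l in h4.
Qed.

Lemma subdiff_min D u x p y : subdiff D u x p -> D y ->
  u x - dotp p x <= u y - dotp p y.
Proof. by move=> H Dy; have := H y Dy; rewrite dotpBr; lra. Qed.

Lemma subdiff_minE D u x p : (forall y, D y -> u x - dotp p x <= u y - dotp p y) ->
  subdiff D u x p.
Proof. by move=> H y Dy; have := H y Dy; rewrite dotpBr; lra. Qed.

(** Test the subgradient inequality at distance [s / 2] from [x] along both directions of each axis;
    the half keeps these points in [D], as [erode] uses open balls. *)
Lemma subdiff_bound D u m M (s : R) x p : (forall x, D x -> m <= u x <= M) -> 0 < s ->
  erode D s x -> subdiff D u x p -> `|p| <= (M - m) / (s / 2).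
Proof.
move=> bu s0 ex sp.
have Dx := erode_sub s0 ex.
have /andP [mx xM] := bu x Dx.
have s2 : 0 < s / 2 by lra.
have s2i : 0 < (s / 2)^-1 by rewrite invr_gt0.
apply/rV_norm_le; split; first by rewrite divr_ge0 //; lra.
move=> i; rewrite ler_pdivlMr //.
have key (a : R) : `|a| = s / 2 -> a * p 0 i <= M - m.
  move=> ha.
  have Dy : D (x + a *: delta_mx 0 i).
    apply: ex; rewrite addrC addKr normrZ ha.
    by apply: (@le_lt_trans _ _ (s / 2 * 1)); [rewrite ler_wpM2l ?norm_delta_le // ltW|lra].
  have := sp _ Dy; rewrite [X in dotp p (X - _)]addrC addrK dotp_delta.
  by have /andP [h1 h2] := bu _ Dy; lra.
have k1 := key (s / 2) (gtr0_norm s2).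
have k2 := key (- (s / 2)) ltac:(by rewrite normrN gtr0_norm).
have [h|h] := leP 0 (p 0 i); first by rewrite ger0_norm //; lra.
by rewrite ltr0_norm //; lra.
Qed.

End BoundedConvex.

(** * The Monge-Ampere measure of a convex function *)

Lemma measure_lt_bigcup dT (T : measurableType dT) (R : realType)
  (m : {measure set T -> \bar R}) (F : (set T)^nat) (a : \bar R) :
  (forall n, measurable (F n)) -> (forall n k, (n <= k)%N -> F n `<=` F k) ->
  (a < m (\bigcup_n F n))%E -> exists n, (a < m (F n))%E.
Proof.
move=> mF ndF am; apply: contrapT => H.
have cv : m \o F @ \oo --> m (\bigcup_n F n).
  apply: nondecreasing_cvg_mu => //; first exact: bigcupT_measurable.
  by move=> n k nk; apply/subsetPset; exact: ndF.
have : (m (\bigcup_n F n) <= a)%E.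
  move/cvg_lim : (cv) => <- //; apply: lime_le.
    by apply/cvg_ex; eexists; exact: cv.
  by apply: nearW => n /=; rewrite leNgt; apply/negP => h; apply: H; exists n.
by rewrite leNgt am.
Qed.

Lemma measure_bigcap_lt dT (T : measurableType dT) (R : realType)
  (m : {measure set T -> \bar R}) (F : (set T)^nat) (a : \bar R) :
  (forall n, measurable (F n)) -> (forall n k, (n <= k)%N -> F k `<=` F n) ->
  (m (F 0%N) < +oo)%E ->
  (m (\bigcap_n F n) < a)%E -> exists n, (m (F n) < a)%E.
Proof.
move=> mF niF F0 am; apply: contrapT => H.
have cv : m \o F @ \oo --> m (\bigcap_n F n).
  apply: nonincreasing_cvg_mu => //; first exact: bigcapT_measurable.
  by move=> n k nk; apply/subsetPset; exact: niF.
have : (a <= m (\bigcap_n F n))%E.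
  move/cvg_lim : (cv) => <- //; apply: lime_ge.
    by apply/cvg_ex; eexists; exact: cv.
  by apply: nearW => n /=; rewrite leNgt; apply/negP => h; apply: H; exists n.
by rewrite leNgt am.
Qed.

Lemma measure_setU_null dT (T : measurableType dT) (R : realType)
  (m : {measure set T -> \bar R}) (A N : set T) :
  measurable A -> measurable N -> m N = 0%E -> (m (A `|` N) <= m A)%E.
Proof.
move=> mA mN N0; have := measureU2 m mA mN.
by rewrite [X in (_ <= _ + X)%E]N0 adde0.
Qed.

(** * Legendre transforms and slopes with two contact points *)

Section LegendreInf.
Context {R : realType} {d : nat}.
Implicit Types (x y z p q : 'rV[R]_d) (A K D : set 'rV[R]_d) (u v : 'rV[R]_d -> R).

(** Minus the Legendre transform of [u] restricted to [A]. Being Lipschitz in the slope, it turns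
    statements on contact points into closed or open conditions on [p]. *)
Definition tilt_inf u A p : R := inf [set u x - dotp p x | x in A].

Lemma tilt_lb D u A p : bcf D u -> A `<=` D ->
  has_lbound [set u x - dotp p x | x in A].
Proof.
move=> [_ _ [B bB] _ [m [M bu]]] AD; exists (m - d%:R * `|p| * B) => _ [x Ax <-].
have Dx := AD x Ax; have /andP [mu _] := bu x Dx.
apply: lerB => //; apply: le_trans (ler_norm _) _; apply: le_trans (dotp_le _ _) _.
by rewrite ler_wpM2l ?bB // mulr_ge0.
Qed.

Lemma tilt_le D u A p x : bcf D u -> A `<=` D -> A x -> tilt_inf u A p <= u x - dotp p x.
Proof. by move=> bu AD Ax; apply: ge_inf; [exact: tilt_lb bu AD|exists x]. Qed.

Lemma le_tilt u A p c : A !=set0 -> (forall x, A x -> c <= u x - dotp p x) ->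
  c <= tilt_inf u A p.
Proof.
move=> [x0 Ax0] H; apply: lb_le_inf; first by exists (u x0 - dotp p x0), x0.
by move=> _ [x Ax <-]; exact: H.
Qed.

Lemma tilt_lip D u A B p q : bcf D u -> (forall x, D x -> `|x| <= B) -> A `<=` D -> A !=set0 ->
  `|tilt_inf u A p - tilt_inf u A q| <= d%:R * B * `|p - q|.
Proof.
move=> bu bB AD A0.
have key p' q' : tilt_inf u A p' - tilt_inf u A q' <= d%:R * B * `|p' - q'|.
  rewrite lerBlDl -lerBlDr; apply: le_tilt => // x Ax.
  have h1 := tilt_le p' bu AD Ax.
  have h2 : dotp (q' - p') x <= d%:R * B * `|p' - q'|.
    apply: le_trans (ler_norm _) _; apply: le_trans (dotp_le _ _) _.
    by rewrite distrC mulrAC ler_wpM2r // ler_wpM2l // bB //; exact: AD.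
  by rewrite dotpBl in h2; lra.
rewrite ler_norml key andbT lerNl opprB.
by apply: le_trans (key _ _) _; rewrite distrC.
Qed.

Lemma tilt_cont D u A : bcf D u -> A `<=` D -> A !=set0 -> continuous (tilt_inf u A).
Proof.
move=> bu AD A0 p; apply: continuous_rVP => e e0.
have [_ _ [B bB] _ _] := bu.
pose k := (d%:R * `|B| + 1 : R).
have k0 : 0 < k by rewrite /k ltr_wpDl // mulr_ge0.
exists (e / k); first exact: divr_gt0.
have bB' x : D x -> `|x| <= `|B| by move=> /bB /le_trans; apply; exact: ler_norm.
move=> q qp; apply: le_lt_trans (tilt_lip q p bu bB' AD A0) _.
apply: (@le_lt_trans _ _ (k * `|q - p|)); first by rewrite ler_wpM2r // /k lerDl.
by rewrite mulrC -ltr_pdivlMr.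
Qed.

Lemma closed_le_fun (f g : 'rV[R]_d -> R) : continuous f -> continuous g ->
  closed [set p | f p <= g p].
Proof.
move=> cf cg.
rewrite (_ : [set p | _] = (fun p => f p - g p) @^-1` [set t | t <= 0]); last first.
  by apply/funext => p /=; rewrite subr_le0.
apply: closed_comp; last exact: closed_le.
move=> p _; apply: (@cvgB R R 'rV[R]_d (nbhs p) (nbhs_filter p) f g (f p) (g p)).
  exact: cf.
exact: cg.
Qed.

Lemma open_lt_fun (f g : 'rV[R]_d -> R) : continuous f -> continuous g ->
  open [set p | f p < g p].
Proof.
move=> cf cg; rewrite (_ : [set p | _] = ~` [set p | g p <= f p]).
  by rewrite openC; exact: closed_le_fun.
by apply/funext => p /=; apply/propext; split; rewrite ltNge => /negP.
Qed.

(** The infimum over [K] is attained, so a slope supports at a point of [K] exactly when passing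
    from [K] to [D] does not lower the infimum. This makes images of compact sets closed. *)
Lemma subdiff_img_compactE D u K : bcf D u -> compact K -> K `<=` D -> K !=set0 ->
  subdiff_img D u K = [set p | tilt_inf u K p <= tilt_inf u D p].
Proof.
move=> bu cK KD K0; have [x0 Kx0] := K0.
apply/seteqP; split => p /=.
  move=> [x Kx sp]; apply: le_tilt; first by exists x0; exact: KD.
  move=> y Dy; apply: le_trans (tilt_le p bu KD Kx) _.
  exact: subdiff_min sp Dy.
move=> H; have [x Kx Hx] := compact_min p K0 cK (bcf_within bu KD).
exists x => //; apply: subdiff_minE => y Dy.
apply: le_trans (tilt_le p bu (@subset_refl _ D) Dy).
by apply: le_trans H; exact: le_tilt.
Qed.

Lemma subdiff_img_closed D u K : bcf D u -> compact K -> K `<=` D ->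
  closed (subdiff_img D u K).
Proof.
move=> bu cK KD; have [->|/set0P K0] := eqVneq K set0.
  by rewrite /subdiff_img bigcup_set0; exact: closed0.
rewrite (subdiff_img_compactE bu cK KD K0); apply: closed_le_fun.
  exact: tilt_cont bu KD K0.
by apply: (tilt_cont bu) => //; have [x /KD] := K0; exists x.
Qed.

Lemma subdiff_mono D u x y p q : D x -> D y -> subdiff D u x p -> subdiff D u y q ->
  0 <= dotp (q - p) (y - x).
Proof.
move=> Dx Dy sp sq; have := sp y Dy; have := sq x Dx.
rewrite -opprB dotpNr dotpBl; lra.
Qed.

Definition nonuniq D u : set 'rV[R]_d :=
  [set p | exists x y, [/\ D x, D y, x != y, subdiff D u x p & subdiff D u y p]].

Lemma compact_halfspace K i (a : R) : compact K ->
  compact (K `&` [set x | x 0 i <= a]) /\ compact (K `&` [set x | a <= x 0 i]).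
Proof.
move=> cK.
have cc : continuous (fun x : 'rV[R]_d => x 0 i : R).
  move=> x; apply: continuous_rVP => e e0; exists e => // y yx.
  by rewrite -rV_subE; apply: le_lt_trans yx; exact: rV_coord_le.
by split; apply: compact_closedI => //; apply: closed_le_fun => //; exact: cst_continuous.
Qed.

(** Two contact points differ in some coordinate [i] and are separated there by rationals [a < b].
    By monotonicity of the subdifferential, the slopes supporting on both sides of such a slab meet
    each line parallel to axis [i] at most once, so the last clause of [is_density] applies to each
    of countably many pieces. *)
Lemma nonuniq_negligible D u (rho : {measure set (BorelRd R d) -> \bar R}) :
  (forall (S : set (BorelRd R d)) (i : 'I_d), measurable S ->
        (forall x y : 'rV[R]_d, S x -> S y ->
            (forall j, j != i -> x 0%R j = y 0%R j) -> x = y) -> rho S = 0%E) ->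
  bcf D u -> rho.-negligible (nonuniq D u : set (BorelRd R d)).
Proof.
move=> rho_line bu; have [oD cD [B bB] cu _] := bu.
pose K (n : nat) := erode D (n.+1%:R^-1 : R).
have n0 (n : nat) : 0 < n.+1%:R^-1 :> R by rewrite invr_gt0 ltr0n.
have cK n : compact (K n) by exact: (erode_compact (n0 n) bB).
have KD n : K n `<=` D by exact: erode_sub.
pose S (t : nat * nat * 'I_d * rat * rat) : set (BorelRd R d) :=
  let: (n, m, i, a, b) := t in
  if a < b then subdiff_img D u (K n `&` [set x | x 0 i <= ratr a]) `&`
    subdiff_img D u (K m `&` [set x | ratr b <= x 0 i]) else set0.
apply: (@negligibleS _ _ _ _ (\bigcup_t S t)); last first.
  apply: negligible_countable => -[[[[n m] i] a] b]; rewrite /S.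
  case: ifPn => ab; last exact: negligible_set0.
  have [c1 _] := compact_halfspace i (ratr a) (cK n).
  have [_ c2] := compact_halfspace i (ratr b) (cK m).
  have mS : measurable (subdiff_img D u (K n `&` [set x | x 0 i <= ratr a]) `&`
    subdiff_img D u (K m `&` [set x | ratr b <= x 0 i]) : set (BorelRd R d)).
    by apply: measurableI; apply: closed_borel; apply: subdiff_img_closed => // x [/KD].
  apply/negligibleP => //; apply: (rho_line _ i) => // p q.
  (* [q'] supports on the left of the slab and [p'] on the right; when they differ only in
     coordinate [i], monotonicity orders them. As each of the two slopes supports on both sides,
     they coincide. *)
  have key p' q' x' y' : K n x' -> K m y' -> x' 0 i <= ratr a -> ratr b <= y' 0 i ->
     subdiff D u x' q' -> subdiff D u y' p' ->
     (forall j, j != i -> p' 0 j = q' 0 j) -> q' 0 i <= p' 0 i.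
    move=> /KD Dx' /KD Dy' xa by' sq sp pq.
    have := subdiff_mono Dx' Dy' sq sp; rewrite /dotp (bigD1 i) //= big1 ?addr0.
      rewrite !mxE => h; rewrite leNgt; apply/negP => qp.
      have ab' : (ratr a : R) < ratr b by rewrite ltr_rat.
      have h1 : 0 < y' 0 i - x' 0 i by lra.
      have : (p' 0 i - q' 0 i) * (y' 0 i - x' 0 i) < 0 by rewrite nmulr_rlt0 //; lra.
      by lra.
    by move=> j ji; rewrite !mxE pq // subrr mul0r.
  move=> [[x [Kx xa] spx] [y [Ky yb] spy]] [[x' [Kx' xa'] sqx] [y' [Ky' yb'] sqy]] pq.
  apply/rowP => j; have [->|ji] := eqVneq j i; last exact: pq.
  apply/le_anti/andP; split.
    by apply: (key _ _ x y') => // k ki; rewrite pq.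
  by apply: (key _ _ x' y).
move=> p [x [y [Dx Dy xy spx spy]]].
have [i xyi] : exists i, x 0 i != y 0 i.
  apply: contrapT => H; move/eqP : xy; apply; apply/rowP => i.
  by apply: contrapT => /eqP h; apply: H; exists i.
have gen x' y' : D x' -> D y' -> subdiff D u x' p -> subdiff D u y' p ->
    x' 0 i < y' 0 i -> (\bigcup_t S t) p.
  move=> Dx' Dy' sx sy xy'.
  have [n Kx'] := open_erode oD Dx'; have [m Ky'] := open_erode oD Dy'.
  have [a] := rat_in_itvoo xy'; rewrite in_itv /= => /andP [a1 a2].
  have [b] := rat_in_itvoo a2; rewrite in_itv /= => /andP [b1 b2].
  exists (n, m, i, a, b) => //=.
  rewrite ifT; last by rewrite -(ltr_rat R).
  by split; [exists x' => //; split => //|exists y' => //; split => //]; exact: ltW.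
have [h|h] := ltP (x 0 i) (y 0 i); first exact: (gen x y).
by apply: (gen y x) => //; rewrite lt_neqAle eq_sym xyi h.
Qed.

End LegendreInf.

Section MongeAmpereMeasure.
Context {R : realType} {d : nat} (Rf : 'rV[R]_d -> R)
  (rho : {measure set (BorelRd R d) -> \bar R}) (Hrho : is_density Rf rho).
Implicit Types (x y z p q : 'rV[R]_d) (A K D e : set 'rV[R]_d) (u v : 'rV[R]_d -> R).

(** Off [N] each slope has at most one contact point, so taking the image and removing [N] commutes
    with unions and complements and keeps disjoint sets disjoint. The sets with Borel trimmed image
    thus form a sigma-algebra, to which open sets belong as countable unions of compact erosions. *)
Lemma MA_ex D u : bcf D u -> exists (nu : {measure set (BorelRd R d) -> \bar R})
    (N : set (BorelRd R d)),
  [/\ measurable N, rho N = 0%E,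
     (forall p x y, ~ N p -> D x -> D y -> subdiff D u x p -> subdiff D u y p -> x = y),
     (forall e : set (BorelRd R d), measurable e ->
       measurable (subdiff_img D u (e `&` D) `\` N : set (BorelRd R d))) &
     (forall e : set (BorelRd R d), nu e = rho (subdiff_img D u (e `&` D) `\` N))].
Proof.
move=> bu; have [sand rho_b rho_o rho_line] := Hrho.
have [oD cD [B bB] cu _] := bu.
have [N [mN N0 HN]] := nonuniq_negligible rho_line bu.
have uniqN p x y : ~ N p -> D x -> D y -> subdiff D u x p -> subdiff D u y p -> x = y.
  move=> Np Dx Dy sx sy; apply: contrapT => /eqP xy; apply: Np; apply: HN.
  by exists x, y.
pose T (e : set 'rV[R]_d) : set (BorelRd R d) := subdiff_img D u (e `&` D) `\` N.
have TU (F : (set 'rV[R]_d)^nat) : T (\bigcup_n F n) = \bigcup_n T (F n).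
  apply/seteqP; split => p.
    by move=> [[x [[n _ Fx] Dx] sx] Np]; exists n => //; split => //; exists x.
  by move=> [n _ [[x [Fx Dx] sx] Np]]; split => //; exists x => //; split => //; exists n.
have n0 (n : nat) : 0 < n.+1%:R^-1 :> R by rewrite invr_gt0 ltr0n.
have mTo (O : set 'rV[R]_d) : open O -> measurable (T O).
  move=> oO; have oOD : open (O `&` D) by exact: openI.
  rewrite /T (open_bigcup_erode oOD) /subdiff_img bigcup_bigcup.
  apply: measurableD => //; apply: bigcupT_measurable => n.
  apply: closed_borel; apply: (subdiff_img_closed bu).
    apply: (@erode_compact _ _ _ B) => // x [_]; exact: bB.
  by move=> x /(erode_sub (n0 n)) [].
have mT e : measurable (e : set (BorelRd R d)) -> measurable (T e).
  move: e; apply: smallest_sub; last by move=> O oO; exact: mTo.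
  split.
  - rewrite /T set0I /subdiff_img bigcup_set0 set0D; exact: measurable0.
  - move=> A mA; rewrite (_ : T (setT `\` A) = T setT `\` T A).
      by apply: measurableD => //; apply: mTo; exact: openT.
    apply/seteqP; split => p.
      move=> [[x [[_ Ax] Dx] sx] Np]; split; first by split => //; exists x.
      move=> [[y [Ay Dy] sy] _]; apply: Ax.
      by rewrite (uniqN p x y Np Dx Dy sx sy).
    move=> [[[x [_ Dx] sx] Np] nA]; split => //; exists x => //; split => //; split => //.
    by move=> Ax; apply: nA; split => //; exists x.
  - move=> F mF; rewrite TU; exact: bigcupT_measurable.
pose nu (e : set (BorelRd R d)) := rho (T e).
have nu0 : nu set0 = 0%E.
  by rewrite /nu /T set0I /subdiff_img bigcup_set0 set0D measure0.
have nu_ge0 e : (0 <= nu e)%E by exact: measure_ge0.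
have nu_sa : semi_sigma_additive nu.
  move=> F mF tF mUF; rewrite /nu TU.
  apply: measure_semi_sigma_additive.
  - by move=> n; exact: mT.
  - apply/trivIsetP => i j _ _ ij; apply/seteqP; split => // p.
    move=> [[[x [Fx Dx] sx] Np] [[y [Fy Dy] sy] _]].
    have xy := uniqN p x y Np Dx Dy sx sy; subst y.
    move/trivIsetP : tF => /(_ i j Logic.I Logic.I ij) E.
    have : (F i `&` F j) x by split.
    by rewrite E.
  - by rewrite -TU; exact: mT.
pose nuM := isMeasure.Build _ _ _ nu nu0 nu_ge0 nu_sa.
pose nu' : {measure set (BorelRd R d) -> \bar R} := HB.pack nu nuM.
by exists nu', N.
Qed.

Local Notation W D u e := (wint (subdiff_img D u e) Rf).

(** The last two clauses compare [nu] with [rho] of Borel sets of slopes, for use when the image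
    itself is not known to be Borel. *)
Lemma MA_measure D u : bcf D u -> exists (nu : {measure set (BorelRd R d) -> \bar R})
    (N : set (BorelRd R d)),
  [/\ measurable N, rho N = 0%E,
     (forall p x y, ~ N p -> D x -> D y -> subdiff D u x p -> subdiff D u y p -> x = y),
     (forall e : set (BorelRd R d), measurable e -> nu e = W D u (e `&` D)) &
     (forall (e B : set (BorelRd R d)), measurable e -> measurable B -> 
        subdiff_img D u (e `&` D) `<=` B -> (nu e <= rho B)%E) /\
     (forall (e B : set (BorelRd R d)), measurable e -> measurable B -> 
        B `\` N `<=` subdiff_img D u (e `&` D) -> (rho B <= nu e)%E)].
Proof.
move=> bu; have [nu [N [mN N0 uniqN mT nuE]]] := MA_ex bu.
have [sand rho_b rho_o rho_line] := Hrho.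
exists nu, N; split => //.
- move=> e me; rewrite nuE; symmetry; apply: (sand _ _ N) => //.
  + exact: mT.
  + by move=> x ex; have [Nx|Nx] := pselect (N x); [right|left].
split.
- move=> e B me mB eB; rewrite nuE; apply: le_measure; rewrite ?inE //.
    exact: mT.
  by move=> x [/eB].
- move=> e B me mB Be; rewrite nuE.
  have -> : rho B = rho (B `\` N).
    apply/eqP; rewrite eq_le; apply/andP; split; last first.
      by apply: le_measure; rewrite ?inE //; exact: measurableD.
    apply: (@le_trans _ _ (rho ((B `\` N) `|` N))).
      apply: le_measure; rewrite ?inE //; first by apply: measurableU => //; exact: measurableD.
      by move=> x Bx; have [Nx|Nx] := pselect (N x); [right|left].
    have mBN : measurable (B `\` N) by exact: measurableD.
    exact: measure_setU_null.
  apply: le_measure; rewrite ?inE //; [exact: measurableD|exact: mT|].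
  by move=> x [Bx Nx]; split => //; apply: Be.
Qed.

End MongeAmpereMeasure.

(** * Stability under locally uniform convergence *)

Section Stability.
Context {R : realType} {d : nat} (Rf : 'rV[R]_d -> R)
  (rho : {measure set (BorelRd R d) -> \bar R}) (Hrho : is_density Rf rho).
Implicit Types (x y z p q : 'rV[R]_d) (A K D Om e : set 'rV[R]_d) (u v w : 'rV[R]_d -> R)
  (r s t eps eta m M : R).

Local Notation W D u e := (wint (subdiff_img D u e) Rf).

Lemma W_le_rho D u e (B : set (BorelRd R d)) : bcf D u ->
  measurable (e : set (BorelRd R d)) -> e `<=` D -> measurable B ->
  subdiff_img D u e `<=` B -> (W D u e <= rho B)%E.
Proof.
move=> bu me eD mB eB; have [nu [N [mN N0 _ nuE [nule _]]]] := MA_measure Hrho bu.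
have eE : e `&` D = e by exact: setIidl.
by have := nule e B me mB; rewrite nuE // eE; apply.
Qed.

Lemma rho_le_W D u e (B : set (BorelRd R d)) : bcf D u ->
  measurable (e : set (BorelRd R d)) -> e `<=` D -> measurable B ->
  B `<=` subdiff_img D u e -> (rho B <= W D u e)%E.
Proof.
move=> bu me eD mB eB; have [nu [N [mN N0 _ nuE [_ nuge]]]] := MA_measure Hrho bu.
have eE : e `&` D = e by exact: setIidl.
by have := nuge e B me mB; rewrite nuE // eE; apply => x [/eB].
Qed.

Lemma W_mono D u e e' : bcf D u ->
  measurable (e : set (BorelRd R d)) -> measurable (e' : set (BorelRd R d)) ->
  e `<=` e' -> e' `<=` D -> (W D u e <= W D u e')%E.
Proof.
move=> bu me me' ee' e'D; have [nu [N [mN N0 _ nuE _]]] := MA_measure Hrho bu.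
have : (nu e <= nu e')%E by apply: le_measure; rewrite ?inE.
by rewrite !nuE // (setIidl (subset_trans ee' e'D)) (setIidl e'D).
Qed.

Lemma W_ge0 D u e : bcf D u -> measurable (e : set (BorelRd R d)) -> e `<=` D ->
  (0 <= W D u e)%E.
Proof.
move=> bu me eD; have [nu [N [mN N0 _ nuE _]]] := MA_measure Hrho bu.
by have := nuE _ me; rewrite (setIidl eD) => <-; exact: measure_ge0.
Qed.

Lemma subdiff_img_erode_bounded D u m M s e : (forall x, D x -> m <= u x <= M) -> 0 < s ->
  e `<=` erode D s -> subdiff_img D u e `<=` [set p | `|p| <= (M - m) / (s / 2)].
Proof. by move=> bu s0 eD p [x ex]; apply: subdiff_bound bu s0 (eD x ex). Qed.

Lemma closed_norm_le (n : R) : closed [set p : 'rV[R]_d | `|p| <= n].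
Proof.
have := @cball_closed R d 0%R n; congr closed.
by apply/funext => y; rewrite /mkset sub0r normrN.
Qed.

Lemma tilt_inf_near u w A (eps : R) p : A !=set0 ->
  (forall x, A x -> `|u x - w x| <= eps) ->
  has_lbound [set u x - dotp p x | x in A] -> tilt_inf u A p <= tilt_inf w A p + eps.
Proof.
move=> A0 H lb; rewrite -lerBlDr; apply: le_tilt => // x Ax.
have h : tilt_inf u A p <= u x - dotp p x by apply: ge_inf => //; exists x.
by have := H x Ax; rewrite ler_norml => /andP [h1 h2]; lra.
Qed.

Lemma natSinv_le (n k : nat) : (n <= k)%N -> k.+1%:R^-1 <= n.+1%:R^-1 :> R.
Proof. by move=> nk; rewrite lef_pV2 ?posrE ?ltr0n // ler_nat ltnS. Qed.

(** Upper semicontinuity on compact sets. The bounded slopes for which the infimum over [K] exceeds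
    that over the larger compact [K'] by at most [1/(n+1)] decrease to slopes of [w] on [K]. Any [u]
    close to [w] on [K'] has its slopes on [K] in this set. *)
Lemma MA_upper Om w K s (m M eta : R) : bcf Om w -> compact K -> 0 < s ->
  K `<=` erode Om (2 * s) -> 0 < eta ->
  exists2 eps, 0 < eps & forall D u, bcf D u -> erode Om s `<=` D ->
    (forall x, D x -> m <= u x <= M) ->
    (forall x, erode Om s x -> `|u x - w x| <= eps) ->
    (W D u K <= W Om w K + eta%:E)%E.
Proof.
move=> bw cK s0 KO eta0.
have [oO cO [B bB] cw _] := bw.
have mK : measurable (K : set (BorelRd R d)).
  by apply: closed_borel; apply: compact_closed cK; exact: norm_hausdorff.
pose K' := erode Om s.
have cK' : compact K' by exact: erode_compact s0 bB.
have K'O : K' `<=` Om by exact: erode_sub.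
have KK' x : K x -> erode K' s x.
  move=> Kx y yx; rewrite /K' (_ : s = 2 * s - s); last by lra.
  by apply: (erode_near (KO x Kx)); exact: ltW.
have KsubK' : K `<=` K' by move=> x /KK'; exact: erode_sub.
have KOm : K `<=` Om by apply: subset_trans K'O.
have [K0|/set0P K0] := eqVneq K set0.
  exists 1 => // D u bu _ _ _; rewrite K0 /subdiff_img !bigcup_set0.
  have [nu [N [mN N0 _ nuE _]]] := MA_measure Hrho bw.
  have := nuE set0 measurable0; rewrite measure0 set0I /subdiff_img bigcup_set0 => <-.
  by rewrite add0e lee_fin ltW.
have K'0 : K' !=set0 by have [x /KsubK'] := K0; exists x.
(* A bound for the slopes on [K] of every admissible [u]; it makes [F 0] of finite measure, as
   continuity from above requires. *)
pose P := (M - m) / (s / 2).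
pose psi p := tilt_inf w K p - tilt_inf w K' p.
pose F (n : nat) : set (BorelRd R d) := [set p | `|p| <= P] `&`
   [set p | tilt_inf w K p <= tilt_inf w K' p + n.+1%:R^-1].
have ctK : continuous (tilt_inf w K) by exact: tilt_cont bw KOm K0.
have ctK' : continuous (tilt_inf w K') by exact: tilt_cont bw K'O K'0.
have mF n : measurable (F n).
  apply: measurableI; apply: closed_borel; first exact: closed_norm_le.
  apply: closed_le_fun => // p.
  apply: (@cvgD R R 'rV[R]_d (nbhs p) (nbhs_filter p)); first exact: ctK'.
  exact: cvg_cst.
have FK : \bigcap_n F n `<=` subdiff_img Om w K.
  move=> p Fp.
  have h : tilt_inf w K p <= tilt_inf w K' p.
    apply/ler_addgt0Pr => e e0; have [n] := ltr_add_invr e0; rewrite add0r => ne.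
    have [_ /= h] := Fp n Logic.I; apply: le_trans h _.
    by rewrite lerD2l ltW.
  have [x Kx Hx] := compact_min p K0 cK (bcf_within bw KOm).
  exists x => //; apply: (@subdiff_local _ _ _ _ _ _ s) => //; first exact: KOm.
  move=> y _ yx; have K'y := KK' x Kx y yx.
  apply: le_trans (tilt_le p bw K'O K'y); apply: le_trans h.
  exact: le_tilt.
have Wfin : (W Om w K < +oo)%E.
  have s20 : 0 < 2 * s by lra.
  have [_ rho_b _ _] := Hrho.
  have [_ _ _ _ [m' [M' bw']]] := bw.
  apply: le_lt_trans (rho_b ((M' - m') / (2 * s / 2))).
  apply: W_le_rho => //; first by apply: closed_borel; exact: closed_norm_le.
  exact: subdiff_img_erode_bounded bw' s20 KO.
have W0 := W_ge0 bw mK KOm.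
have hcap : (rho (\bigcap_n F n) < W Om w K + eta%:E)%E.
  apply: (@le_lt_trans _ _ (W Om w K)); last by rewrite lteDl ?lte_fin // ge0_fin_numE.
  by apply: rho_le_W => //; apply: bigcapT_measurable.
have F0 : (rho (F 0%N) < +oo)%E.
  have [_ rho_b _ _] := Hrho.
  apply: le_lt_trans (rho_b P); apply: le_measure; rewrite ?inE //.
    by apply: closed_borel; exact: closed_norm_le.
  by move=> p [].
have [|n hn] := measure_bigcap_lt mF _ F0 hcap.
  by move=> n k nk p [h1 /= h2]; split => //=; apply: le_trans h2 _; rewrite lerD2l natSinv_le.
(* Both infima move by at most [eps], hence the half. *)
exists (n.+1%:R^-1 / 2); first by rewrite divr_gt0 // invr_gt0 ltr0n.
move=> D u bu OD bum uw; apply: le_trans (ltW hn).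
have K'D : K' `<=` D by [].
have KD : K `<=` D by exact: subset_trans KsubK' K'D.
apply: W_le_rho => // p [x Kx sp]; split.
  apply: (subdiff_bound bum s0 _ sp) => y yx; apply: K'D; exact: KK' yx.
rewrite /=.
have h1 : tilt_inf w K p <= tilt_inf u K p + n.+1%:R^-1 / 2.
  apply: tilt_inf_near => //; last exact: tilt_lb bw KOm.
  by move=> y Ky; rewrite distrC; apply: uw; exact: KsubK'.
have h2 : tilt_inf u K' p <= tilt_inf w K' p + n.+1%:R^-1 / 2.
  by apply: tilt_inf_near => //; exact: tilt_lb bu K'D.
have h3 : tilt_inf u K p <= tilt_inf u K' p.
  apply: le_trans (tilt_le p bu KD Kx) _; apply: le_tilt => // y K'y.
  by apply: (subdiff_min sp); exact: K'D.
by move: h1 h2 h3; set t : R := n.+1%:R^-1; lra.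
Qed.

(** Lower semicontinuity on open sets. A slope of [w] supporting only in [O] has a strictly smaller
    infimum over [K'] than over [S], the part of [K'] outside [O]. Where the gap exceeds [1/(n+1)],
    every [u] close to [w] on [K'] still has its minimiser in [O], and [subdiff_local] turns it into
    a contact point. *)
Lemma MA_lower Om w O s (a : \bar R) : bcf Om w -> open O -> 0 < s ->
  O `<=` erode Om s -> (a < W Om w O)%E ->
  exists2 eps, 0 < eps & forall D u, bcf D u -> erode Om s `<=` D ->
    (forall x, erode Om s x -> `|u x - w x| <= eps) ->
    (a < W D u O)%E.
Proof.
move=> bw oO s0 OK aW.
have [oOm cO [B bB] cw _] := bw.
have mO : measurable (O : set (BorelRd R d)) by exact: open_borel.
pose K' := erode Om s.
have cK' : compact K' by exact: erode_compact s0 bB.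
have K'O : K' `<=` Om by exact: erode_sub.
have OOm : O `<=` Om by exact: subset_trans K'O.
have [nu [N [mN N0 uniqN nuE [nule nuge]]]] := MA_measure Hrho bw.
have [OE|/set0P O0] := eqVneq O set0.
  exists 1 => // D u bu KD _; apply: lt_le_trans aW _.
  have := nuE set0 measurable0; rewrite set0I measure0 -OE => <-.
  by apply: W_ge0 => //; exact: subset_trans KD.
have K'0 : K' !=set0 by have [x /OK] := O0; exists x.
pose S := K' `&` ~` O.
have cS : compact S by apply: compact_closedI => //; rewrite closedC.
have SK' : S `<=` K' by move=> x [].
have SO : S `<=` Om by exact: subset_trans K'O.
have find D u p x : bcf D u -> K' `<=` D -> O x -> (forall y, K' y -> u x - dotp p x <= u y - dotp p y) ->
    subdiff_img D u O p.
  move=> bu KD Ox H; have [oD cD _ cu _] := bu.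
  have [r r0 Hr] := (open_ballP O).1 oO x Ox.
  exists x => //; apply: (@subdiff_local _ _ _ _ _ _ r) => //; first exact: KD (OK x Ox).
  by move=> y _ yx; apply: H; apply: OK; exact: Hr.
have [S0|/set0P S0] := eqVneq S set0.
  have KOx x : K' x -> O x.
    move=> Kx; apply: contrapT => nO; have : S x by split.
    by rewrite S0.
  exists 1 => // D u bu KD _.
  apply: lt_le_trans aW _; apply: (@le_trans _ _ (rho setT)).
    by apply: W_le_rho => //; exact: subsetT.
  apply: rho_le_W => //; first exact: subset_trans KD.
  move=> p _; have [x K'x Hx] := compact_min p K'0 cK' (bcf_within bu KD).
  by apply: (find _ _ _ x) => //; exact: KOx.
pose F (n : nat) : set (BorelRd R d) :=
   [set p | tilt_inf w K' p + n.+1%:R^-1 < tilt_inf w S p].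
have ctS : continuous (tilt_inf w S) by exact: tilt_cont bw SO S0.
have ctK' : continuous (tilt_inf w K') by exact: tilt_cont bw K'O K'0.
have mF n : measurable (F n).
  apply: open_borel; apply: open_lt_fun => // p.
  apply: (@cvgD R R 'rV[R]_d (nbhs p) (nbhs_filter p)); first exact: ctK'.
  exact: cvg_cst.
have OF : subdiff_img Om w O `\` N `<=` \bigcup_n F n.
  move=> p [[x Ox sp] Np].
  have [y Sy Hy] := compact_min p S0 cS (bcf_within bw SO).
  have lt : w x - dotp p x < w y - dotp p y.
    rewrite ltNge; apply/negP => yx.
    have sy : subdiff Om w y p.
      apply: subdiff_minE => z Oz; apply: le_trans yx _; exact: subdiff_min sp Oz.
    have E := uniqN p x y Np (OOm x Ox) (SO y Sy) sp sy.
    by have [_] := Sy; rewrite -E.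
  have [n hn] := ltr_add_invr lt; exists n => //; rewrite /F /=.
  apply: (@le_lt_trans _ _ (w x - dotp p x + n.+1%:R^-1)).
    by rewrite lerD2r; apply: tilt_le bw K'O (OK x Ox).
  by apply: lt_le_trans hn _; exact: le_tilt.
have aF : (a < rho (\bigcup_n F n))%E.
  apply: lt_le_trans aW _.
  have mU : measurable (\bigcup_n F n) by exact: bigcupT_measurable.
  apply: (@le_trans _ _ (nu O)); first by rewrite nuE // setIidl.
  apply: (@le_trans _ _ (rho ((\bigcup_n F n) `|` N))).
    apply: nule => //; first exact: measurableU.
    rewrite setIidl // => p Op; have [Np|Np] := pselect (N p); first by right.
    by left; apply: OF.
  exact: measure_setU_null.
have [|n hn] := measure_lt_bigcup mF _ aF.
  move=> n k nk p /= h; rewrite /F /=; apply: le_lt_trans h.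
  by rewrite lerD2l natSinv_le.
exists (n.+1%:R^-1 / 2); first by rewrite divr_gt0 // invr_gt0 ltr0n.
move=> D u bu KD uw; apply: lt_le_trans hn _.
apply: rho_le_W => //; first exact: subset_trans KD.
move=> p Fp.
have SD : S `<=` D by exact: subset_trans KD.
have [x K'x Hx] := compact_min p K'0 cK' (bcf_within bu KD).
apply: (find _ _ _ x) => //; apply: contrapT => nO.
have Sx : S x by split.
have h1 : tilt_inf u K' p <= tilt_inf w K' p + n.+1%:R^-1 / 2.
  by apply: tilt_inf_near => //; exact: tilt_lb bu KD.
have h2 : tilt_inf w S p <= tilt_inf u S p + n.+1%:R^-1 / 2.
  apply: tilt_inf_near => //; last exact: tilt_lb bw SO.
  by move=> y /SK' K'y; rewrite distrC; apply: uw.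
have h3 : tilt_inf u S p <= u x - dotp p x by exact: tilt_le bu SD Sx.
have h4 : u x - dotp p x <= tilt_inf u K' p by exact: le_tilt.
have : tilt_inf w K' p + n.+1%:R^-1 < tilt_inf w S p by [].
by move: h1 h2 h3 h4; set t : R := n.+1%:R^-1; lra.
Qed.

Definition fatten e (r : R) : set 'rV[R]_d := [set x | exists2 y, e y & `|x - y| < r].

Lemma fatten_open e r : open (fatten e r).
Proof.
apply/open_ballP => x [y ey xy]; exists (r - `|x - y|); first by lra.
move=> z zx; exists y => //.
rewrite (_ : z - y = (z - x) + (x - y)); last by rewrite addrA subrK.
by apply: le_lt_trans (ler_normD _ _) _; lra.
Qed.

Lemma sub_fatten e r : 0 < r -> e `<=` fatten e r.
Proof. by move=> r0 x ex; exists x => //; rewrite subrr normr0. Qed.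

Lemma fatten_erode A r s : 0 <= s -> fatten (erode A r) s `<=` erode A (r - s).
Proof. by move=> s0 x [y Hy xy]; apply: (erode_near Hy); exact: ltW. Qed.

(** The open counterpart of [erode], for exhausting an open set by open sets. *)
Definition open_erode_set A r : set 'rV[R]_d := [set x | exists2 t, r < t & erode A t x].

Lemma open_erode_set_open A r : open (open_erode_set A r).
Proof.
apply/open_ballP => x [t rt Hx]; exists ((t - r) / 2); first by lra.
move=> y yx; exists (t - (t - r) / 2); first by lra.
by apply: (erode_near Hx); exact: ltW.
Qed.

(* [W D u] is compared with [mu'] only up to a fattening by [r >= s], [s] being the mesh scale. *)
Definition approximates Om w (mu' : set (BorelRd R d) -> \bar R) (m M s eps : R) D u :=
  [/\ bcf D u, erode Om s `<=` D, (forall x, D x -> m <= u x <= M),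
     (forall x, erode Om s x -> `|u x - w x| <= eps) &
     (forall e r, measurable (e : set (BorelRd R d)) -> s <= r ->
        fatten e r `<=` erode Om s ->
        (W D u e <= mu' (fatten e r))%E /\ (mu' e <= W D u (fatten e r))%E)].

(** Exhaust [O] by open sets for one inequality and by compact erosions for the other. In both cases
    the fattening in [approximates] fits into the margin left by the erosion. *)
Lemma MA_limit_open Om w (mu' : {measure set (BorelRd R d) -> \bar R}) m M O :
  bcf Om w ->
  (forall s eps, 0 < s -> 0 < eps -> exists D u, approximates Om w mu' m M s eps D u) ->
  open O -> O `<=` Om -> W Om w O = mu' O.
Proof.
move=> bw Happ oO OOm; have [oOm cO [B bB] cw _] := bw.
have mO : measurable (O : set (BorelRd R d)) by exact: open_borel.
have n0 (n : nat) : 0 < n.+1%:R^-1 :> R by rewrite invr_gt0 ltr0n.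
apply/eqP; rewrite eq_le; apply/andP; split.
  rewrite leNgt; apply/negP => lt.
  have [nu [N [mN N0 uniqN nuE _]]] := MA_measure Hrho bw.
  pose F (n : nat) : set (BorelRd R d) := open_erode_set O n.+1%:R^-1.
  have FO n : F n `<=` O by move=> x [t nt]; apply: erode_sub; exact: lt_trans nt.
  have FE : \bigcup_n F n = O.
    apply/seteqP; split; first by move=> x [n _]; exact: FO.
    move=> x Ox; have [n Hx] := open_erode oO Ox; exists n.+1 => //.
    exists n.+1%:R^-1 => //.
    by rewrite ltf_pV2 ?posrE ?ltr0n // ltr_nat.
  have mF n : measurable (F n) by apply: open_borel; exact: open_erode_set_open.
  have : (mu' O < nu (\bigcup_n F n))%E by rewrite FE nuE // setIidl.
  move=> /(measure_lt_bigcup mF) [|n hn].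
    by move=> n k nk x [t tn Hx]; exists t => //; apply: le_lt_trans tn; exact: natSinv_le.
  have FOm : F n `<=` Om by exact: subset_trans OOm.
  rewrite nuE // setIidl // in hn.
  pose r : R := n.+1%:R^-1; pose s : R := r / 2.
  have r0 : 0 < r by exact: n0.
  have s0 : 0 < s by rewrite /s; lra.
  have FD x : F n x -> erode O r x.
    by move=> [t nt]; apply: erode_mono => //; exact: ltW.
  have FK : F n `<=` erode Om s.
    move=> x /FD; apply: erode_mono => //; rewrite /s; lra.
  have [eps eps0 Heps] := MA_lower bw (@open_erode_set_open O n.+1%:R^-1) s0 FK hn.
  have [D [u [bu KD bum uw mass]]] := Happ s eps s0 eps0.
  have fF : fatten (F n) s `<=` erode O s.
    move=> x [y Fy xy]; rewrite (_ : s = r - s); last by rewrite /s; lra.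
    by apply: (erode_near (FD y Fy)); exact: ltW.
  have [h1 _] := mass (F n) s (mF n) (lexx s) (subset_trans fF (erode_mono OOm (lexx s))).
  have := Heps D u bu KD uw; apply/negP; rewrite -leNgt; apply: le_trans h1 _.
  apply: le_measure; rewrite ?inE //; first by apply: open_borel; exact: fatten_open.
  by apply: subset_trans fF _; exact: erode_sub.
rewrite leNgt; apply/negP => lt.
have mE r : measurable (erode O r : set (BorelRd R d)) by apply: closed_borel; exact: erode_closed.
have [n hn] : exists n : nat, (W Om w O < mu' (erode O n.+1%:R^-1))%E.
  apply: measure_lt_bigcup => //; last by rewrite -open_bigcup_erode.
  by move=> n k nk; apply: erode_mono => //; exact: natSinv_le.
have W0 := W_ge0 bw mO OOm.
(* [MA_upper] loses an additive [eta], so a finite margin is extracted from the strict inequality,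
   whose right side may be infinite. *)
have [eta eta0 heta] : exists2 eta : R, 0 < eta &
    (W Om w O + eta%:E < mu' (erode O n.+1%:R^-1))%E.
  move: W0 hn; case: (W Om w O) => [a| |] //= _.
    case: (mu' _) => [b| |] //= ab.
      rewrite lte_fin in ab; exists ((b - a) / 2); first by lra.
      by rewrite -EFinD lte_fin; lra.
    by exists 1 => //; rewrite -EFinD ltry.
  by rewrite ltNge leey.
pose r : R := n.+1%:R^-1; pose s := r / 4.
have r0 : 0 < r by exact: n0.
have s0 : 0 < s by rewrite /s; lra.
pose K := erode O (r / 2).
have bO x : O x -> `|x| <= B by move=> /OOm; exact: bB.
have r20 : 0 < r / 2 by lra.
have cK : compact K by exact: (erode_compact r20 bO).
have KOm : K `<=` erode Om (2 * s) by apply: erode_mono => //; rewrite /s; lra.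
have [eps eps0 Heps] := MA_upper m M bw cK s0 KOm eta0.
have [D [u [bu KD bum uw mass]]] := Happ s eps s0 eps0.
have fK : fatten (erode O r) (r / 2) `<=` K.
  move=> x /fatten_erode; rewrite (_ : r - r / 2 = r / 2); last by lra.
  by apply; exact: ltW.
have KOs : K `<=` erode Om s by apply: erode_mono => //; rewrite /s; lra.
have [|_ h2] := mass _ (r / 2) (mE r) _ (subset_trans fK KOs); first by rewrite /s; lra.
have KD' : K `<=` D by exact: subset_trans KD.
have mK : measurable (K : set (BorelRd R d)) by exact: mE.
have KO : K `<=` O by exact: erode_sub.
have h3 : (W D u (fatten (erode O r) (r / 2)) <= W D u K)%E.
  by apply: W_mono => //; apply: open_borel; exact: fatten_open.
have h4 := Heps D u bu KD bum uw.
have h5 : (W Om w K <= W Om w O)%E by exact: W_mono.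
move: heta; apply/negP; rewrite -leNgt.
apply: (le_trans h2); apply: (le_trans h3); apply: (le_trans h4).
by apply: leeD.
Qed.

(** Open sets are stable under intersection and generate the Borel sets, so agreement on them
    suffices once the total mass is finite. *)
Lemma MA_limit Om w (mu' : {measure set (BorelRd R d) -> \bar R}) m M :
  bcf Om w -> (mu' Om < +oo)%E ->
  (forall s eps, 0 < s -> 0 < eps -> exists D u, approximates Om w mu' m M s eps D u) ->
  MA_eq Om Rf mu' w.
Proof.
move=> bw mufin Happ e me eOm; have [oOm cO bB cw _] := bw.
have [nu [N [mN N0 uniqN nuE _]]] := MA_measure Hrho bw.
have mOm : measurable (Om : set (BorelRd R d)) by exact: open_borel.
have E : mrestr nu mOm e = mrestr mu' mOm e.
  apply: (@measure_unique _ R (BorelRd R d) (@open 'rV[R]_d) (fun=> setT)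
    _ _ _ _ (mrestr nu mOm) (mrestr mu' mOm)) => //.
  - by move=> A B; exact: openI.
  - by move=> _; exact: openT.
  - by rewrite bigcup_const.
  - move=> A oA; have oAO : open (A `&` Om) by exact: openI.
    have := nuE _ (open_borel oAO); rewrite (setIidl (@subIsetr _ A Om)).
    rewrite (MA_limit_open bw Happ oAO (@subIsetr _ A Om)); exact.
  - move=> _; have := nuE _ mOm; rewrite setIid (MA_limit_open bw Happ oOm) // => E.
    have h : (nu (setT `&` Om) < +oo)%E by rewrite setTI; move: mufin; rewrite -E.
    exact: h.
have := nuE _ me; rewrite (setIidl eOm) => <-.
by move: E; rewrite /mrestr (setIidl eOm).
Qed.

End Stability.

(** * The comparison principle *)

Section SubgradientExistence.
Context {R : realType} {d : nat}.
Implicit Types (x y z p q : 'rV[R]_d) (A K D : set 'rV[R]_d) (u v : 'rV[R]_d -> R)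
  (r s t e : R).

Lemma dotp_ge0 x : 0 <= dotp x x.
Proof. by apply: sumr_ge0 => i _; rewrite -expr2 sqr_ge0. Qed.

Lemma sqr_norm_le_dotp x : `|x| ^+ 2 <= dotp x x.
Proof.
have h : `|x| <= Num.sqrt (dotp x x).
  apply/rV_norm_le; split; first exact: sqrtr_ge0.
  move=> i; rewrite -sqrtr_sqr ler_sqrt ?dotp_ge0 //.
  rewrite /dotp (bigD1 i) //= -expr2 lerDl.
  by apply: sumr_ge0 => j _; rewrite -expr2 sqr_ge0.
by rewrite -[leRHS]sqr_sqrtr ?dotp_ge0 // lerXn2r ?nnegrE ?sqrtr_ge0.
Qed.

Lemma dotp_sqrB x y : dotp x x - dotp y y = dotp (x + y) (x - y).
Proof. by rewrite dotpBr !dotpDl [dotp y x]dotpC; ring. Qed.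

Lemma dotp_sqrD x y t : dotp (x + t *: y) (x + t *: y) =
  dotp x x + 2 * t * dotp x y + t ^+ 2 * dotp y y.
Proof. by rewrite dotpDr !dotpDl !dotpZr !dotpZl [dotp y x]dotpC; ring. Qed.

Lemma dotp_self_continuous x0 : continuous (fun x : 'rV[R]_d => dotp (x - x0) (x - x0) : R).
Proof.
move=> x; apply: continuous_rVP => e e0.
pose c : R := d%:R * (1 + `|x - x0| + `|x - x0|) + 1.
have c0 : 0 < c by rewrite /c ltr_wpDl // mulr_ge0 // !addr_ge0.
exists (Num.min 1 (e / c)); first by rewrite lt_min ltr01 divr_gt0.
move=> y; rewrite lt_min => /andP [y1 y2].
have -> : dotp (y - x0) (y - x0) - dotp (x - x0) (x - x0) =
    dotp (y - x0 + (x - x0)) (y - x).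
  have -> : y - x = (y - x0) - (x - x0) by rewrite opprB addrA subrK.
  exact: dotp_sqrB.
apply: le_lt_trans (dotp_le _ _) _.
apply: (@le_lt_trans _ _ (c * `|y - x|)); last by rewrite mulrC -ltr_pdivlMr.
rewrite ler_wpM2r //; apply: (@le_trans _ _ (d%:R * (1 + `|x - x0| + `|x - x0|))); last by rewrite /c lerDl.
rewrite ler_wpM2l //; apply: le_trans (ler_normD _ _) _; rewrite lerD2r.
have -> : y - x0 = (y - x) + (x - x0) by rewrite addrA subrK.
by apply: le_trans (ler_normD _ _) _; rewrite lerD2r ltW.
Qed.

(* The minimiser of [u + k |y - x0|^2] has the subgradient [- 2 k (y - x0)]. *)
Lemma subgradient_near D u x0 e : bcf D u -> D x0 -> 0 < e ->
  exists y p, [/\ D y, `|y - x0| < e & subdiff D u y p].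
Proof.
move=> bu Dx0 e0; have [oD cD [B bB] cu [m [M bu']]] := bu.
have [r r0 Hr] := (open_ballP D).1 oD x0 Dx0.
pose s := Num.min (r / 2) (e / 2).
have s0 : 0 < s by rewrite lt_min; lra.
have sr : s < r by rewrite gt_min; apply/orP; left; lra.
have se : s < e by rewrite gt_min; apply/orP; right; lra.
pose K := [set y | `|x0 - y| <= s].
have KD : K `<=` D by move=> y Ky; apply: Hr; rewrite distrC; exact: le_lt_trans sr.
have cK : compact K by apply: (@bounded_compact _ _ _ B); [exact: cball_closed|move=> y /KD; exact: bB].
have K0 : K !=set0 by exists x0; rewrite /K /= subrr normr0 ltW.
(* Large enough for the penalty at distance [s] to exceed the oscillation [M - m], so that the
   minimiser lies strictly inside the ball [K]. *)
pose k := (M - m + 1) / s ^+ 2.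
have mM : m <= M by have /andP [h1 h2] := bu' x0 Dx0; exact: le_trans h1 h2.
have s20 : 0 < s ^+ 2 by rewrite exprn_gt0.
have k0 : 0 < k by rewrite divr_gt0 //; lra.
pose f y := u y + k * dotp (y - x0) (y - x0).
have [|y yK Hy] := @EVT_min_rV R d f K K0 cK.
  move=> y; apply: cvgD; first exact: (bcf_within bu KD).
  apply: cvgM; first exact: cvg_cst.
  by apply: continuous_subspaceT; exact: dotp_self_continuous.
rewrite inE in yK.
have Hmin z : K z -> f y <= f z by move=> Kz; apply: Hy; rewrite inE.
have Dy := KD y yK.
have ys : `|x0 - y| < s.
  have := Hmin x0; rewrite /f subrr dotp0r mulr0 addr0 => /(_ _) h.
  have {}h : u y + k * dotp (y - x0) (y - x0) <= u x0.
    by apply: h; rewrite /K /= subrr normr0 ltW.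
  have /andP [h1 _] := bu' y Dy; have /andP [_ h2] := bu' x0 Dx0.
  have h3 : k * `|y - x0| ^+ 2 <= k * dotp (y - x0) (y - x0).
    by apply: ler_wpM2l; [exact: ltW|exact: sqr_norm_le_dotp].
  have h4 : k * `|y - x0| ^+ 2 < k * s ^+ 2.
    by rewrite [ltRHS]mulfVK ?gt_eqF //; lra.
  rewrite ltr_pM2l // in h4; rewrite distrC.
  by rewrite ltr_pXn2r ?nnegrE // ?ltW // in h4.
exists y, ((- (2 * k)) *: (y - x0)); split => //.
  by rewrite distrC; exact: lt_trans se.
move=> z Dz; rewrite dotpZl.
have [->|zy] := eqVneq z y; first by rewrite subrr dotp0r mulr0 addr0.
have n0 : 0 < `|z - y| by rewrite normr_gt0 subr_eq0.
apply/ler_addgt0Pr => eps eps0.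
pose c := k * dotp (z - y) (z - y).
have c0 : 0 <= c by rewrite mulr_ge0 ?dotp_ge0 // ltW.
(* The three bounds keep the point on the segment, keep it in the ball [K], and make the
   second-order term [t * c] at most [eps]. *)
pose t := Num.min 1 (Num.min ((s - `|x0 - y|) / `|z - y|) (eps / (c + 1))).
have t0 : 0 < t.
  rewrite !lt_min ltr01 /=; apply/andP; split; first by rewrite divr_gt0 // subr_gt0.
  by rewrite divr_gt0 // ltr_wpDl.
have t1 : t <= 1 by rewrite ge_min lexx.
have t2 : t * `|z - y| <= s - `|x0 - y|.
  by rewrite -ler_pdivlMr // !ge_min lexx orbT.
have t3 : t * c <= eps.
  apply: (@le_trans _ _ (t * (c + 1))); first by rewrite ler_wpM2l ?lerDl // ltW.
  by rewrite -ler_pdivlMr ?ltr_wpDl // !ge_min lexx !orbT.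
pose w := t *: z + (1 - t) *: y.
have wy : w - y = t *: (z - y) by apply/rowP => i; rewrite !mxE; ring.
have Kw : K w.
  rewrite /K /=; have -> : x0 - w = (x0 - y) - (w - y) by rewrite opprB addrA subrK.
  apply: le_trans (ler_normB _ _) _; rewrite wy normrZ gtr0_norm //; lra.
have hw := Hmin w Kw.
have t01 : 0 <= t <= 1 by rewrite ltW.
have cw := cu z y Dz Dy t t01; rewrite -/w in cw.
have E : dotp (w - x0) (w - x0) = dotp (y - x0) (y - x0) + 2 * t * dotp (y - x0) (z - y) +
    t ^+ 2 * dotp (z - y) (z - y).
  have -> : w - x0 = (y - x0) + t *: (z - y) by apply/rowP => i; rewrite /w !mxE; ring.
  exact: dotp_sqrD.
rewrite /f E in hw.
have key : t * (u y + - (2 * k) * dotp (y - x0) (z - y)) <= t * (u z + eps).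
  have h5 : t * (t * c) <= t * eps by rewrite ler_wpM2l // ltW.
  by rewrite /c in h5; lra.
by rewrite ler_pM2l in key.
Qed.

(** Slopes supporting at points that tend to [x0] stay in a compact set. The Fenchel gap [h] at [x0]
    attains its minimum there, and it is small at slopes supporting near [x0], so the minimum is at
    most 0. *)
Lemma subgradient_exists D u x0 : bcf D u -> D x0 -> exists p, subdiff D u x0 p.
Proof.
move=> bu Dx0; have [oD cD [B bB] cu [m [M bu']]] := bu.
have [s s0 Hs] := (open_ballP D).1 oD x0 Dx0.
have s20 : 0 < s / 2 by lra.
pose P := (M - m) / (s / 2 / 2).
pose K := [set p : 'rV[R]_d | `|p| <= P].
have Hnear e : 0 < e -> exists y p, [/\ D y, `|y - x0| < e, K p & subdiff D u y p].
  move=> e0; have e'0 : 0 < Num.min e (s / 2) by rewrite lt_min e0.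
  have [y [p [Dy]]] := subgradient_near bu Dx0 e'0.
  rewrite lt_min => /andP [y1 y2] sp; exists y, p; split => //.
  have ey : erode D (s / 2) y.
    move=> z zy; apply: Hs; have -> : z - x0 = (z - y) + (y - x0) by rewrite addrA subrK.
    by apply: le_lt_trans (ler_normD _ _) _; lra.
  exact: subdiff_bound bu' s20 ey sp.
have cK : compact K by apply: (@bounded_compact _ _ _ P) => //; exact: closed_norm_le.
have K0 : K !=set0 by have [y [p [_ _ Kp _]]] := Hnear 1 ltr01; exists p.
pose h p := u x0 - dotp x0 p - tilt_inf u D p.
have D0 : D !=set0 by exists x0.
have [|p pK Hp] := @EVT_min_rV R d h K K0 cK.
  apply: continuous_subspaceT => p.
  apply: (@cvgB R R 'rV[R]_d (nbhs p) (nbhs_filter p)); last exact: (tilt_cont bu).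
  apply: (@cvgB R R 'rV[R]_d (nbhs p) (nbhs_filter p)); first exact: cvg_cst.
  exact: dotp_continuous.
exists p; apply: subdiff_minE => z Dz.
apply: le_trans (tilt_le p bu (@subset_refl _ D) Dz).
suff : h p <= 0 by rewrite /h dotpC; lra.
apply/ler_addgt0Pr => e e0; rewrite add0r.
pose c : R := d%:R * `|P| + 1.
have c0 : 0 < c by rewrite ltr_wpDl // mulr_ge0.
have [r r0 Hr] := bcf_cont bu Dx0 (ltac:(lra) : 0 < e / 2).
have e2c : 0 < e / 2 / c by rewrite divr_gt0 //; lra.
have [y [q [Dy yx Kq sq]]] := Hnear (Num.min r (e / 2 / c)) ltac:(by rewrite lt_min r0).
move: yx; rewrite lt_min => /andP [y1 y2].
have h1 : h p <= h q by apply: Hp; rewrite inE.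
apply: le_trans h1 _.
have h2 : u y - dotp q y <= tilt_inf u D q.
  by apply: le_tilt => // w Dw; exact: subdiff_min sq Dw.
have [_ h3] := Hr y y1; rewrite ltr_norml in h3; have /andP [h4 h5] := h3.
have h6 : dotp q (y - x0) <= e / 2.
  apply: le_trans (ler_norm _) _; apply: le_trans (dotp_le _ _) _.
  apply: (@le_trans _ _ (c * `|y - x0|)); last by rewrite mulrC -ler_pdivlMr // ltW.
  rewrite ler_wpM2r // /c; apply: (@le_trans _ _ (d%:R * `|P|)); last by rewrite lerDl.
  by rewrite ler_wpM2l //; apply: le_trans Kq _; exact: ler_norm.
by rewrite dotpBr in h6; rewrite /h dotpC; lra.
Qed.

End SubgradientExistence.

Section Chain.
Context {R : realType} {d : nat}.
Implicit Types (x y z p q : 'rV[R]_d) (e : R).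

(* Sum along equally spaced good points: [sum (q_(i+1) - q_i).(x_(i+1) - x_i)] telescopes
   up to [O(1/n)]. *)
Lemma chain_const (f : 'rV[R]_d -> R) (X : 'rV[R]_d -> 'rV[R]_d -> Prop) (B L r : R) p0 q :
  0 <= B -> 0 <= L ->
  (forall p p', `|f p - f p'| <= L * `|p - p'|) ->
  (forall p e, `|p - p0| < r -> 0 < e -> exists q x, [/\ `|q - p| < e & X q x]) ->
  (forall p x, X p x -> `|x| <= B) ->
  (forall p x p' x', X p x -> X p' x' -> `|f p' - f p| <= dotp (p' - p) (x' - x)) ->
  `|q - p0| < r -> f q = f p0.
Proof.
move=> B0 L0 fL dense bX mono qr.
pose D := q - p0.
(* The three terms come from the telescoped main part, from the accumulated errors of the slopes,
   and from the two ends of the chain; each is divided by [N]. *)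
pose C : R := d%:R * `|D| * (2 * B) + d%:R * 2 * (2 * B) + 2 * L.
have C0 : 0 <= C by rewrite !addr_ge0 // !mulr_ge0.
have key n : `|f q - f p0| <= C / n.+1%:R.
  pose N : R := n.+1%:R.
  have N1 : 1 <= N by rewrite /N ler1n.
  have N0 : 0 < N by exact: lt_le_trans N1.
  pose pt (i : nat) := p0 + (i%:R / N) *: D.
  (* Good slopes are taken within [N^-2] of the chain points, so that [N] steps accumulate an error
     of order [N^-1]. *)
  have e0 : 0 < (N ^+ 2)^-1 by rewrite invr_gt0 exprn_gt0.
  have H (i : nat) : exists qx : 'rV[R]_d * 'rV[R]_d, (i <= n.+1)%N ->
      `|qx.1 - pt i| < (N ^+ 2)^-1 /\ X qx.1 qx.2.
    have [ni|ni] := leqP i n.+1; last by exists (0, 0).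
    have hp : `|pt i - p0| < r.
      rewrite /pt addrC addKr normrZ; apply: (le_lt_trans _ qr).
      have iN : 0 <= i%:R / N by rewrite divr_ge0 // ltW.
      rewrite ger0_norm //.
      by rewrite ler_piMl // ler_pdivrMr // mul1r /N ler_nat.
    by have [a [b [h1 h2]]] := dense _ _ hp e0; exists (a, b).
  have [qx Hqx] := choice H.
  pose Q i := (qx i).1; pose Z i := (qx i).2.
  have HQ i : (i <= n.+1)%N -> `|Q i - pt i| < (N ^+ 2)^-1 by move=> /Hqx [].
  have HX i : (i <= n.+1)%N -> X (Q i) (Z i) by move=> /Hqx [].
  have step i : (i < n.+1)%N -> f (Q i.+1) - f (Q i) <= `|f (Q i.+1) - f (Q i)| by move=> _; exact: ler_norm.
  have bd i : (i < n.+1)%N -> `|f (Q i.+1) - f (Q i)| <=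
      N^-1 * (dotp D (Z i.+1) - dotp D (Z i)) + d%:R * (2 * (N ^+ 2)^-1) * (2 * B).
    move=> ni; apply: le_trans (mono _ _ _ _ (HX i (ltnW ni)) (HX i.+1 ni)) _.
    have -> : Q i.+1 - Q i = N^-1 *: D + ((Q i.+1 - pt i.+1) - (Q i - pt i)).
      rewrite /pt -[in i.+1%:R]addn1 natrD mulrDl scalerDl mul1r.
      by apply/rowP => j; rewrite !mxE; ring.
    rewrite dotpDl dotpZl dotpBr; apply: lerD => //.
    apply: le_trans (ler_norm _) _; apply: le_trans (dotp_le _ _) _.
    apply: ler_pM => //.
      rewrite ler_wpM2l //; apply: le_trans (ler_normB _ _) _.
      by move: (HQ i (ltnW ni)) (HQ i.+1 ni); set c := (N ^+ 2)^-1; lra.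
    apply: le_trans (ler_normB _ _) _.
    by have := bX _ _ (HX i (ltnW ni)); have := bX _ _ (HX i.+1 ni); lra.
  have tel : `|f (Q n.+1) - f (Q 0%N)| <=
      N^-1 * (dotp D (Z n.+1) - dotp D (Z 0%N)) + N * (d%:R * (2 * (N ^+ 2)^-1) * (2 * B)).
    have IH k : (k <= n.+1)%N -> `|f (Q k) - f (Q 0%N)| <=
        N^-1 * (dotp D (Z k) - dotp D (Z 0%N)) + k%:R * (d%:R * (2 * (N ^+ 2)^-1) * (2 * B)).
      elim: k => [_|k IHk kn]; first by rewrite !subrr normr0 mulr0 mul0r addr0.
      have -> : f (Q k.+1) - f (Q 0%N) = (f (Q k.+1) - f (Q k)) + (f (Q k) - f (Q 0%N)).
        by rewrite addrA subrK.
      apply: le_trans (ler_normD _ _) _.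
      have := IHk (ltnW kn); have := bd k kn.
      rewrite -[in k.+1%:R]addn1 natrD [(_ + 1) * _]mulrDl mul1r.
      set c := _ * (2 * B); set a := N^-1; lra.
    exact: IH.
  have z0 := bX _ _ (HX 0%N isT); have zn := bX _ _ (HX n.+1 (leqnn _)).
  have h1 : dotp D (Z n.+1) - dotp D (Z 0%N) <= d%:R * `|D| * (2 * B).
    rewrite -dotpBr; apply: le_trans (ler_norm _) _; apply: le_trans (dotp_le _ _) _.
    rewrite ler_wpM2l ?mulr_ge0 //; apply: le_trans (ler_normB _ _) _; lra.
  have pt0 : pt 0%N = p0 by rewrite /pt mul0r scale0r addr0.
  have ptn : pt n.+1 = q by rewrite /pt divff ?gt_eqF // scale1r /D addrC subrK.
  have h2 : `|f q - f (Q n.+1)| <= L * (N ^+ 2)^-1.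
    apply: le_trans (fL _ _) _; rewrite ler_wpM2l //.
    by have := HQ n.+1 (leqnn _); rewrite ptn distrC => /ltW.
  have h3 : `|f (Q 0%N) - f p0| <= L * (N ^+ 2)^-1.
    apply: le_trans (fL _ _) _; rewrite ler_wpM2l //.
    by have := HQ 0%N isT; rewrite pt0 => /ltW.
  have -> : f q - f p0 = (f q - f (Q n.+1)) + (f (Q n.+1) - f (Q 0%N)) + (f (Q 0%N) - f p0).
    by ring.
  apply: le_trans (ler_normD _ _) _; apply: (le_trans (lerD (ler_normD _ _) (lexx _))).
  have a0 : 0 < N^-1 by rewrite invr_gt0.
  have a1 : N^-1 <= 1 by rewrite invf_le1.
  have E2 : (N ^+ 2)^-1 = N^-1 * N^-1 by rewrite expr2 invfM.
  have E3 : N * (d%:R * (2 * (N ^+ 2)^-1) * (2 * B)) = N^-1 * (d%:R * 2 * (2 * B)).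
    by rewrite E2; field; rewrite gt_eqF.
  rewrite E3 in tel.
  have h4 : N^-1 * (dotp D (Z n.+1) - dotp D (Z 0%N)) <= N^-1 * (d%:R * `|D| * (2 * B)).
    by rewrite ler_wpM2l // ltW.
  have h5 : L * (N ^+ 2)^-1 <= N^-1 * L.
    by rewrite E2 mulrC -mulrA; apply: ler_wpM2l; [exact: ltW|rewrite ler_piMl].
  rewrite (_ : C / n.+1%:R = N^-1 * (d%:R * `|D| * (2 * B)) +
      N^-1 * (d%:R * 2 * (2 * B)) + 2 * (N^-1 * L)); last by rewrite /C -/N; ring.
  move: tel h2 h3 h4 h5; set a1' := N^-1 * (_ - _); set a2 := N^-1 * (_ * 2 * _).
  set a3 := N^-1 * L; set a4 := L / _; set a5 := N^-1 * _; lra.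
apply/eqP; rewrite -subr_eq0 -normr_le0; apply/ler_addgt0Pr => e e0; rewrite add0r.
have Ce : 0 < e / (C + 1) by rewrite divr_gt0 // ltr_wpDl.
have [n] := ltr_add_invr Ce; rewrite add0r => hn.
apply: le_trans (key n) _; apply: (@le_trans _ _ ((C + 1) * (e / (C + 1)))).
  by apply: ler_pM => //; [rewrite lerDl|exact: ltW].
by rewrite mulrCA divff ?mulr1 // gt_eqF // ltr_wpDl.
Qed.

End Chain.

Section Comparison.
Context {R : realType} {d : nat} (Rf : 'rV[R]_d -> R)
  (rho : {measure set (BorelRd R d) -> \bar R}) (Hrho : is_density Rf rho).
Implicit Types (x y z p q : 'rV[R]_d) (A K D Om e : set 'rV[R]_d) (u v w : 'rV[R]_d -> R)
  (r s t eps eta m M : R).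

Local Notation W D u e := (wint (subdiff_img D u e) Rf).

Lemma W_diff_negligible Om u v e : bcf Om u -> bcf Om v ->
  measurable (e : set (BorelRd R d)) -> e `<=` Om ->
  subdiff_img Om v e `<=` subdiff_img Om u e ->
  (W Om u e <= W Om v e)%E -> (W Om v e < +oo)%E ->
  rho.-negligible (subdiff_img Om u e `\` subdiff_img Om v e : set (BorelRd R d)).
Proof.
move=> bu bv me eOm vu uv vfin; have [sand _ _ _] := Hrho.
have [nu [N [mN N0 _ mT _]]] := MA_ex Hrho bu.
have [nu' [N' [mN' N0' _ mT' _]]] := MA_ex Hrho bv.
have mA := mT e me; have mA' := mT' e me.
rewrite (setIidl eOm) in mA mA'.
pose A : set (BorelRd R d) := subdiff_img Om u e `\` N; rewrite -/A in mA.
pose A' : set (BorelRd R d) := subdiff_img Om v e `\` N'; rewrite -/A' in mA'.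
have uE : W Om u e = rho A.
  apply: (sand _ _ N) => //; first by move=> x [].
  by move=> x ex; have [Nx|Nx] := pselect (N x); [right|left].
have vE : W Om v e = rho A'.
  apply: (sand _ _ N') => //; first by move=> x [].
  by move=> x ex; have [Nx|Nx] := pselect (N' x); [right|left].
rewrite uE vE in uv vfin.
have mAA : measurable (A `\` A') by exact: measurableD.
exists ((A `\` A') `|` N); split.
- by apply: measurableU.
- apply/eqP; rewrite eq_le measure_ge0 andbT.
  apply: le_trans (measure_setU_null mAA mN N0) _.
  have h : (rho (A `\` A') + rho A' <= 0 + rho A')%E.
    rewrite -measureU //; last by apply/seteqP; split => // x [[]].
    rewrite add0e; apply: le_trans uv; apply: le_trans (measure_setU_null mA mN N0).
    apply: le_measure; rewrite ?inE //; [exact: measurableU|exact: measurableU|].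
    move=> x [[]|[vx _]]; first by left.
    by have [Nx|Nx] := pselect (N x); [right|left; split => //; exact: vu].
  by rewrite leeD2rE // ge0_fin_numE // in h.
- move=> x [ux vx]; have [Nx|Nx] := pselect (N x); first by right.
  by left; split => // -[].
Qed.

Lemma not_negligible_ball (Bad : set (BorelRd R d)) p r : rho.-negligible Bad -> 0 < r ->
  exists2 q, `|q - p| < r & ~ Bad q.
Proof.
move=> [M [mM M0 BM]] r0; have [_ _ rho_o _] := Hrho.
apply: contrapT => H; have := rho_o p r r0; apply/negP; rewrite -leNgt -M0.
apply: le_measure; rewrite ?inE //; first by apply: open_borel; exact: oball_open.
move=> q /= pq; apply: BM; apply: contrapT => nB; apply: H; exists q => //.
by rewrite distrC.
Qed.

Lemma bcf_superlevel_open Om u v t : bcf Om u -> bcf Om v ->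
  open [set x | Om x /\ t < v x - u x].
Proof.
move=> bu bv; apply/open_ballP => x [Ox tx].
have e0 : 0 < (v x - u x - t) / 2 by lra.
have [r1 r10 H1] := bcf_cont bu Ox e0; have [r2 r20 H2] := bcf_cont bv Ox e0.
exists (Num.min r1 r2); first by rewrite lt_min r10.
move=> y; rewrite lt_min => /andP [/H1 [Oy h1] /H2 [_ h2]].
by split => //; move: h1 h2; rewrite !ltr_norml => /andP [? ?] /andP [? ?]; lra.
Qed.

Theorem comparison Om u v : (0 < d)%N -> bcf Om u -> bcf Om v ->
  (forall O, open O -> O `<=` Om -> (W Om u O <= W Om v O)%E) ->
  (forall t, 0 < t -> exists K, [/\ compact K, K `<=` Om &
      forall x, Om x -> ~ K x -> v x - u x <= t]) ->
  forall x, Om x -> v x <= u x.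
Proof.
move=> d0 bu bv Wuv bdr x1 Ox1; rewrite leNgt; apply/negP => uv1.
have [oO cO [B bB] cu [mu_ [Mu bu']]] := bu; have [_ _ _ cv [mv [Mv bv']]] := bv.
(* Half the excess at [x1]: superlevel sets of [v - u] from level [t] up lie in the compact set [K],
   and the maximum exceeds [t]. *)
pose t := (v x1 - u x1) / 2.
have t0 : 0 < t by rewrite /t; lra.
have [K [cK KO offK]] := bdr t t0.
have Kx1 : K x1 by apply: contrapT => /(offK x1 Ox1); rewrite /t; lra.
have K0 : K !=set0 by exists x1.
have cuv : {within K, continuous (fun x => v x - u x)}.
  by move=> x; apply: cvgB; [exact: (bcf_within bv KO)|exact: (bcf_within bu KO)].
have [x0 x0K Hx0] := EVT_max_rV K0 cK cuv.
rewrite inE in x0K; have Ox0 := KO x0 x0K.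
pose M0 := v x0 - u x0.
have tM0 : t < M0.
  have : v x1 - u x1 <= M0 by apply: Hx0; rewrite inE.
  by rewrite /t; lra.
have leM0 x : Om x -> v x - u x <= M0.
  move=> Ox; have [Kx|nK] := pselect (K x); first by apply: Hx0; rewrite inE.
  by apply: le_trans (offK x Ox nK) _; exact: ltW.
pose E s := [set x | Om x /\ s < v x - u x].
have EO s : E s `<=` Om by move=> x [].
have EK s : t <= s -> E s `<=` K.
  move=> ts x [Ox sx]; apply: contrapT => /(offK x Ox); lra.
have oE s : open (E s) by exact: bcf_superlevel_open.
have mE s : measurable (E s : set (BorelRd R d)) by exact: open_borel.
have touch s x q : t <= s -> E s x ->
    (forall y, Om y -> ~ E s y -> u x - dotp q x < u y - dotp q y) -> subdiff_img Om u (E s) q.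
  move=> ts Ex H; have [y Ky Hy] := compact_min q K0 cK (bcf_within bu KO).
  have yx : u y - dotp q y <= u x - dotp q x by apply: Hy; apply: EK Ex.
  have Ey : E s y by apply: contrapT => /(H y (KO y Ky)); lra.
  exists y => //; apply: subdiff_minE => z Oz.
  have [Ez|nE] := pselect (E s z); first by apply: Hy; exact: EK Ez.
  by apply: le_trans yx _; apply: ltW; exact: H.
(* Outside [E s] the excess [v - u] is at most [s], hence less than at [x]. There [u] minus the tilt
   is thus strictly higher than at [x], and its minimum falls in [E s]. *)
have vu s : t <= s -> subdiff_img Om v (E s) `<=` subdiff_img Om u (E s).
  move=> ts p [x Ex sp]; apply: (touch s x) => // y Oy nE.
  have h1 := subdiff_min sp Oy; have [Ox sx] := Ex.
  have h2 : v y - u y <= s by rewrite leNgt; apply/negP => h; apply: nE.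
  lra.
have Wfin s : t <= s -> (W Om v (E s) < +oo)%E.
  move=> ts; have [r r0 Kr] := compact_erode cK oO KO.
  have [_ rho_b _ _] := Hrho; apply: le_lt_trans (rho_b ((Mv - mv) / (r / 2))).
  apply: (W_le_rho Hrho) => //; first by apply: closed_borel; exact: closed_norm_le.
  apply: subdiff_img_erode_bounded bv' r0 _; apply: subset_trans Kr; exact: EK.
have [_ _ _ rho_line] := Hrho.
(* Only rational levels are treated, to keep the bad set negligible; they suffice because a rational
   lies between any two distinct values of [v - u]. *)
pose F (a : rat) : set (BorelRd R d) := if t <= ratr a
  then subdiff_img Om u (E (ratr a)) `\` subdiff_img Om v (E (ratr a)) else set0.
pose Bad : set (BorelRd R d) := (nonuniq Om u `|` nonuniq Om v) `|` \bigcup_a F a.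
have nBad : rho.-negligible Bad.
  apply: negligibleU; first by apply: negligibleU; exact: nonuniq_negligible rho_line _.
  apply: negligible_countable => a; rewrite /F; case: ifP => ta; last exact: negligible_set0.
  apply: W_diff_negligible => //; [exact: vu|exact: Wuv|exact: Wfin].
have uniq_u q x y : ~ Bad q -> Om x -> Om y -> subdiff Om u x q -> subdiff Om u y q -> x = y.
  move=> nb Ox Oy sx sy; apply: contrapT => /eqP xy; apply: nb; left; left.
  by exists x, y.
have uniq_v q x y : ~ Bad q -> Om x -> Om y -> subdiff Om v x q -> subdiff Om v y q -> x = y.
  move=> nb Ox Oy sx sy; apply: contrapT => /eqP xy; apply: nb; left; right.
  by exists x, y.
(* Let [x] be the contact point of [u]. As [q] is a slope of [v] at every rational level from [t] up
   to the excess at [x], the contact point [y] of [v] has at least that excess. The two support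
   inequalities then make [y] a contact point of [u] as well. *)
have common q : ~ Bad q -> subdiff_img Om u (E t) q ->
    exists x, [/\ Om x, subdiff Om u x q & subdiff Om v x q].
  move=> nb [x [Ox tx] sux]; exists x.
  have Fq (a : rat) : t <= ratr a -> ratr a < v x - u x -> subdiff_img Om v (E (ratr a)) q.
    move=> ta ax; apply: contrapT => nv; apply: nb; right; exists a => //.
    by rewrite /F ta; split => //; exists x.
  have [a0] := rat_in_itvoo tx; rewrite in_itv /= => /andP [ta0 a0x].
  have [y [Oy a0y] svy] := Fq a0 (ltW ta0) a0x.
  have ge : v x - u x <= v y - u y.
    rewrite leNgt; apply/negP => lt.
    have lt' : Num.max t (v y - u y) < v x - u x by rewrite gt_max tx lt.
    have [a] := rat_in_itvoo lt'; rewrite in_itv /= gt_max => /andP [/andP [ta ya] ax].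
    have [y' [Oy' ay'] svy'] := Fq a (ltW ta) ax.
    by have yy' := uniq_v q y y' nb Oy Oy' svy svy'; subst y'; lra.
  have h1 := subdiff_min sux Oy; have h2 := subdiff_min svy Ox.
  have suy : subdiff Om u y q.
    apply: subdiff_minE => z Oz; have := subdiff_min sux Oz; lra.
  by rewrite (uniq_u q x y nb Ox Oy sux suy).
pose C := [set x | K x /\ M0 <= v x - u x].
have cC : compact C.
  apply: (@bounded_compact _ _ _ B); last by move=> x [/KO /bB].
  apply: closed_seqP => x Hx.
  have Kx : K x.
    have clK : closed K by apply: compact_closed cK; exact: norm_hausdorff.
    apply: clK => U /nbhs_ballP [e /= e0 He]; have [y [[Ky _] yx]] := Hx e e0.
    by exists y; split => //; apply: He; rewrite ball_rVE /= distrC.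
  split => //=; apply/ler_addgt0Pr => e e0.
  have e2 : 0 < e / 2 by lra.
  have [r1 r10 H1] := bcf_cont bu (KO x Kx) e2; have [r2 r20 H2] := bcf_cont bv (KO x Kx) e2.
  have [y [[_ /= My] yx]] := Hx (Num.min r1 r2) ltac:(by rewrite lt_min r10).
  move: yx; rewrite lt_min => /andP [/H1 [_ h1] /H2 [_ h2]].
  by move: h1 h2; rewrite !ltr_norml => /andP [? ?] /andP [? ?]; lra.
have CO : C `<=` Om by move=> x [/KO].
pose Q := subdiff_img Om v C.
have Q0 : Q !=set0.
  by have [p sp] := subgradient_exists bv Ox0; exists p, x0.
have cQ : compact Q.
  have [r r0 Kr] := compact_erode cC oO CO.
  apply: (@bounded_compact _ _ _ ((Mv - mv) / (r / 2))).
    exact: subdiff_img_closed.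
  by move=> p Qp; exact: (subdiff_img_erode_bounded bv' r0 Kr Qp).
(* Openness contradicts compactness through one coordinate: [p0] is taken in [Q] with the largest
   coordinate [i0]. *)
pose i0 : 'I_d := Ordinal d0.
have cc : continuous (fun x : 'rV[R]_d => x 0 i0 : R).
  move=> x; apply: continuous_rVP => e e0; exists e => // y yx.
  by rewrite -rV_subE; apply: le_lt_trans yx; exact: rV_coord_le.
have [p0 p0Q Hp0] := EVT_max_rV Q0 cQ (continuous_subspaceT cc).
rewrite inE in p0Q; have [z0 [Kz0 Mz0] sv0] := p0Q.
have Oz0 := KO z0 Kz0.
have z0M : v z0 - u z0 = M0 by apply/le_anti; rewrite Mz0 leM0.
have su0 : subdiff Om u z0 p0.
  apply: subdiff_minE => y Oy; have := subdiff_min sv0 Oy; have := leM0 y Oy; lra.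
pose L : R := d%:R * `|B|.
have L0 : 0 <= L by rewrite mulr_ge0.
have bB' x : Om x -> `|x| <= `|B| by move=> /bB /le_trans; apply; exact: ler_norm.
(* Changing the slope by less than [r] alters its pairing with differences of points of [Om] by less
   than [M0 - t], so [u] still touches inside [E t]. *)
pose r := (M0 - t) / (2 * L + 1).
have r0 : 0 < r by rewrite divr_gt0 ?subr_gt0 //; lra.
have ballE q : `|q - p0| < r -> subdiff_img Om u (E t) q.
  move=> qr; apply: (touch t z0) => //; first by split => //; rewrite z0M.
  move=> y Oy nE; have h1 := subdiff_min sv0 Oy.
  have h2 : v y - u y <= t by rewrite leNgt; apply/negP => h; apply: nE.
  have h3 : dotp (q - p0) (y - z0) < M0 - t.
    apply: le_lt_trans (ler_norm _) _; apply: le_lt_trans (dotp_le _ _) _.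
    have h4 : `|y - z0| <= 2 * `|B|.
      by apply: le_trans (ler_normB _ _) _; have := bB' y Oy; have := bB' z0 Oz0; lra.
    apply: (@le_lt_trans _ _ (`|q - p0| * (2 * L + 1))); last by rewrite -ltr_pdivlMr //; lra.
    rewrite mulrC mulrA [X in X <= _]mulrC ler_wpM2l //.
    have : `|y - z0| * d%:R <= 2 * `|B| * d%:R by rewrite ler_wpM2r.
    rewrite /L; lra.
  by rewrite dotpBl !dotpBr in h3; lra.
have O0 : Om !=set0 by exists x0.
pose f q := tilt_inf v Om q - tilt_inf u Om q.
pose X q x := [/\ ~ Bad q, Om x, subdiff Om u x q & subdiff Om v x q].
have tiltE w x q : bcf Om w -> Om x -> subdiff Om w x q -> tilt_inf w Om q = w x - dotp q x.
  move=> bw Ox sw; apply/le_anti; rewrite (tilt_le q bw (@subset_refl _ Om) Ox) /=.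
  by apply: le_tilt => // y Oy; exact: subdiff_min sw Oy.
have fp0 : f p0 = M0 by rewrite /f (tiltE v z0) // (tiltE u z0) // -z0M; ring.
have fX q x : X q x -> f q = v x - u x.
  by move=> [_ Ox su sv]; rewrite /f (tiltE v x) // (tiltE u x) //; ring.
have dense p (e : R) : `|p - p0| < r -> 0 < e -> exists q x, `|q - p| < e /\ X q x.
  move=> pr e0; have e'0 : 0 < Num.min e (r - `|p - p0|) by rewrite lt_min e0; lra.
  have [q] := not_negligible_ball p nBad e'0; rewrite lt_min => /andP [qp1 qp2] nb.
  have qr : `|q - p0| < r.
    have -> : q - p0 = (q - p) + (p - p0) by rewrite addrA subrK.
    by apply: le_lt_trans (ler_normD _ _) _; lra.
  have [x [Ox su sv]] := common q nb (ballE q qr).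
  by exists q, x.
have fconst q : `|q - p0| < r -> f q = M0.
  move=> qr; rewrite -fp0; apply: (@chain_const _ _ f X `|B| (2 * L) r) => //.
  - by rewrite mulr_ge0.
  - move=> p p'; rewrite /f.
    have h1 := tilt_lip p p' bv bB' (@subset_refl _ Om) O0.
    have h2 := tilt_lip p p' bu bB' (@subset_refl _ Om) O0.
    rewrite (_ : _ - _ = (tilt_inf v Om p - tilt_inf v Om p') - (tilt_inf u Om p - tilt_inf u Om p')); last by ring.
    by apply: le_trans (ler_normB _ _) _; rewrite -/L in h1 h2; lra.
  - by move=> p x [_ Ox _ _]; exact: bB'.
  - move=> p x p' x' Xp Xp'; rewrite (fX _ _ Xp) (fX _ _ Xp').
    have [_ Ox su sv] := Xp; have [_ Ox' su' sv'] := Xp'.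
    have h1 := subdiff_min su Ox'; have h2 := subdiff_min su' Ox.
    have h3 := subdiff_min sv Ox'; have h4 := subdiff_min sv' Ox.
    rewrite dotpBl !dotpBr ler_norml; apply/andP; split; lra.
(* Beyond [p0] by [r / 2] in coordinate [i0]: a good slope within [r / 4] of [q0] belongs to [Q] and
   exceeds the maximum. *)
pose q0 := p0 + (r / 2) *: delta_mx 0 i0.
have q0r : `|q0 - p0| <= r / 2.
  rewrite /q0 addrC addKr normrZ ger0_norm; last by rewrite divr_ge0 // ltW.
  by rewrite ler_piMr ?norm_delta_le // divr_ge0 // ltW.
have [q [x [qq0 Xq]]] := dense q0 (r / 4) ltac:(lra) ltac:(lra).
have qr : `|q - p0| < r.
  have -> : q - p0 = (q - q0) + (q0 - p0) by rewrite addrA subrK.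
  by apply: le_lt_trans (ler_normD _ _) _; lra.
have Qq : Q q.
  have [nb Ox su sv] := Xq; exists x => //.
  have E1 := fconst q qr; rewrite (fX _ _ Xq) in E1.
  split; last by rewrite E1.
  by apply: (EK t (lexx t)); split => //; rewrite E1.
have := Hp0 q; rewrite inE => /(_ Qq).
have := le_lt_trans (rV_coord_le (q - q0) i0) qq0.
rewrite rV_subE /q0 !mxE !eqxx mulr1 ltr_norml => /andP [h1 h2] h3.
lra.
Qed.

End Comparison.

(** * Compactness and affine barriers *)

Section Compactness.
Context {R : realType} {d : nat}.
Implicit Types (x y z p q : 'rV[R]_d) (A K D Om : set 'rV[R]_d) (u v w : 'rV[R]_d -> R)
  (r s t e eps m M B : R).

Lemma erode_erode Om r s : erode Om r `<=` erode (erode Om (r - s)) s.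
Proof. by move=> x Hx y yx; apply: (erode_near Hx); exact: ltW. Qed.

(* A limit along an ultrafilter exists pointwise; equi-Lipschitz bounds make it locally uniform. *)
Lemma convex_cluster T (F : set_system T) (PF : ProperFilter F) Om B m M
    (D : T -> set 'rV[R]_d) (u : T -> 'rV[R]_d -> R) :
  open Om -> convex_setE Om -> (forall x, Om x -> `|x| <= B) ->
  (forall s, 0 < s -> F [set t | erode Om s `<=` D t]) ->
  F [set t | bcf (D t) (u t) /\ forall x, D t x -> m <= u t x <= M] ->
  exists w, [/\ bcf Om w, forall x, Om x -> m <= w x <= M &
    forall P s eps, F P -> 0 < s -> 0 < eps -> exists a, [/\ P a,
      bcf (D a) (u a), (forall x, D a x -> m <= u a x <= M), erode Om s `<=` D a &
      forall x, erode Om s x -> `|u a x - w x| <= eps]].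
Proof.
move=> oO cO bB FD Fu.
have [G [GU FG]] := ultraFilterLemma PF.
have GP := @ultra_proper _ _ GU.
have Gu := FG _ Fu; have GD s (sp : 0 < s) := FG _ (FD s sp).
have Gx x : Om x -> G [set t | m <= u t x <= M].
  move=> Ox; have [n Hn] := open_erode oO Ox.
  have n0 : 0 < n.+1%:R^-1 :> R by rewrite invr_gt0 ltr0n.
  by apply: filterS2 Gu (GD _ n0) => t [_ bt] Dt; apply: bt; exact: Dt.
have Hlim x : exists l, Om x -> forall eps, 0 < eps -> G [set t | `|u t x - l| < eps].
  have [Ox|nO] := pselect (Om x); last by exists 0.
  (* The limit along the ultrafilter is the supremum of the levels that [u t x] eventually
     dominates; the ultrafilter property gives the matching upper bound. *)
  pose S := [set a | G [set t | a <= u t x]].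
  have Sm : S m by apply: filterS (Gx x Ox) => t /andP [].
  have SM : ubound S M.
    move=> a Sa; have [t [/= h1 /andP [_ h2]]] := filter_ex (filterI Sa (Gx x Ox)).
    exact: le_trans h1 h2.
  have hS : has_sup S by split; [exists m|exists M].
  exists (sup S) => _ eps eps0.
  have [a Sa ha] := sup_adherent eps0 hS.
  have nS : ~ S (sup S + eps / 2).
    move=> h; have := @ub_le_sup _ S hS.2 _ h; lra.
  have [//|h] := in_ultra_setVsetC [set t | sup S + eps / 2 <= u t x] GU.
  apply: filterS2 Sa h => t /= h1 /negP; rewrite -ltNge => h2.
  by rewrite ltr_norml; apply/andP; split; lra.
have [w Hw] := choice Hlim.
have wb x : Om x -> m <= w x <= M.
  move=> Ox; apply/andP; split; apply/ler_addgt0Pr => eps eps0.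
    have [t [/= h1 /andP [h2 h3]]] := filter_ex (filterI (Hw x Ox eps eps0) (Gx x Ox)).
    by move: h1; rewrite ltr_norml => /andP [? ?]; lra.
  have [t [/= h1 /andP [h2 h3]]] := filter_ex (filterI (Hw x Ox eps eps0) (Gx x Ox)).
  by move: h1; rewrite ltr_norml => /andP [? ?]; lra.
have cw : convex_fun_on Om w.
  move=> x y Ox Oy t t01.
  have Oz := cO x y Ox Oy t t01; set z := t *: x + (1 - t) *: y in Oz *.
  have [n1 H1] := open_erode oO Ox; have [n2 H2] := open_erode oO Oy.
  have n0 (n : nat) : 0 < n.+1%:R^-1 :> R by rewrite invr_gt0 ltr0n.
  apply/ler_addgt0Pr => eps eps0; have e2 : 0 < eps / 2 by lra.
  have h1 := Hw x Ox _ e2; have h2 := Hw y Oy _ e2; have h3 := Hw z Oz _ e2.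
  have [a [[/= a1 a2] [a3 [[[_ _ _ cu _] _] [a5 a6]]]]] := filter_ex
    (filterI (filterI h1 h2) (filterI h3 (filterI Gu (filterI (GD _ (n0 n1)) (GD _ (n0 n2)))))).
  have := cu x y (a5 _ H1) (a6 _ H2) t t01; rewrite -/z => c.
  move: a1 a2 a3; rewrite !ltr_norml => /andP [? ?] /andP [? ?] /andP [? ?].
  have /andP [t0 t1] := t01.
  have i1 : t * u a x <= t * (w x + eps / 2) by rewrite ler_wpM2l //; lra.
  have i2 : (1 - t) * u a y <= (1 - t) * (w y + eps / 2) by rewrite ler_wpM2l //; lra.
  lra.
have bw : bcf Om w by split => //; [exists B|exists m, M].
exists w; split => // P s eps FP s0 eps0.
have GPP := FG _ FP.
have s2 : 0 < s / 2 by lra.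
have s4 : 0 < s / 4 by lra.
have GK : \forall t \near G, erode Om s `<=` [set x | `|u t x - w x| <= eps].
  have cK : compact (erode Om s) by exact: erode_compact s0 bB.
  have HH := (compact_near_coveringP _).1 cK T G (fun (a : T) x => `|u a x - w x| <= eps) _.
  suff H : forall x, erode Om s x -> \forall x' \near x & i \near G, `|u i x' - w x'| <= eps.
    exact: (HH _ H).
  move=> {HH} x Kx.
  have Ox : Om x by exact: erode_sub s0 _ Kx.
  have mM : m <= M by have /andP [h1 h2] := wb x Ox; exact: le_trans h1 h2.
  pose L := (M - m) / (s / 4) + 1.
  have L0 : 0 < L by rewrite /L ltr_wpDl // divr_ge0 ?subr_ge0 // ltW.
  (* Three errors of [eps / 3]: the oscillations of [u t] and of [w] over this ball, and the
     pointwise error at its centre [x]. *)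
  pose rad := Num.min (s / 2) (eps / 3 / L).
  have rad0 : 0 < rad by rewrite lt_min s2 /= divr_gt0 //; lra.
  have e3 : 0 < eps / 3 by lra.
  exists (ball x rad, [set t | [/\ `|u t x - w x| < eps / 3, erode Om (s / 4) `<=` D t &
      bcf (D t) (u t) /\ forall x, D t x -> m <= u t x <= M]]).
    split => /=; first exact: nbhsx_ballx.
    apply: filterS2 (Hw x Ox _ e3) (filterI Gu (GD _ s4)) => t /= h1 [h2 h3].
    by split.
  move=> [y t] [/=]; rewrite ball_rVE /= lt_min => /andP [y1 y2] [t1 t2 [bt bt']].
  have lip D' v : erode Om (s / 4) `<=` D' -> convex_fun_on D' v ->
      (forall x, D' x -> m <= v x <= M) -> `|v y - v x| <= eps / 3.
    move=> OD cv bv.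
    have ex : erode D' (s / 4) x.
      have : erode Om (s / 2) x by apply: erode_mono Kx => //; lra.
      move=> /(@erode_erode Om (s / 2) (s / 4)) h z zx; apply: OD.
      by have := h z zx; rewrite (_ : s / 2 - s / 4 = s / 4) //; lra.
    have ey : erode D' (s / 4) y.
      have : erode Om (s / 2) y.
        rewrite (_ : s / 2 = s - s / 2); last by lra.
        by apply: (erode_near Kx); rewrite distrC ltW.
      move=> /(@erode_erode Om (s / 2) (s / 4)) h z zx; apply: OD.
      by have := h z zx; rewrite (_ : s / 2 - s / 4 = s / 4) //; lra.
    apply: le_trans (bcf_lip cv bv s4 ex ey) _.
    apply: (@le_trans _ _ (L * `|y - x|)); first by rewrite ler_wpM2r // /L lerDl.
    by rewrite mulrC -ler_pdivlMr // distrC ltW.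
  have [_ _ _ cut _] := bt.
  have l1 := lip _ _ t2 cut bt'.
  have l2 := lip Om w (erode_sub s4) cw wb.
  have -> : u t y - w y = (u t y - u t x) + (u t x - w x) - (w y - w x) by ring.
  apply: le_trans (ler_normB _ _) _; apply: (le_trans (lerD (ler_normD _ _) (lexx _))).
  lra.
have [t [Pt [[bt bt'] [Dt Kt]]]] := filter_ex (filterI GPP (filterI Gu (filterI (GD s s0) GK))).
by exists t.
Qed.

End Compactness.

(** * Boundary geometry of convex domains *)

Section Geometry.
Context {R : realType} {d : nat}.
Implicit Types (x y z p q b : 'rV[R]_d) (A K D Om : set 'rV[R]_d) (u v w : 'rV[R]_d -> R)
  (r s t e eps m M B : R).

Lemma norm_le_enorm x : `|x| <= enorm x.
Proof.
rewrite -(@ler_pXn2r _ 2) // ?nnegrE ?sqrtr_ge0 //.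
by rewrite /enorm sqr_sqrtr ?dotp_ge0 // sqr_norm_le_dotp.
Qed.

Lemma enorm_le_norm x : enorm x <= d%:R * `|x|.
Proof.
rewrite /enorm -[X in _ <= X]ger0_norm ?mulr_ge0 // -sqrtr_sqr ler_sqrt ?sqr_ge0 //.
apply: le_trans (ler_norm _) _; apply: le_trans (dotp_le _ _) _.
rewrite exprMn [_ ^+ 2 in leRHS]expr2 expr2 -mulrA ler_wpM2r ?mulr_ge0 //.
by rewrite -natrM ler_nat; case: (d) => // n; rewrite leq_pmulr.
Qed.

Lemma enorm_scale a x : 0 <= a -> enorm (a *: x) = a * enorm x.
Proof.
move=> a0; rewrite /enorm dotpZl dotpZr mulrA -expr2 sqrtrM ?sqr_ge0 //.
by rewrite sqrtr_sqr ger0_norm.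
Qed.

Lemma enormN x : enorm (- x) = enorm x.
Proof. by rewrite /enorm dotpNl dotpNr opprK. Qed.

Lemma enorm_gt0 x : x != 0 -> 0 < enorm x.
Proof. by move=> x0; apply: lt_le_trans (norm_le_enorm x); rewrite normr_gt0. Qed.

Lemma closureP A x : closure A x <-> forall e, 0 < e -> exists y, A y /\ `|y - x| < e.
Proof.
split.
  move=> cx e e0; have [y [Ay]] := cx _ (nbhsx_ballx x e e0).
  by rewrite ball_rVE /= => xy; exists y; rewrite distrC.
move=> H U /nbhs_ballP [e /= e0 He]; have [y [Ay yx]] := H e e0.
by exists y; split => //; apply: He; rewrite ball_rVE /= distrC.
Qed.

Lemma bdry_open Om : open Om -> bdry Om = closure Om `\` Om.
Proof.
move=> oO; rewrite /bdry (_ : interior Om = Om) //; apply/seteqP; split.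
  exact: interior_subset.
by move: oO; rewrite openE.
Qed.

Lemma closure_bounded A B : (forall x, A x -> `|x| <= B) -> forall x, closure A x -> `|x| <= B.
Proof.
move=> bB x /closureP H; apply/ler_addgt0Pr => e e0; have [y [Ay yx]] := H e e0.
have -> : x = y - (y - x) by rewrite opprB addrC subrK.
by apply: le_trans (ler_normB _ _) _; have := bB y Ay; lra.
Qed.

Lemma closure_compact A B : (forall x, A x -> `|x| <= B) -> compact (closure A).
Proof.
move=> bB; apply: (@bounded_compact _ _ _ B); first exact: closed_closure.
exact: closure_bounded.
Qed.

Lemma bdry_compact Om B : open Om -> (forall x, Om x -> `|x| <= B) -> compact (bdry Om).
Proof.
move=> oO bB; rewrite bdry_open //; apply: (@bounded_compact _ _ _ B).
  by apply: closedI; [exact: closed_closure|rewrite closedC].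
by move=> x [cx _]; exact: closure_bounded bB x cx.
Qed.

Lemma convex_closure Om : convex_setE Om -> convex_setE (closure Om).
Proof.
move=> cO x y /closureP cx /closureP cy t /andP [t0 t1]; apply/closureP => e e0.
have [x' [Ox' xx']] := cx e e0; have [y' [Oy' yy']] := cy e e0.
exists (t *: x' + (1 - t) *: y'); split; first by apply: cO => //; apply/andP.
have -> : t *: x' + (1 - t) *: y' - (t *: x + (1 - t) *: y) =
  t *: (x' - x) + (1 - t) *: (y' - y) by apply/rowP => i; rewrite !mxE; ring.
apply: le_lt_trans (ler_normD _ _) _; rewrite !normrZ (ger0_norm t0) ger0_norm ?subr_ge0 //.
have [->|tn1] := eqVneq t 1; first by rewrite subrr mul0r mul1r addr0.
have h1 : t * `|x' - x| <= t * e by rewrite ler_wpM2l // ltW.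
have h2 : (1 - t) * `|y' - y| < (1 - t) * e by rewrite ltr_pM2l // subr_gt0 lt_neqAle tn1.
lra.
Qed.

Lemma open_closure_segment Om x b t : open Om -> convex_setE Om -> Om x -> closure Om b ->
  0 < t <= 1 -> Om (t *: x + (1 - t) *: b).
Proof.
move=> oO cO Ox /closureP cb /andP [t0 t1].
have [r r0 Hr] := (open_ballP Om).1 oO x Ox.
have [t1'|/eqP] := eqVneq t 1; first by rewrite t1' subrr scale0r addr0 scale1r.
move=> /eqP tn1; have t1' : 0 < 1 - t by rewrite subr_gt0 lt_neqAle tn1.
have [y [Oy yb]] := cb (r * t / (1 - t)) ltac:(by rewrite divr_gt0 // mulr_gt0).
pose x' := x + ((1 - t) / t) *: (b - y).
have Ox' : Om x'.
  apply: Hr; rewrite /x' addrC addKr normrZ ger0_norm ?divr_ge0 ?(ltW t0) ?(ltW t1') //.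
  rewrite distrC mulrAC ltr_pdivrMr //; rewrite ltr_pdivlMr // in yb.
  by rewrite mulrC.
have -> : t *: x + (1 - t) *: b = t *: x' + (1 - t) *: y.
  by rewrite /x'; apply/rowP => i; rewrite !mxE; field; rewrite gt_eqF.
by apply: cO => //; rewrite ltW.
Qed.

(** Prolong the segment from [x0] slightly beyond [x]: its end is in the closure, and
    [open_closure_segment] puts [x] in [Om]. This is what places the mesh domain inside [Om]. *)
Lemma interior_closure_convex Om x : open Om -> convex_setE Om -> Om !=set0 ->
  (exists2 r, 0 < r & forall y, `|y - x| < r -> closure Om y) -> Om x.
Proof.
move=> oO cO [x0 Ox0] [r r0 Hr].
have [->//|xx0] := eqVneq x x0.
have n0 : 0 < `|x - x0| by rewrite normr_gt0 subr_eq0.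
pose s := r / 2 / `|x - x0|.
have s0 : 0 < s by rewrite !divr_gt0.
pose b := x + s *: (x - x0).
have cb : closure Om b.
  apply: Hr; rewrite /b addrC addKr normrZ gtr0_norm // mulfVK ?gt_eqF //; lra.
have -> : x = (s / (1 + s)) *: x0 + (1 - s / (1 + s)) *: b.
  by rewrite /b; apply/rowP => i; rewrite !mxE; field; rewrite gt_eqF // addr_gt0.
apply: open_closure_segment => //.
by rewrite divr_gt0 ?addr_gt0 //= ler_pdivrMr ?addr_gt0 // mul1r lerDr.
Qed.

Lemma bdry_cross Om x z : open Om -> Om x -> ~ Om z ->
  exists2 t, 0 <= t <= 1 & bdry Om (x + t *: (z - x)) .
Proof.
move=> oO Ox nz; rewrite bdry_open //.
pose S := [set t | 0 <= t <= 1 /\ Om (x + t *: (z - x))].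
have S0 : S 0 by split; [rewrite lexx ler01|rewrite scale0r addr0].
have hS : has_sup S by split; [by exists 0|exists 1 => t [/andP []]].
pose t := sup S.
have t0 : 0 <= t by apply: ub_le_sup S0; exact: hS.2.
have t1 : t <= 1 by apply: ge_sup; [exists 0|move=> s [/andP []]].
exists t; first by rewrite t0.
split.
  apply/closureP => e e0.
  have e'0 : 0 < e / (`|z - x| + 1) by rewrite divr_gt0 // ltr_wpDl.
  have [s [/andP [s0 s1] Os] st] := sup_adherent e'0 hS.
  exists (x + s *: (z - x)); split => //.
  have -> : x + s *: (z - x) - (x + t *: (z - x)) = (s - t) *: (z - x).
    by apply/rowP => i; rewrite !mxE; ring.
  have st' : s <= t by apply: ub_le_sup; [exact: hS.2|split => //; rewrite s0].
  rewrite normrZ ler0_norm ?subr_le0 // opprB.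
  apply: (@le_lt_trans _ _ ((t - s) * (`|z - x| + 1))).
    by rewrite ler_wpM2l ?subr_ge0 // lerDl.
  by rewrite -ltr_pdivlMr ?ltr_wpDl // -/t in st *; lra.
move=> Ot; have tn1 : t != 1.
  by apply/eqP => E; apply: nz; move: Ot; rewrite E scale1r addrC subrK.
have [r r0 Hr] := (open_ballP Om).1 oO _ Ot.
have n0 : 0 < `|z - x| + 1 by rewrite ltr_wpDl.
pose s := Num.min 1 (t + r / (2 * (`|z - x| + 1))).
have ts : t < s.
  by rewrite lt_min lt_neqAle tn1 t1 /= ltrDl divr_gt0 // mulr_gt0.
have Ss : S s.
  split; first by rewrite (le_trans t0 (ltW ts)) /= ge_min lexx.
  apply: Hr; have -> : x + s *: (z - x) - (x + t *: (z - x)) = (s - t) *: (z - x).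
    by apply/rowP => i; rewrite !mxE; ring.
  rewrite normrZ ger0_norm ?subr_ge0 ?(ltW ts) //.
  apply: (@le_lt_trans _ _ (r / (2 * (`|z - x| + 1)) * (`|z - x| + 1))).
    apply: ler_pM => //; [by rewrite subr_ge0 ltW|by rewrite lerBlDl ge_min lexx orbT|by rewrite lerDl].
  by rewrite invfM mulrA mulfVK ?gt_eqF //; lra.
by have := @ub_le_sup _ S hS.2 _ Ss; rewrite -/t leNgt ts.
Qed.

(** A segment leaving [Om] crosses the boundary. [inner_set] measures Euclidean distance and [erode]
    the sup norm, hence the division by [d]. *)
Lemma inner_set_erode Om (delta : R) : (0 < d)%N -> open Om -> 0 < delta ->
  inner_set Om delta `<=` erode Om (delta / d%:R).
Proof.
move=> d0 oO delta0 x [Ox dx] z zx; apply: contrapT => nz.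
have [t /andP [t0 t1] bb] := bdry_cross oO Ox nz.
have : distE x (bdry Om) <= enorm (x - (x + t *: (z - x))).
  apply: ge_inf; first by exists 0 => _ [y _ <-]; exact: sqrtr_ge0.
  by exists (x + t *: (z - x)).
apply/negP; rewrite -ltNge; apply: le_lt_trans dx.
rewrite opprD addrA subrr add0r enormN enorm_scale //.
apply: (@le_trans _ _ (1 * enorm (z - x))); first by rewrite ler_wpM2r // sqrtr_ge0.
rewrite mul1r; apply: le_trans (enorm_le_norm _) _.
by rewrite mulrC -ler_pdivlMr ?ltr0n // ltW.
Qed.

Lemma closure_inner_set Om (delta : R) : (0 < d)%N -> open Om -> 0 < delta ->
  closure (inner_set Om delta) `<=` erode Om (delta / d%:R).
Proof.
move=> d0 oO delta0 x cx; apply: erode_closed => U nU.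
by have [y [iy Uy]] := cx U nU; exists y; split => //; exact: inner_set_erode.
Qed.

Lemma erode_inner_set Om s (delta : R) : bdry Om !=set0 -> open Om -> 0 < delta < s ->
  erode Om s `<=` inner_set Om delta.
Proof.
move=> b0 oO /andP [delta0 ds] x Hx; split; first exact: (erode_sub (lt_trans delta0 ds) Hx).
apply: lt_le_trans ds _; apply: lb_le_inf.
  by have [b bb] := b0; exists (enorm (x - b)), b.
move=> _ [b bb <-]; apply: le_trans (norm_le_enorm _).
rewrite leNgt; apply/negP => h; move: bb; rewrite bdry_open // => -[_]; apply.
by apply: Hx; rewrite distrC.
Qed.

(** The distance is an infimum over the boundary, so the condition becomes an intersection of closed
    conditions on squared distances; the margin [1/(n+1)] accounts for the strict inequality. *)
Lemma inner_set_borel Om (delta : R) : open Om -> bdry Om !=set0 -> 0 < delta ->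
  measurable (inner_set Om delta : set (BorelRd R d)).
Proof.
move=> oO [b0 bb0] delta0.
pose F (n : nat) : set (BorelRd R d) := Om `&`
  \bigcap_(b in bdry Om) [set x | (delta + n.+1%:R^-1) ^+ 2 <= dotp (x - b) (x - b)].
have n0 (n : nat) : 0 < n.+1%:R^-1 :> R by rewrite invr_gt0 ltr0n.
rewrite (_ : inner_set Om delta = \bigcup_n F n).
  apply: bigcupT_measurable => n; apply: measurableI; first exact: open_borel.
  apply: closed_borel; apply: closed_bigI => b _; apply: closed_le_fun.
    exact: cst_continuous.
  exact: dotp_self_continuous.
have lb x : has_lbound [set enorm (x - y) | y in bdry Om].
  by exists 0 => _ [y _ <-]; exact: sqrtr_ge0.
apply/seteqP; split => x.
  move=> [Ox dx]; have [n hn] := ltr_add_invr dx; exists n => //; split => // b bb /=.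
  have h : delta + n.+1%:R^-1 <= enorm (x - b).
    by apply: le_trans (ltW hn) _; apply: ge_inf => //; exists b.
  rewrite -[leRHS]sqr_sqrtr ?dotp_ge0 // lerXn2r ?nnegrE ?sqrtr_ge0 //.
  by rewrite addr_ge0 // ltW.
move=> [n _ [Ox H]]; split => //.
apply: (@lt_le_trans _ _ (delta + n.+1%:R^-1)); first by rewrite ltrDl.
apply: lb_le_inf; first by exists (enorm (x - b0)), b0.
move=> _ [b bb <-]; have := H b bb; rewrite /= => h.
have d'0 : 0 <= delta + n.+1%:R^-1 by rewrite addr_ge0 // ltW.
by rewrite /enorm -(ger0_norm d'0) -sqrtr_sqr ler_sqrt ?dotp_ge0.
Qed.

End Geometry.

(** * Affine barriers *)

Section Barrier.
Context {R : realType} {d : nat}.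
Implicit Types (x y z p q b : 'rV[R]_d) (A K D Om : set 'rV[R]_d) (u v w g : 'rV[R]_d -> R)
  (r s t e eps m M B : R).

Lemma within_continuous_dist A g y eps : {within A, continuous g} -> A y -> 0 < eps ->
  exists2 r, 0 < r & forall x, A x -> `|x - y| < r -> `|g x - g y| < eps.
Proof.
move=> /subspace_continuousP /[apply] h eps0.
have FW : Filter (within A (nbhs y)) by exact: within_filter.
have /nbhs_ballP [r /= r0 Hr] :=
  (@cvgrPdist_lt R R 'rV[R]_d (within A (nbhs y)) FW g (g y)).1 h eps eps0.
by exists r => // x Ax xy; rewrite distrC; apply: Hr => //; rewrite ball_rVE /= distrC.
Qed.

(** A second point [x] of the closure on the supporting hyperplane at [y] would put the whole
    segment between them in the boundary and in the hyperplane, against the parabolic growth near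
    [y]. *)
Lemma parabolic_strict Om tau y : open Om -> convex_setE Om -> 0 <= tau ->
  bdry Om y -> parabolic_support Om tau y ->
  exists nu, forall x, closure Om x -> x != y -> 0 < dotp nu (x - y).
Proof.
move=> oO cO tau0 by_ [nu [rho [eta [nu1 [rho0 [eta0 [supp [_ para]]]]]]]].
exists nu => x cx xy.
have cy : closure Om y by move: by_; rewrite bdry_open // => -[].
have ge0 z : closure Om z -> 0 <= dotp nu (z - y).
  move=> /closureP cz; rewrite leNgt; apply/negP => lt.
  pose c : R := d%:R * `|nu| + 1.
  have c0 : 0 < c by rewrite ltr_wpDl // mulr_ge0.
  have [z' [Oz' zz']] := cz (- dotp nu (z - y) / c) ltac:(by rewrite divr_gt0 // oppr_gt0).
  have := supp z' Oz'; have -> : z' - y = (z' - z) + (z - y) by rewrite addrA subrK.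
  rewrite dotpDr => h.
  have h2 : dotp nu (z' - z) <= c * `|z' - z|.
    apply: le_trans (ler_norm _) _; apply: le_trans (dotp_le _ _) _.
    by rewrite ler_wpM2r // /c lerDl.
  by rewrite ltr_pdivlMr // in zz'; lra.
have gt0 z : Om z -> 0 < dotp nu (z - y).
  move=> Oz; rewrite lt_neqAle ge0 ?andbT; last exact: subset_closure.
  apply/eqP => E; have [r r0 Hr] := (open_ballP Om).1 oO z Oz.
  have n0 : nu != 0 by apply/eqP => n0; move: nu1; rewrite n0 /enorm dotp0r sqrtr0 => /eqP; rewrite eq_sym oner_eq0.
  have nn0 : 0 < `|nu| by rewrite normr_gt0.
  pose z' := z - (r / 2 / `|nu|) *: nu.
  have Oz' : Om z'.
    apply: Hr; rewrite /z' addrC addKr normrN normrZ gtr0_norm ?divr_gt0 //.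
    by rewrite mulfVK ?gt_eqF //; lra.
  have := supp z' Oz'; rewrite /z' addrAC dotpBr -E dotpZr sub0r oppr_ge0 leNgt => /negP; apply.
  rewrite mulr_gt0 ?divr_gt0 //; apply: lt_le_trans (sqr_norm_le_dotp _).
  by rewrite exprn_gt0.
rewrite lt_neqAle ge0 // andbT; apply/eqP => E.
have seg s : 0 <= s <= 1 -> bdry Om (y + s *: (x - y)).
  move=> s01; rewrite bdry_open //; split.
    have -> : y + s *: (x - y) = s *: x + (1 - s) *: y by apply/rowP => i; rewrite !mxE; ring.
    by apply: convex_closure.
  by move=> /gt0; rewrite addrC addKr dotpZr -E mulr0 ltxx.
have xy0 : x - y != 0 by rewrite subr_eq0.
have en0 := enorm_gt0 xy0.
pose s := Num.min 1 (rho / 2 / enorm (x - y)).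
have s0 : 0 < s by rewrite lt_min ltr01 !divr_gt0.
have s1 : s <= 1 by rewrite ge_min lexx.
have bs := seg s ltac:(by rewrite (ltW s0)).
have es : enorm (y + s *: (x - y) - y) < rho.
  rewrite addrC addKr enorm_scale ?(ltW s0) //.
  apply: (@le_lt_trans _ _ (rho / 2 / enorm (x - y) * enorm (x - y))).
    by rewrite ler_wpM2r ?(ltW en0) // ge_min lexx orbT.
  by rewrite mulfVK ?gt_eqF //; lra.
have := para _ bs es; rewrite addrC addKr dotpZr -E mulr0 leNgt => /negP; apply.
rewrite mulr_gt0 // powR_gt0 // /proj_orth dotpZr -E mulr0 scale0r subr0.
by rewrite enorm_scale ?(ltW s0) // mulr_gt0.
Qed.

Definition strictly_supported Om := forall y, bdry Om y ->
  exists nu, forall x, closure Om x -> x != y -> 0 < dotp nu (x - y).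

Lemma strict_gap Om B y nu r : (forall x, Om x -> `|x| <= B) ->
  (forall x, closure Om x -> x != y -> 0 < dotp nu (x - y)) -> 0 < r ->
  exists2 c, 0 < c & forall x, closure Om x -> r <= `|x - y| -> c <= dotp nu (x - y).
Proof.
move=> bB H r0; pose K := closure Om `&` [set x | r <= `|x - y|].
have cn : continuous (fun x : 'rV[R]_d => `|x - y| : R).
  rewrite (_ : (fun x => _) = (fun x : 'rV[R]_d => `|y - x| : R)); first exact: continuous_distl.
  by apply/funext => x; rewrite distrC.
have cK : compact K.
  apply: compact_closedI; first exact: closure_compact bB.
  by apply: closed_le_fun => //; exact: cst_continuous.
have [K0|/set0P K0] := eqVneq K set0.
  exists 1 => // x cx rx; have : K x by split.
  by rewrite K0.
have [x [cx rx] Hx] := compact_min nu K0 cK (continuous_subspaceT (@cst_continuous _ _ (0 : R))).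
have cd : continuous (fun x : 'rV[R]_d => dotp nu x : R) by exact: dotp_continuous.
have [z zK Hz] := EVT_min_rV K0 cK (continuous_subspaceT cd).
rewrite inE in zK; have [cz rz] := zK.
exists (dotp nu (z - y)).
  apply: H => //; apply/eqP => E; move: rz; rewrite /= E subrr normr0; lra.
move=> x' cx' rx'; rewrite !dotpBr lerD2r; apply: Hz; rewrite inE; split => //.
Qed.

(** A large multiple of the strict normal at [y] works: in [k], the term [2 * G / c] covers the
    oscillation of [g] away from [y], and the term with [N] raises the affine function above [N] on
    [K]. Added to [g y] it bounds from above, subtracted from it from below. *)
Lemma barrier Om B g y eps N K : open Om -> (forall x, Om x -> `|x| <= B) ->
  strictly_supported Om -> {within bdry Om, continuous g} -> bdry Om y -> 0 < eps ->
  compact K -> K `<=` Om ->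
  exists q, [/\ (forall x, closure Om x -> 0 <= dotp q (x - y)),
    (forall x, bdry Om x -> `|g x - g y| <= eps + dotp q (x - y)) &
    (forall x, K x -> N <= dotp q (x - y))].
Proof.
move=> oO bB ss cg by_ eps0 cK KO.
have [nu Hnu] := ss y by_.
have cy : closure Om y by move: by_; rewrite bdry_open // => -[].
have nOy : ~ Om y by move: by_; rewrite bdry_open // => -[].
have cb := bdry_compact oO bB.
have b0 : bdry Om !=set0 by exists y.
have [x1 _ H1] := EVT_max_rV b0 cb cg.
have [x2 _ H2] := EVT_min_rV b0 cb cg.
pose G := `|g x1| + `|g x2|.
have G0 : 0 <= G by rewrite addr_ge0.
have gG x : bdry Om x -> `|g x| <= G.
  move=> bx; have h1 := H1 x (mem_set bx); have h2 := H2 x (mem_set bx).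
  rewrite ler_norml /G; have := ler_norm (g x1); have := ler_norm (- g x2).
  rewrite normrN => h3 h4; have := normr_ge0 (g x1); have := normr_ge0 (g x2) => h5 h6.
  by apply/andP; split; lra.
have [r r0 Hr] : exists2 r, 0 < r & forall x, bdry Om x -> `|x - y| < r -> `|g x - g y| < eps.
  exact: within_continuous_dist.
have [c c0 Hc] := strict_gap bB Hnu r0.
have [r' r'0 Kr] := compact_erode cK oO KO.
have [c' c'0 Hc'] := strict_gap bB Hnu r'0.
pose k := 2 * G / c + `|N| / c'.
have k0 : 0 <= k by rewrite addr_ge0 // divr_ge0 ?(ltW c0) ?(ltW c'0) // mulr_ge0.
have ge0 x : closure Om x -> 0 <= dotp nu (x - y).
  move=> cx; have [->|xy] := eqVneq x y; first by rewrite subrr dotp0r.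
  exact: ltW (Hnu x cx xy).
exists (k *: nu); split.
- by move=> x cx; rewrite dotpZl mulr_ge0 // ge0.
- move=> x bx; have cx : closure Om x by move: bx; rewrite bdry_open // => -[].
  have [xy|xy] := ltP `|x - y| r.
    apply: le_trans (ltW (Hr x bx xy)) _; rewrite lerDl dotpZl mulr_ge0 // ge0 //.
  apply: le_trans (ler_normB _ _) _.
  have h1 : 2 * G / c * c <= k * dotp nu (x - y).
    apply: ler_pM => //; [by rewrite divr_ge0 ?(ltW c0) // mulr_ge0|exact: ltW| |exact: Hc].
    by rewrite /k lerDl divr_ge0 // ltW.
  rewrite mulfVK ?gt_eqF // in h1.
  by rewrite dotpZl; have := gG x bx; have := gG y by_; lra.
- move=> x Kx; have Ox := KO x Kx; rewrite dotpZl.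
  apply: le_trans (ler_norm _) _.
  have rx : r' <= `|x - y|.
    by rewrite leNgt; apply/negP => h; apply: nOy; apply: (Kr x Kx); rewrite distrC.
  have h1 : `|N| / c' * c' <= k * dotp nu (x - y).
    apply: ler_pM => //; [by rewrite divr_ge0 // ltW|exact: ltW| |apply: Hc' => //; exact: subset_closure].
    by rewrite /k lerDr divr_ge0 ?(ltW c0) // mulr_ge0.
  by rewrite mulfVK ?gt_eqF // in h1.
Qed.

Lemma exit_point Om B x p : (0 < d)%N -> open Om -> (forall x, Om x -> `|x| <= B) -> Om x ->
  p != 0 -> exists2 t, 0 < t & bdry Om (x + t *: p).
Proof.
move=> d0 oO bB Ox p0; have np : 0 < `|p| by rewrite normr_gt0.
pose T := (2 * `|B| + 1) / `|p|.
have T0 : 0 < T by rewrite divr_gt0 // ltr_wpDl // mulr_ge0.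
pose z := x + T *: p.
have nz : ~ Om z.
  move=> /bB h; have h1 := bB x Ox; have h2 := ler_norm B.
  have : `|z - x| = 2 * `|B| + 1.
    by rewrite /z addrC addKr normrZ gtr0_norm // mulfVK ?gt_eqF.
  by have := ler_normB z x; lra.
have [t /andP [t0 t1] bb] := bdry_cross oO Ox nz.
have zx : z - x = T *: p by rewrite /z addrC addKr.
rewrite zx scalerA in bb; exists (t * T) => //.
rewrite lt_neqAle mulr_ge0 ?(ltW T0) // andbT; apply/eqP => E.
by move: bb; rewrite -E scale0r addr0 bdry_open // => -[].
Qed.

Lemma weak_bc_near Om v g b x eps : open Om -> convex_setE Om -> weak_bc Om g v ->
  bdry Om b -> Om x -> 0 < eps ->
  exists2 a0, 0 < a0 <= 1 & forall a, 0 < a < a0 ->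
    Om (a *: x + (1 - a) *: b) /\ v (a *: x + (1 - a) *: b) <= g b + eps.
Proof.
move=> oO cO wb bb Ox eps0; have [eta [eta0 Heta]] := wb b bb eps eps0.
have cb : closure Om b by move: bb; rewrite bdry_open // => -[].
have k0 : 0 < d%:R * `|x - b| + 1 by rewrite ltr_wpDl // mulr_ge0.
exists (Num.min 1 (eta / (d%:R * `|x - b| + 1))).
  by rewrite lt_min ltr01 divr_gt0 //= ge_min lexx.
move=> a /andP [a0]; rewrite lt_min => /andP [a1 a2].
have Oa : Om (a *: x + (1 - a) *: b).
  by apply: open_closure_segment => //; rewrite a0 ltW.
split => //; apply: Heta => //.
have -> : a *: x + (1 - a) *: b - b = a *: (x - b) by apply/rowP => i; rewrite !mxE; ring.
rewrite enorm_scale ?(ltW a0) //; rewrite ltr_pdivlMr // in a2.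
apply: le_lt_trans a2; rewrite ler_wpM2l ?(ltW a0) //.
by apply: le_trans (enorm_le_norm _) _; rewrite lerDl.
Qed.

(* Convexity along a chord through [x] between two boundary points. *)
Lemma weak_bc_le Om B v g c q : (0 < d)%N -> open Om -> convex_setE Om ->
  (forall x, Om x -> `|x| <= B) -> convex_fun_on Om v -> weak_bc Om g v ->
  (forall x, bdry Om x -> g x <= c + dotp q x) -> forall x, Om x -> v x <= c + dotp q x.
Proof.
move=> d0 oO cO bB cv wb gl x Ox; pose e1 : 'rV[R]_d := delta_mx 0 (Ordinal d0).
have e10 : e1 != 0.
  apply/eqP => /(congr1 (fun M : 'rV[R]_d => M 0 (Ordinal d0))); rewrite !mxE !eqxx /=.
  by move/eqP; rewrite oner_eq0.
have ne10 : - e1 != 0 by rewrite oppr_eq0.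
have [t1 t10] := exit_point d0 oO bB Ox e10; set b1 := x + t1 *: e1 => bb1.
have [t2 t20] := exit_point d0 oO bB Ox ne10; set b2 := x + t2 *: - e1 => bb2.
apply/ler_addgt0Pr => eps eps0; have e2 : 0 < eps / 2 by lra.
have [a1 /andP [a10 a11] H1] := weak_bc_near oO cO wb bb1 Ox e2.
have [a2 /andP [a20 a21] H2] := weak_bc_near oO cO wb bb2 Ox e2.
pose k := Num.max `|c + dotp q b1 - (c + dotp q x)| `|c + dotp q b2 - (c + dotp q x)| + 1.
have k0 : 0 < k by rewrite ltr_wpDl // le_max normr_ge0.
pose a := Num.min (Num.min a1 a2) (eps / 2 / k) / 2.
have m0 : 0 < Num.min (Num.min a1 a2) (eps / 2 / k) by rewrite !lt_min a10 a20 divr_gt0.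
have a0 : 0 < a by rewrite divr_gt0.
have am : a < Num.min (Num.min a1 a2) (eps / 2 / k) by rewrite /a; lra.
move: am; rewrite !lt_min => /andP [/andP [aa1 aa2] aa3].
rewrite ltr_pdivlMr // in aa3.
have [Oy1 v1] := H1 a ltac:(by rewrite a0).
have [Oy2 v2] := H2 a ltac:(by rewrite a0).
set y1 := a *: x + (1 - a) *: b1 in Oy1 v1; set y2 := a *: x + (1 - a) *: b2 in Oy2 v2.
pose l := t2 / (t1 + t2).
have l01 : 0 <= l <= 1.
  by rewrite divr_ge0 ?addr_ge0 ?(ltW t10) ?(ltW t20) //= ler_pdivrMr ?addr_gt0 // mul1r lerDr ltW.
have xE : l *: y1 + (1 - l) *: y2 = x.
  rewrite /y1 /y2 /b1 /b2 /l; apply/rowP => i; rewrite !mxE; field.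
  by rewrite gt_eqF // addr_gt0.
have := cv y1 y2 Oy1 Oy2 l l01; rewrite xE => h.
have lin b : a *: x + (1 - a) *: b = b + a *: (x - b) by apply/rowP => i; rewrite !mxE; ring.
have near b : `|c + dotp q b - (c + dotp q x)| <= k - 1 -> 
    c + dotp q b <= c + dotp q (a *: x + (1 - a) *: b) + eps / 2.
  move=> hk; rewrite lin dotpDr dotpZr dotpBr.
  have h1 : a * (dotp q b - dotp q x) <= a * k.
    rewrite ler_wpM2l ?(ltW a0) //; apply: le_trans (ler_norm _) _.
    have -> : dotp q b - dotp q x = c + dotp q b - (c + dotp q x) by ring.
    by lra.
  lra.
have n1 := near b1 ltac:(by rewrite /k addrK le_max lexx).
have n2 := near b2 ltac:(by rewrite /k addrK le_max lexx orbT).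
have g1 := gl b1 bb1; have g2 := gl b2 bb2.
have /andP [l0 l1] := l01.
have i1 : l * v y1 <= l * (c + dotp q y1 + eps) by rewrite ler_wpM2l //; lra.
have i2 : (1 - l) * v y2 <= (1 - l) * (c + dotp q y2 + eps) by rewrite ler_wpM2l //; lra.
have E : dotp q x = l * dotp q y1 + (1 - l) * dotp q y2 by rewrite -!dotpZr -dotpDr xE.
rewrite E; lra.
Qed.

(** The lower bound at [y] comes from a point [z] of [Om] opposite to [y] with respect to a fixed
    [x0], and convexity at [x0]. *)
Lemma bcf_of_bounded_above Om B v M : open Om -> convex_setE Om ->
  (forall x, Om x -> `|x| <= B) -> convex_fun_on Om v -> (forall x, Om x -> v x <= M) -> bcf Om v.
Proof.
move=> oO cO bB cv vM; split => //; first by exists B.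
have [[x0 Ox0]|nO] := pselect (Om !=set0); last by exists 0, 0 => x Ox; case: nO; exists x.
have [r r0 Hr] := (open_ballP Om).1 oO x0 Ox0.
pose s := r / (2 * `|B| + 1) / 2.
have k0 : 0 < 2 * `|B| + 1 by rewrite ltr_wpDl // mulr_ge0.
have s0 : 0 < s by rewrite !divr_gt0.
exists (((1 + s) * v x0 - M) / s), M => y Oy; rewrite vM // andbT.
pose z := x0 - s *: (y - x0).
have yx : `|y - x0| <= 2 * `|B|.
  apply: le_trans (ler_normB _ _) _; have := bB y Oy; have := bB x0 Ox0; have := ler_norm B; lra.
have Oz : Om z.
  apply: Hr; rewrite /z addrC addKr normrN normrZ gtr0_norm //.
  apply: (@le_lt_trans _ _ (s * (2 * `|B| + 1))); first by rewrite ler_wpM2l ?(ltW s0) //; lra.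
  by rewrite /s mulrAC mulfVK ?gt_eqF //; lra.
have s10 : 0 < 1 + s by rewrite addr_gt0.
have xE : x0 = (s / (1 + s)) *: y + (1 - s / (1 + s)) *: z.
  by rewrite /z; apply/rowP => i; rewrite !mxE; field; rewrite gt_eqF.
have h01 : 0 <= s / (1 + s) <= 1.
  by rewrite divr_ge0 ?(ltW s0) ?(ltW s10) //= ler_pdivrMr // mul1r lerDr.
have := cv y z Oy Oz _ h01; rewrite -xE => h.
have h2 : (1 + s) * v x0 <= s * v y + v z.
  rewrite -ler_pdivlMl //; apply: le_trans h _; rewrite le_eqVlt; apply/orP; left; apply/eqP.
  by field; rewrite gt_eqF.
by rewrite ler_pdivrMr // mulrC; have := vM z Oz; lra.
Qed.

Lemma comparison_boundary Om u v t : bcf Om u -> bcf Om v ->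
  (forall y, bdry Om y -> exists2 r, 0 < r & forall x, Om x -> `|x - y| < r -> v x - u x < t) ->
  exists K, [/\ compact K, K `<=` Om & forall x, Om x -> ~ K x -> v x - u x <= t].
Proof.
move=> bu bv H; have [oO cO [B bB] _ _] := bu.
exists [set x | Om x /\ t <= v x - u x]; split; last first.
- by move=> x Ox nK; rewrite leNgt; apply/negP => h; apply: nK; split => //; exact: ltW.
- by move=> x [].
apply: (@bounded_compact _ _ _ B); last by move=> x [/bB].
apply: closed_seqP => x Hx.
have cx : closure Om x by apply/closureP => e e0; have [y [[Oy _] yx]] := Hx e e0; exists y.
have Ox : Om x.
  apply: contrapT => nO; have bx : bdry Om x by rewrite bdry_open.
  have [r r0 Hr] := H x bx; have [y [[Oy ty] yx]] := Hx r r0.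
  by have := Hr y Oy yx; rewrite ltNge ty.
split => //; apply/ler_addgt0Pr => e e0.
have e2 : 0 < e / 2 by lra.
have [r1 r10 H1] := bcf_cont bu Ox e2; have [r2 r20 H2] := bcf_cont bv Ox e2.
have [y [[_ /= My] yx]] := Hx (Num.min r1 r2) ltac:(by rewrite lt_min r10).
move: yx; rewrite lt_min => /andP [/H1 [_ h1] /H2 [_ h2]].
by move: h1 h2; rewrite !ltr_norml => /andP [? ?] /andP [? ?]; lra.
Qed.

End Barrier.

(** * Finitely many point masses *)

Section Contact.
Context {R : realType} {d : nat}.
Implicit Types (x y z p q b : 'rV[R]_d) (A K D Om : set 'rV[R]_d) (u v w g : 'rV[R]_d -> R)
  (r s t e eps m M B : R).

(** By convexity [u] stays below the supporting plane on the segment from [x] to [b], hence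
    coincides with it, and the midpoint is a second contact point. The limit hypothesis replaces a
    value at [b], which may lie on the boundary. *)
Lemma contact_nonuniq D u x b p : bcf D u -> D x -> closure D b -> x != b ->
  subdiff D u x p ->
  (forall eps, 0 < eps -> exists2 r, 0 < r & forall y, D y -> `|y - b| < r ->
     u y <= u x + dotp p (y - x) + eps) ->
  nonuniq D u p.
Proof.
move=> bu Dx Db xb px Hb; have [oD cD [B bB] cu _] := bu.
pose y : 'rV[R]_d := (1 / 2) *: x + (1 - 1 / 2) *: b.
have Dy : D y by apply: open_closure_segment => //; lra.
have yx : y - x = (1 / 2) *: (b - x).
  rewrite /y scalerBr scalerBl scale1r; apply/rowP => i; rewrite !mxE; lra.
have xy : x != y.
  rewrite eq_sym -subr_eq0 yx scaler_eq0 negb_or subr_eq0 (eq_sym b) xb andbT; apply/eqP; lra.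
exists x, y; split => //.
suff uy : u y <= u x + dotp p (y - x).
  by move=> z Dz; have := px z Dz; rewrite !dotpBr in uy *; lra.
apply/ler_addgt0Pr => eps eps0; have e2 : 0 < eps / 2 by lra.
have [r r0 Hr] := Hb _ e2.
have nb : 0 < `|b - x| by rewrite normr_gt0 subr_eq0 eq_sym.
pose a := Num.min (1 / 2) (r / (2 * `|b - x|)).
have a0 : 0 < a by rewrite lt_min; apply/andP; split; [lra|rewrite divr_gt0 ?mulr_gt0 //; lra].
have a1 : a <= 1 / 2 by rewrite ge_min lexx.
pose y' : 'rV[R]_d := a *: x + (1 - a) *: b.
have Dy' : D y' by apply: open_closure_segment => //; lra.
have y'b : `|y' - b| < r.
  rewrite (_ : y' - b = a *: (x - b)); last by
    apply/rowP => i; rewrite !mxE; ring.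
  rewrite normrZ gtr0_norm // distrC; apply: le_lt_trans (_ : r / (2 * `|b - x|) * `|b - x| < _).
    by rewrite ler_pM2r // ge_min lexx orbT.
  rewrite invfM mulrA mulfVK ?gt_eqF //; lra.
have h1 := Hr _ Dy' y'b.
pose k := (1 / 2) / (1 - a).
have k01 : 0 <= k <= 1.
  rewrite /k divr_ge0 /=; [|lra|lra]. rewrite ler_pdivrMr; lra.
have ky : y = k *: y' + (1 - k) *: x.
  have k1 : k * (1 - a) = 1 / 2 by rewrite /k mulfVK // subr_eq0; apply/eqP; lra.
  apply/rowP => i; rewrite !mxE.
  transitivity ((k * a + 1 - k) * x 0 i + (k * (1 - a)) * b 0 i); last by ring.
  rewrite k1 (_ : k * a + 1 - k = 1 - k * (1 - a)); last by ring.
  rewrite k1; lra.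
have := cu _ _ Dy' Dx k k01; rewrite -ky => h2.
have /andP [k0 k1] := k01.
have h3 : k * u y' <= k * (u x + dotp p (y' - x) + eps / 2) by rewrite ler_wpM2l.
have ek : k * (eps / 2) <= eps / 2 by rewrite ler_piMl // ltW.
have yy : y - x = k *: (y' - x) by rewrite {1}ky; clearbody y'; apply/rowP => i; rewrite !mxE; ring.
rewrite yy dotpZr; lra.
Qed.

(** Follow the direction of increase to the boundary; when [p = 0] any direction does. *)
Lemma affine_exit Om B x p : (0 < d)%N -> open Om -> (forall x, Om x -> `|x| <= B) -> Om x ->
  exists2 b, bdry Om b & dotp p x <= dotp p b.
Proof.
move=> d0 oO bO Ox; have [->|p0] := eqVneq p 0.
  have n1 : (const_mx 1 : 'rV[R]_d) != 0.
    apply/negP => /eqP /rowP /(_ (Ordinal d0)); rewrite !mxE => h; lra.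
  have [t t0 bt] := exit_point d0 oO bO Ox n1; exists (x + t *: const_mx 1) => //.
  by rewrite !dotp0l.
have [t t0 bt] := exit_point d0 oO bO Ox p0; exists (x + t *: p) => //.
by rewrite dotpDr dotpZr lerDl mulr_ge0 // ?dotp_ge0 // ltW.
Qed.

Lemma point_closed x : closed [set x].
Proof.
apply: closed_seqP => y Hy /=; apply/eqP; rewrite -subr_eq0 -normr_le0.
by apply/ler_addgt0Pr => e e0; have [z [-> yz]] := Hy e e0; rewrite add0r distrC ltW.
Qed.

Lemma finite_gap n (f : 'I_n -> R) : (forall i, 0 < f i) ->
  exists2 c, 0 < c & forall i, c <= f i.
Proof.
elim: n f => [|n IH] f f0; first by exists 1 => // -[].
have [c c0 Hc] := IH (fun i => f (lift ord0 i)) (fun i => f0 _).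
exists (Num.min (f ord0) c); first by rewrite lt_min f0.
by move=> i; have [j ->|->] := unliftP ord0 i; rewrite ge_min ?Hc ?orbT // lexx.
Qed.

End Contact.

Section Atoms.
Context {R : realType} {d : nat} (Rf : 'rV[R]_d -> R)
  (rho : {measure set (BorelRd R d) -> \bar R}) (Hrho : is_density Rf rho).
Implicit Types (x p : 'rV[R]_d) (D : set 'rV[R]_d) (u : 'rV[R]_d -> R).
Local Notation W D u e := (wint (subdiff_img D u e) Rf).

(** Off the nodes only slopes of [nonuniq] occur, a null set, so the measure is the sum of its
    atoms. *)
Lemma W_atoms D u n (a : 'I_n -> 'rV[R]_d) (E : set 'rV[R]_d) : bcf D u -> injective a ->
  (forall i, D (a i)) ->
  (forall x p, D x -> subdiff D u x p -> ~ nonuniq D u p -> exists i, x = a i) ->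
  measurable (E : set (BorelRd R d)) -> E `<=` D ->
  (W D u E = \sum_(i < n | `[< E (a i) >]) wint (subdiff D u (a i)) Rf)%E.
Proof.
move=> bu inja Da atoms me ED; have [_ _ _ ln] := Hrho.
have [N [mN N0 sN]] := nonuniq_negligible ln bu.
have [nu [_ [_ _ _ Hnu _]]] := MA_measure Hrho bu.
have eE : E `&` D = E by apply/setIidPl.
rewrite -{1}eE -Hnu //.
pose F (i : 'I_n) : set (BorelRd R d) := [set a i].
have mF i : measurable (F i) by apply: closed_borel; exact: point_closed.
have tF : trivIset (fun i : 'I_n => `[< E (a i) >]) F.
  by move=> i j _ _ [x [/= -> /inja]].
have nuA i : nu (F i) = wint (subdiff D u (a i)) Rf.
  rewrite Hnu // (_ : F i `&` D = F i); last by apply/setIidPl => x ->; exact: Da.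
  by rewrite /subdiff_img /F bigcup_set1.
rewrite -(eq_bigr _ (fun i _ => nuA i)) -measure_bigsetU_ord_cond //.
set Fe := \big[setU/set0]_(i < n | `[< E (a i) >]) F i.
have mFe : measurable Fe by apply: bigsetU_measurable.
have Fee : Fe `<=` E.
  rewrite /Fe -bigcup_seq_cond => x [i] /= /andP [_ /asboolP h] -> //.
have h0 : nu (E `\` Fe) = 0%E.
  apply/le_anti/andP; split; last exact: measure_ge0.
  rewrite -N0 Hnu; last exact: measurableD.
  have eFD : (E `\` Fe) `&` D = E `\` Fe by apply/setIidPl => x [/ED].
  rewrite eFD; apply: (W_le_rho Hrho) => //; first exact: measurableD.
    by move=> x [/ED].
  move=> p [x [ex nF] px]; apply: sN; apply: contrapT => nn; apply: nF.
  have [j xA] := atoms _ _ (ED _ ex) px nn.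
  rewrite /Fe -bigcup_seq_cond; exists j; last exact: xA.
  by rewrite /= mem_index_enum; apply/asboolP; rewrite -xA.
rewrite -[LHS](_ : (nu (Fe `|` (E `\` Fe)) = _)%E); last by rewrite setDUK.
have mD : measurable (E `\` Fe : set (BorelRd R d)) by exact: measurableD.
have dis : Fe `&` (E `\` Fe) = set0 by apply/seteqP; split => // x [h1 [_]].
apply: etrans (measureU nu mFe mD dis) _.
by rewrite [X in (_ + X)%E](_ : _ = 0%E) ?adde0.
Qed.

End Atoms.

(** * Envelopes of nodal heights and boundary data *)

Section Envelope.
Context {R : realType} {d : nat} (Om : set 'rV[R]_d) (B gm gM : R) (g : 'rV[R]_d -> R)
  (d0 : (0 < d)%N) (oO : open Om) (cO : convex_setE Om) (bO : forall x, Om x -> `|x| <= B)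
  (O0 : Om !=set0) (ssO : strictly_supported Om) (cg : {within bdry Om, continuous g})
  (bg : forall x, bdry Om x -> gm <= g x <= gM)
  (n : nat) (A : 'I_n -> 'rV[R]_d) (OA : forall i, Om (A i)).
Implicit Types (x y p q b : 'rV[R]_d) (z : 'rV[R]_n) (c r s t e eps m M : R).

Definition minorant z c p := (forall j, c + dotp p (A j) <= z 0 j) /\
  (forall x, bdry Om x -> c + dotp p x <= g x).

(** In effect the convex envelope of the nodal heights and of [g]. As a supremum of affine minorants
    it is convex at once, and its supporting planes are again minorants ([subdiff_minorant]). *)
Definition envelope z x : R := sup [set t | exists c p, minorant z c p /\ t = c + dotp p x].

Let bdry0 : bdry Om !=set0.
Proof. by have [x Ox] := O0; have [b bb _] := affine_exit 0 d0 oO bO Ox; exists b. Qed.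

Lemma affine_le_bdry c p c' p' x :
  (forall x, bdry Om x -> c + dotp p x <= c' + dotp p' x) -> Om x ->
  c + dotp p x <= c' + dotp p' x.
Proof.
move=> H Ox; have [b bb] := affine_exit (p - p') d0 oO bO Ox.
by rewrite !dotpBl => h; have := H b bb; lra.
Qed.

Lemma minorant_const z c : (forall j, c <= z 0 j) -> c <= gm -> minorant z c 0.
Proof.
move=> cz cg'; split => [j|x bx]; rewrite dotp0l addr0 //.
by have /andP [h _] := bg bx; exact: le_trans h.
Qed.

Lemma minorant_exists z : exists c, minorant z c 0.
Proof.
exists (- `|z| - `|gm|); apply: minorant_const.
  move=> j; have := rV_coord_le z j; rewrite ler_norml => /andP [h _].
  by have := normr_ge0 gm; lra.
by have := normr_ge0 z; have := ler_norm (- gm); rewrite normrN; lra.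
Qed.

Lemma envelope_ub z x c' q : (forall y, bdry Om y -> g y <= c' + dotp q y) -> Om x ->
  ubound [set t | exists c p, minorant z c p /\ t = c + dotp p x] (c' + dotp q x).
Proof.
move=> H Ox t [c [p [[_ mp] ->]]]; apply: affine_le_bdry Ox => y by'.
exact: le_trans (mp _ by') (H _ by').
Qed.

Lemma envelope_upper z x c q : (forall y, bdry Om y -> g y <= c + dotp q y) -> Om x ->
  envelope z x <= c + dotp q x.
Proof.
move=> H Ox; apply: ge_sup; last exact: envelope_ub.
by have [c0 m0] := minorant_exists z; exists (c0 + dotp 0 x), c0, 0.
Qed.

Lemma envelope_le_gM z x : Om x -> envelope z x <= gM.
Proof.
move=> Ox; rewrite -(addr0 gM) -(dotp0l x); apply: envelope_upper => // y by'.
by rewrite dotp0l addr0; have /andP [] := bg by'.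
Qed.

Lemma minorant_le z c p x : minorant z c p -> Om x -> c + dotp p x <= envelope z x.
Proof.
move=> mp Ox; apply: ub_le_sup; last by exists c, p.
exists (gM + dotp 0 x); apply: envelope_ub => // y by'.
by rewrite dotp0l addr0; have /andP [] := bg by'.
Qed.

Lemma envelope_le z x M : (forall c p, minorant z c p -> c + dotp p x <= M) -> envelope z x <= M.
Proof.
move=> H; apply: ge_sup; last by move=> t [c [p [mp ->]]]; exact: H.
by have [c0 m0] := minorant_exists z; exists (c0 + dotp 0 x), c0, 0.
Qed.

Lemma envelope_ge z x c : (forall j, c <= z 0 j) -> c <= gm -> Om x -> c <= envelope z x.
Proof.
move=> cz cg' Ox; have := minorant_le (minorant_const cz cg') Ox.
by rewrite dotp0l addr0.
Qed.

Lemma envelope_node z j : envelope z (A j) <= z 0 j.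
Proof. by apply: envelope_le => c p [/(_ j)]. Qed.

Lemma envelope_bcf z : bcf Om (envelope z).
Proof.
split => //; first by exists B.
  move=> x y Ox Oy t t01; have /andP [t0 t1] := t01.
  apply: envelope_le => c p mp; rewrite dotpDr !dotpZr.
  have h1 := minorant_le mp Ox; have h2 := minorant_le mp Oy.
  have i1 : t * (c + dotp p x) <= t * envelope z x by rewrite ler_wpM2l.
  have i2 : (1 - t) * (c + dotp p y) <= (1 - t) * envelope z y by rewrite ler_wpM2l // subr_ge0.
  lra.
have [c mc] := minorant_exists z; exists c, gM => x Ox; rewrite envelope_le_gM // andbT.
by have := minorant_le mc Ox; rewrite dotp0l addr0.
Qed.

Lemma envelope_bdry z b eps : bdry Om b -> 0 < eps ->
  exists2 r, 0 < r & forall x, Om x -> `|x - b| < r -> envelope z x <= g b + eps.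
Proof.
move=> bb eps0; have e2 : 0 < eps / 2 by lra.
have [q [q0 qb _]] := barrier 0 oO bO ssO cg bb e2 compact0 (@sub0set _ Om).
have [rp rp0 Hrp] := dotp_near q e2.
exists rp => // x Ox xb.
have h : forall y, bdry Om y -> g y <= (g b + eps / 2 - dotp q b) + dotp q y.
  by move=> y by'; have := qb _ by'; rewrite dotpBr ler_norml => /andP [_ h]; lra.
have := envelope_upper z h Ox => h1.
have := Hrp _ _ xb; rewrite ler_norml => /andP [_ h2].
lra.
Qed.

Lemma subdiff_minorant z x p : Om x -> subdiff Om (envelope z) x p ->
  minorant z (envelope z x - dotp p x) p.
Proof.
move=> Ox px; split => [j|b bb].
  by have := px _ (OA j); have := envelope_node z j; rewrite dotpBr; lra.
apply/ler_addgt0Pr => eps eps0; have e2 : 0 < eps / 2 by lra.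
have [r r0 Hr] := envelope_bdry z bb e2.
have [rp rp0 Hrp] := dotp_near p e2.
have [cb _] := bb.
have m0 : 0 < Num.min r rp by rewrite lt_min r0.
have [y [Oy]] := (closureP _ _).1 cb _ m0; rewrite lt_min => /andP [yr ye].
have := Hr _ Oy yr => h1; have := px _ Oy; rewrite dotpBr => h2.
have := Hrp _ _ ye; rewrite ler_norml => /andP [h3 _].
lra.
Qed.

(** Finitely many nodes and a compact boundary leave a uniform gap when contact is excluded
    pointwise; [J] exempts the nodes where contact is allowed. *)
Lemma minorant_gap z c p (J : pred 'I_n) : minorant z c p ->
  (forall j, ~~ J j -> c + dotp p (A j) != z 0 j) ->
  (forall b, bdry Om b -> c + dotp p b != g b) ->
  exists2 e, 0 < e & (forall j, ~~ J j -> c + e + dotp p (A j) <= z 0 j) /\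
    (forall x, bdry Om x -> c + e + dotp p x <= g x).
Proof.
move=> [m1 m2] n1 n2.
have [e1 e10 H1] : exists2 e, 0 < e & forall j, e <= (if J j then 1 else z 0 j - (c + dotp p (A j))).
  apply: finite_gap => j; case: ifPn => // /n1 h; rewrite subr_gt0 lt_neqAle h /=; exact: m1.
have [b bb Hb] := compact_min p bdry0 (bdry_compact oO bO) cg.
have gb : 0 < g b - (c + dotp p b) by rewrite subr_gt0 lt_neqAle n2 //= m2.
exists (Num.min e1 (g b - (c + dotp p b))); first by rewrite lt_min e10.
split => [j /negPf Jj|x bx].
  have := H1 j; rewrite Jj => h; have : Num.min e1 (g b - (c + dotp p b)) <= e1 by rewrite ge_min lexx.
  lra.
have h := Hb x bx.
have : Num.min e1 (g b - (c + dotp p b)) <= g b - (c + dotp p b) by rewrite ge_min lexx orbT.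
lra.
Qed.

(** Otherwise the supporting plane could be raised by the gap and remain a minorant, exceeding the
    envelope at [x]. *)
Lemma subdiff_touches z x p : Om x -> subdiff Om (envelope z) x p ->
  let c := envelope z x - dotp p x in
  (exists j, c + dotp p (A j) = z 0 j) \/ (exists2 b, bdry Om b & c + dotp p b = g b).
Proof.
move=> Ox px c; have mc := subdiff_minorant Ox px.
have [//|/not_orP [n1 n2]] := pselect ((exists j, c + dotp p (A j) = z 0 j) \/
  (exists2 b, bdry Om b & c + dotp p b = g b)).
have [e e0 [h1 h2]] : exists2 e, 0 < e & (forall j, ~~ pred0 j -> c + e + dotp p (A j) <= z 0 j) /\
    (forall x, bdry Om x -> c + e + dotp p x <= g x).
  apply: (minorant_gap (J := pred0)) => //.
    by move=> j _; apply/eqP => h; apply: n1; exists j.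
  by move=> b bb; apply/eqP => h; apply: n2; exists b.
have me : minorant z (c + e) p by split => // j; exact: h1.
by have := minorant_le me Ox; rewrite /c; lra.
Qed.

Lemma bdry_contact_nonuniq z x b p : Om x -> bdry Om b -> subdiff Om (envelope z) x p ->
  envelope z x - dotp p x + dotp p b = g b -> nonuniq Om (envelope z) p.
Proof.
move=> Ox bb px hb; have bb' : ~ Om b by move: bb; rewrite bdry_open // => -[].
have xb : x != b by apply/eqP => h; apply: bb'; rewrite -h.
apply: (contact_nonuniq (envelope_bcf z) Ox _ xb px) => [|eps eps0]; first by case: bb.
have e2 : 0 < eps / 2 by lra.
have [r r0 Hr] := envelope_bdry z bb e2.
have [rp rp0 Hrp] := dotp_near p e2.
exists (Num.min r rp); first by rewrite lt_min r0.
move=> y Oy; rewrite lt_min => /andP [yr ye]; have := Hr _ Oy yr => h1.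
have := Hrp _ _ ye; rewrite ler_norml => /andP [h3 _].
rewrite dotpBr; lra.
Qed.

(** A Laguerre-type cell: by [cell_subdiff] and [subdiff_cell] it is the subdifferential of the
    envelope at [A i] up to a null set. It is empty when the height exceeds the envelope there. *)
Definition cell z i : set 'rV[R]_d := [set p | minorant z (z 0 i - dotp p (A i)) p].

Lemma cell_subdiff z i p : cell z i p -> envelope z (A i) = z 0 i /\ subdiff Om (envelope z) (A i) p.
Proof.
move=> Cp; have h : envelope z (A i) = z 0 i.
  by apply/le_anti; rewrite envelope_node /=; have := minorant_le Cp (OA i); lra.
split => // y Oy; have := minorant_le Cp Oy; rewrite h dotpBr; lra.
Qed.

Lemma subdiff_cell z x p : Om x -> subdiff Om (envelope z) x p -> ~ nonuniq Om (envelope z) p ->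
  exists2 i, x = A i & cell z i p.
Proof.
move=> Ox px np; have [[j hj]|[b bb hb]] := subdiff_touches Ox px; last first.
  by exfalso; apply: np; exact: bdry_contact_nonuniq hb.
have Cj : cell z j p.
  by rewrite /cell /= -hj addrK; exact: subdiff_minorant.
exists j => //; apply/eqP/negPn/negP => xj; apply: np.
by exists x, (A j); split => //; case: (cell_subdiff Cj).
Qed.

(** Cells with slack [e] in all other constraints. They survive a perturbation of the heights by
    [e / 2], and as [e] tends to 0 they exhaust the cell up to a null set; this makes the measure of
    a cell lower semicontinuous in [z]. *)
Definition shrunk z i e : set 'rV[R]_d :=
  [set p | (forall j, j != i -> z 0 i - dotp p (A i) + e + dotp p (A j) <= z 0 j) /\
    (forall x, bdry Om x -> z 0 i - dotp p (A i) + e + dotp p x <= g x)].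

Lemma shrunk0 z i : shrunk z i 0 = cell z i.
Proof.
apply/seteqP; split => p [h1 h2]; split => [j|x bx].
- by have [->|ji] := eqVneq j i; [rewrite subrK|have := h1 _ ji; rewrite addr0].
- by have := h2 _ bx; rewrite addr0.
- by move=> _; rewrite addr0.
- by rewrite addr0; exact: h2.
Qed.

Lemma shrunk_closed z i e : closed (shrunk z i e).
Proof.
have Hc c x : closed [set p : 'rV[R]_d | z 0 i - dotp p (A i) + e + dotp p x <= c].
  rewrite (_ : [set p | _] = [set p : 'rV[R]_d | dotp (x - A i) p <= c - z 0 i - e]).
    by apply: closed_le_fun; [exact: dotp_continuous|exact: cst_continuous].
  by apply/seteqP; split => p /=; rewrite dotpBl !(dotpC p); lra.
rewrite (_ : shrunk z i e = (\bigcap_(j in [set j | j != i])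
    [set p : 'rV[R]_d | z 0 i - dotp p (A i) + e + dotp p (A j) <= z 0 j]) `&`
    (\bigcap_(x in bdry Om) [set p : 'rV[R]_d | z 0 i - dotp p (A i) + e + dotp p x <= g x])).
  by apply: closedI; apply: closed_bigI => *; apply: Hc.
by apply/seteqP; split => p [h1 h2]; split => *; (exact: h1 || exact: h2).
Qed.

Lemma shrunk_near z z' i e : `|z' - z| <= e / 2 -> shrunk z i e `<=` cell z' i.
Proof.
move=> zz p [h1 h2].
have hz j : `|z' 0 j - z 0 j| <= e / 2.
  by have := rV_coord_le (z' - z) j; rewrite !mxE => h; exact: le_trans zz.
have := hz i; rewrite ler_norml => /andP [_ hi].
split => [j|x bx]; last by have := h2 _ bx; have := normr_ge0 (z' - z); lra.
have [->|ji] := eqVneq j i; first by rewrite subrK.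
by have := h1 _ ji; have := hz j; rewrite ler_norml => /andP [hj _]; lra.
Qed.

Lemma cell_shrunk z i p : cell z i p -> ~ nonuniq Om (envelope z) p ->
  injective A -> exists k : nat, shrunk z i k.+1%:R^-1 p.
Proof.
move=> Cp np injA; have [uA pA] := cell_subdiff Cp.
have [e e0 [h1 h2]] : exists2 e, 0 < e &
    (forall j, ~~ pred1 i j -> z 0 i - dotp p (A i) + e + dotp p (A j) <= z 0 j) /\
    (forall x, bdry Om x -> z 0 i - dotp p (A i) + e + dotp p x <= g x).
  apply: (minorant_gap (J := pred1 i)) => // [j /= ji|b bb]; apply/eqP => h; apply: np.
    exists (A i), (A j); split => //; first by rewrite (inj_eq injA) eq_sym.
    have [|_ //] := @cell_subdiff z j p.
    by rewrite /cell /= -h addrK.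
  by apply: (bdry_contact_nonuniq (OA i) bb pA); rewrite uA.
have [k Hk] := ltr_add_invr e0.
rewrite add0r in Hk; set t : R := _^-1 in Hk.
by exists k; rewrite -/t; split => [j ji|x bx]; [have := h1 _ ji|have := h2 _ bx]; lra.
Qed.

Lemma cell_bounded z i : exists k : nat, cell z i `<=` [set p | `|p| <= k%:R].
Proof.
have [k Hk] := open_erode oO (OA i).
have [_ _ _ _ [m [M bu]]] := envelope_bcf z.
have k0 : 0 < k.+1%:R^-1 :> R by rewrite invr_gt0 ltr0n.
exists (Num.truncn ((M - m) / (k.+1%:R^-1 / 2))).+1 => p /cell_subdiff [_ pA] /=.
apply: le_trans (subdiff_bound bu k0 Hk pA) _; exact: ltW (truncnS_gt _).
Qed.

Context (Rf : 'rV[R]_d -> R) (rho : {measure set (BorelRd R d) -> \bar R})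
  (Hrho : is_density Rf rho) (injA : injective A).
Local Notation W D u e := (wint (subdiff_img D u e) Rf).

Lemma shrunk_borel z i e : measurable (shrunk z i e : set (BorelRd R d)).
Proof. apply: closed_borel; exact: shrunk_closed. Qed.

Lemma cell_borel z i : measurable (cell z i : set (BorelRd R d)).
Proof. rewrite -shrunk0; exact: shrunk_borel. Qed.

Lemma rho_cell_fin z i : (rho (cell z i) < +oo)%E.
Proof.
have [k Hk] := cell_bounded z i; have [_ fin _ _] := Hrho.
apply: le_lt_trans (fin k%:R); apply: le_measure; rewrite ?inE //; first exact: cell_borel.
apply: closed_borel; exact: closed_norm_le.
Qed.

Lemma nonuniq_null z : exists N : set (BorelRd R d), [/\ measurable N, rho N = 0%E &
  nonuniq Om (envelope z) `<=` N].
Proof.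
have [_ _ _ ln] := Hrho.
by have [N [mN N0 sN]] := nonuniq_negligible ln (envelope_bcf z); exists N.
Qed.

Lemma rho_cell_le z i a : (forall k : nat, (rho (shrunk z i k.+1%:R^-1) <= a)%E) ->
  (rho (cell z i) <= a)%E.
Proof.
move=> H; have [N [mN N0 sN]] := nonuniq_null z.
rewrite leNgt; apply/negP => h.
pose F (k : nat) : set (BorelRd R d) := shrunk z i k.+1%:R^-1.
have mF k : measurable (F k) by exact: shrunk_borel.
have F1 : (a < rho (\bigcup_k F k))%E.
  apply: lt_le_trans h _; apply: le_trans (measure_setU_null _ mN N0); last first.
    exact: bigcup_measurable.
  apply: le_measure; rewrite ?inE; [exact: cell_borel|apply: measurableU => //; exact: bigcup_measurable|].
  move=> p Cp; have [np|nn] := pselect (nonuniq Om (envelope z) p); [by right; exact: sN|left].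
  by have [k hk] := cell_shrunk Cp nn injA; exists k.
have [k hk] : exists k, (a < rho (F k))%E.
  apply: measure_lt_bigcup F1 => // k l kl p [h1 h2].
  have := @natSinv_le R k l kl; set t1 := _^-1; set t2 := _^-1 => tt.
  by split => [j ji|x bx]; [have := h1 _ ji|have := h2 _ bx]; rewrite -/t1 -/t2; lra.
by have := H k; rewrite leNgt hk.
Qed.

Lemma W_envelope z (E : set 'rV[R]_d) : measurable (E : set (BorelRd R d)) -> E `<=` Om ->
  (W Om (envelope z) E = \sum_(i < n | `[< E (A i) >]) rho (cell z i))%E.
Proof.
move=> mE EO; have bu := envelope_bcf z; have [N [mN N0 sN]] := nonuniq_null z.
rewrite (W_atoms Hrho bu injA OA) // => [|x p Ox px nn]; last first.
  by have [i xi _] := subdiff_cell Ox px nn; exists i.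
apply: eq_bigr => i _; have [sw _ _ _] := Hrho.
apply: (sw _ _ N) => //; first exact: cell_borel.
  by move=> p /cell_subdiff [].
move=> p px; have [np|nn] := pselect (nonuniq Om (envelope z) p); first by right; exact: sN.
by left; have [j /injA ->] := subdiff_cell (OA i) px nn.
Qed.

Context (m : 'I_n -> \bar R) (m0 : forall i, (0 <= m i)%E) (rad : R) (rad0 : 0 <= rad)
  (msum : (\sum_i m i < rho [set p : 'rV[R]_d | (`|p| <= rad)%R])%E).
Let lo := gm - 2 * (d%:R * rad * B).
(** The admissible class of a Perron-type argument: nonempty, closed, bounded below, and stable
    under slightly lowering a height whose cell is strictly under budget. *)
Definition cell_budget z := forall i, (rho (cell z i) <= m i)%E.

Lemma dotp_rad p x : `|p| <= rad -> Om x \/ bdry Om x -> `|dotp p x| <= d%:R * rad * B.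
Proof.
move=> pr Hx; apply: le_trans (dotp_le p x) _.
have xB : `|x| <= B.
  by case: Hx => [/bO //|[cx _]]; exact: closure_bounded cx.
by apply: ler_pM => //; rewrite ?mulr_ge0 // ler_wpM2l.
Qed.

(** The pairing of a slope in the ball of radius [rad] with two points of the closure of [Om] varies
    by at most [2 * (d * rad * B)]. Were some height below [lo], each such slope would be attained
    at a node before any boundary point, hence lie in a cell, and the cells would outweigh
    [msum]. *)
Lemma cell_budget_lb z j : cell_budget z -> lo <= z 0 j.
Proof.
move=> Hz; rewrite leNgt; apply/negP => zj.
suff : (rho [set p : 'rV[R]_d | (`|p| <= rad)%R] <= \sum_i m i)%E by rewrite leNgt msum.
have mS : measurable (\bigcup_i [set A i] : set (BorelRd R d)).
  apply: fin_bigcup_measurable => // i _; apply: closed_borel; exact: point_closed.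
have SO : \bigcup_i [set A i] `<=` Om by move=> x [i _ ->].
have mB : measurable ([set p : 'rV[R]_d | `|p| <= rad] : set (BorelRd R d)).
  by apply: closed_borel; exact: closed_norm_le.
apply: le_trans (rho_le_W Hrho (envelope_bcf z) mS SO mB _) _.
  move=> p /= pr.
  (* The plane through the node of least tilted height is below the other nodes by this choice, and
     below [g] because of [zj]. *)
  case: (arg_minP (fun k => z 0 k - dotp p (A k)) (erefl (xpredT j))) => k _ Hk.
  exists (A k); first by exists k.
  suff /cell_subdiff [_ //] : cell z k p.
  split => [l|x bx]; first by have := Hk l isT; rewrite /=; lra.
  have := Hk j isT => /= h; have /andP [gx _] := bg bx.
  have := dotp_rad pr (or_introl (OA j)); have := dotp_rad pr (or_intror bx).
  rewrite !ler_norml => /andP [_ h1] /andP [h2 _]; move: zj; rewrite /lo; lra.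
rewrite W_envelope //; apply: le_trans (_ : \sum_(i < n) rho (cell z i) <= _)%E; last first.
  by apply: lee_sum => i _; exact: Hz.
by apply: lee_sum_nneg_subset => //= ? ?; exact: measure_ge0.
Qed.

Lemma cell_budget_top z : (forall i, gM + 1 <= z 0 i) -> cell_budget z.
Proof.
move=> Hz i; rewrite (_ : cell z i = set0) ?measure0 //; apply/seteqP; split => // p Cp.
have := minorant_le Cp (OA i); rewrite subrK => h; have := envelope_le_gM z (OA i).
by have := Hz i; lra.
Qed.

Lemma cell_budget_closed : closed [set z | cell_budget z].
Proof.
apply: closed_seqP => z Hz i; apply: rho_cell_le => k.
set t : R := _^-1; have t0 : 0 < t by rewrite invr_gt0 ltr0n.
have t2 : 0 < t / 2 by lra.
have [z' [Hz' zz]] := Hz _ t2.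
apply: le_trans (Hz' i); apply: le_measure; rewrite ?inE;
  [exact: shrunk_borel|exact: cell_borel|exact: shrunk_near (ltW zz)].
Qed.

(** Lowering one height enlarges only its own cell and shrinks the others. That cell varies
    continuously from above in measure, so a small decrease stays within its budget. *)
Lemma cell_budget_lower z i : cell_budget z -> (rho (cell z i) < m i)%E ->
  exists2 e, 0 < e & cell_budget (z - e *: delta_mx 0 i).
Proof.
move=> Hz lt; pose z' e := z - e *: delta_mx 0 i.
have z'i e : z' e 0 i = z 0 i - e by rewrite !mxE !eqxx /= mulr1.
have z'j e j : j != i -> z' e 0 j = z 0 j by move=> ji; rewrite !mxE (negPf ji) andbF mulr0 subr0.
pose F (k : nat) : set (BorelRd R d) := cell (z' k.+1%:R^-1) i.
have Fc k p : F k p <-> (forall j, j != i -> z 0 i - k.+1%:R^-1 - dotp p (A i) + dotp p (A j) <= z 0 j)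
   /\ (forall x, bdry Om x -> z 0 i - k.+1%:R^-1 - dotp p (A i) + dotp p x <= g x).
  rewrite /F -shrunk0 /shrunk /= z'i; split => -[h1 h2]; split => [j ji|x bx].
  - by have := h1 _ ji; rewrite addr0 z'j.
  - by have := h2 _ bx; rewrite addr0.
  - by rewrite addr0 z'j //; exact: h1.
  - by rewrite addr0; exact: h2.
have lt' : (rho (\bigcap_k F k) < m i)%E.
  apply: le_lt_trans lt; apply: le_measure; rewrite ?inE.
  - by apply: bigcap_measurable => // k _; exact: cell_borel.
  - exact: cell_borel.
  move=> p Hp; rewrite -shrunk0.
  have lim c c' : (forall k : nat, z 0 i - k.+1%:R^-1 - c <= c') -> z 0 i - c <= c'.
    move=> H; apply/ler_addgt0Pr => e e0.
    have [k Hk] := ltr_add_invr e0.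
    by rewrite add0r in Hk; have := H k; set t : R := _^-1 in Hk *; lra.
  split => [j ji|x bx]; rewrite addr0.
    suff : z 0 i - (dotp p (A i) - dotp p (A j)) <= z 0 j by lra.
    apply: lim => k.
    by have [/(_ j ji) h _] := (Fc k p).1 (Hp k I); set t : R := _^-1 in h *; lra.
  suff : z 0 i - (dotp p (A i) - dotp p x) <= g x by lra.
  apply: lim => k; have [_ /(_ x bx) h] := (Fc k p).1 (Hp k I).
  by set t : R := _^-1 in h *; lra.
have [k hk] : exists k, (rho (F k) < m i)%E.
  apply: measure_bigcap_lt lt' => [k|k l kl p /Fc [h1 h2]|]; first exact: cell_borel.
    have := @natSinv_le R k l kl => tt; apply/Fc; set t1 : R := k.+1%:R^-1 in tt *.
    set t2 : R := l.+1%:R^-1 in tt h1 h2.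
    by split => [j ji|x bx]; [have := h1 _ ji|have := h2 _ bx]; lra.
  exact: rho_cell_fin.
have k0 : 0 < k.+1%:R^-1 :> R by rewrite invr_gt0 ltr0n.
exists k.+1%:R^-1 => // j; have [->|ji] := eqVneq j i; first exact: ltW.
apply: le_trans (Hz j); apply: le_measure; rewrite ?inE; [exact: cell_borel|exact: cell_borel|].
move=> p [h1 h2]; rewrite -/(z' _) in h1 h2; rewrite z'j // in h1 h2; split => // l.
have := h1 l; have [->|li] := eqVneq l i; last by rewrite z'j.
by rewrite z'i; set t : R := _^-1 in k0 *; lra.
Qed.

Lemma discrete_weights : exists z, (forall i, rho (cell z i) = m i) /\ forall i, lo <= z 0 i.
Proof.
(* The cap [gM + 1] makes [Z] bounded; at that level all cells are empty, so [Z] is nonempty, and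
   lowering a height respects the cap. *)
pose Z : set 'rV[R]_n := [set z | cell_budget z] `&` [set z | forall i, z 0 i <= gM + 1].
have Zlo z i : Z z -> lo <= z 0 i by case=> Hz _; exact: cell_budget_lb.
have Zb z : Z z -> `|z| <= `|lo| + `|gM + 1|.
  move=> Hz; apply/rV_norm_le; split; first by rewrite addr_ge0.
  move=> i; have h1 := Zlo _ i Hz; have [_ /(_ i) h2] := Hz.
  rewrite ler_norml; have := ler_norm (- lo); have := ler_norm (gM + 1).
  by rewrite normrN; have := normr_ge0 lo; have := normr_ge0 (gM + 1); lra.
have Zc : closed Z.
  apply: closedI; first exact: cell_budget_closed.
  apply: closed_seqP => z Hz i; apply/ler_addgt0Pr => e e0.
  have [y [Hy yz]] := Hz _ e0; have := rV_coord_le (y - z) i; rewrite !mxE => h.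
  have := le_lt_trans h yz; rewrite ltr_norml => /andP [h1 h2]; have := Hy i; lra.
have cZ : compact Z by exact: bounded_compact Zc Zb.
have nZ : Z !=set0.
  exists (const_mx (gM + 1)); split => [|i /=]; last by rewrite mxE.
  by apply: cell_budget_top => i; rewrite mxE.
(* For the zero function and the slope [- const_mx 1] the tilted value is the sum of the heights. *)
have [z Zz Hz] := @compact_min R n Z (fun=> 0) (- const_mx 1) nZ cZ
  (continuous_subspaceT (@cst_continuous 'rV[R]_n R 0)).
exists z; split => [i|i]; last exact: Zlo.
have [bz tz] := Zz; apply/le_anti; rewrite bz /= leNgt; apply/negP => lt.
have [e e0 be] := cell_budget_lower bz lt.
have := Hz (z - e *: delta_mx 0 i); rewrite !dotpNl dotpBr dotp_delta !mxE.
suff h : Z (z - e *: delta_mx 0 i) by move=> /(_ h); lra.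
split => // j /=; have := tz j; rewrite !mxE /=.
have h : 0 <= e * (j == i)%:R by rewrite mulr_ge0 ?ler0n // ltW.
lra.
Qed.

Lemma discrete_solution : exists u, [/\ bcf Om u,
  (forall E : set 'rV[R]_d, measurable (E : set (BorelRd R d)) -> E `<=` Om ->
     W Om u E = \sum_(i < n | `[< E (A i) >]) m i)%E,
  (forall x, Om x -> lo <= u x <= gM),
  (forall c q, (forall y, bdry Om y -> g y <= c + dotp q y) -> forall x, Om x -> u x <= c + dotp q x) &
  (forall c q, (forall y, bdry Om y -> c + dotp q y <= g y) -> (forall i, c + dotp q (A i) <= lo) ->
     forall x, Om x -> c + dotp q x <= u x)].
Proof.
have [z [Hz loz]] := discrete_weights.
exists (envelope z); split => [|E mE EO|x Ox|c q H x Ox|c q H1 H2 x Ox].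
- exact: envelope_bcf.
- by rewrite W_envelope //; apply: eq_bigr => i _; exact: Hz.
- rewrite envelope_le_gM // andbT; apply: envelope_ge => //.
  have [y by'] := bdry0; rewrite /lo gerBl.
  have h : 0 <= B by have := bO Ox; exact: le_trans.
  by rewrite !mulr_ge0.
- exact: envelope_upper.
- apply: minorant_le => //; split => // j; exact: le_trans (loz j).
Qed.

End Envelope.

(** * Compactly supported measures *)

Section FiniteCells.
Context {R : realType} {d : nat}.
Implicit Types (x y z p q b : 'rV[R]_d) (A K D Om e : set 'rV[R]_d) (u v w g : 'rV[R]_d -> R)
  (r s t eps m M B : R).

Lemma nball_open x r : open [set y | `|y - x| < r].
Proof. by rewrite (_ : [set y | _] = fatten [set x] r); [exact: fatten_open|apply/seteqP; split => y; [exists x|case=> z ->]]. Qed.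

Lemma finite_net K s : compact K -> 0 < s -> exists (n : nat) (a : 'I_n -> 'rV[R]_d),
  [/\ injective a, (forall i, K (a i)) & forall x, K x -> exists i, `|x - a i| < s].
Proof.
move=> cK s0; have := cK; rewrite compact_cover.
move=> /(_ _ K (fun x => [set y | `|y - x| < s])) [|x Kx|D' D'K cov].
- by move=> i _; exact: nball_open.
- by exists x => //=; rewrite subrr normr0.
pose a (i : 'I_(size (finmap.enum_fset D'))) := nth 0 (finmap.enum_fset D') i.
exists _, a; split => [i j /eqP|i|x Kx].
- by rewrite nth_uniq ?finmap.fset_uniq // => /eqP /val_inj.
- by have := D'K (a i); rewrite inE; apply; rewrite mem_nth.
- have [y /= yD xy] := cov x Kx.
  have yi : (index y (finmap.enum_fset D') < size (finmap.enum_fset D'))%N by rewrite index_mem.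
  by exists (Ordinal yi); rewrite /a /= nth_index.
Qed.

(** Balls of a finite net, minus those of smaller index. The cells may stick out of [K], where the
    measure to be discretised vanishes. *)
Lemma finite_cells K s : compact K -> 0 < s ->
  exists (n : nat) (a : 'I_n -> 'rV[R]_d) (E : 'I_n -> set 'rV[R]_d),
  [/\ injective a, (forall i, K (a i)), forall i, measurable (E i : set (BorelRd R d)),
     (forall i y, E i y -> `|y - a i| < s) &
     trivIset setT E /\ forall x, K x -> exists i, E i x].
Proof.
move=> cK s0; have [n [a [inja Ka cov]]] := finite_net cK s0.
pose b (i : 'I_n) : set 'rV[R]_d := [set y | `|y - a i| < s].
pose E (i : 'I_n) : set 'rV[R]_d := b i `\` \bigcup_(j in [set j : 'I_n | (j < i)%N]) b j.
exists n, a, E; split => // [i|i y []//|].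
  apply: measurableD; first by apply: open_borel; exact: nball_open.
  apply: fin_bigcup_measurable => [|j _]; first exact: finite_finset.
  by apply: open_borel; exact: nball_open.
split.
  apply/trivIsetP => i j _ _ ij; apply/seteqP; split => // x [[bi ni] [bj nj]].
  have : (i != j :> nat) by [].
  by rewrite neq_ltn => /orP [ij'|ji']; [apply: nj; exists i|apply: ni; exists j].
move=> x Kx; have [i0 bi0] := cov x Kx.
have i0' : `[< b i0 x >] by apply/asboolP.
case: (@arg_minnP _ i0 (fun i => `[< b i x >]) (fun i : 'I_n => (i : nat)) i0') => i /asboolP bi Hi.
exists i; split => // -[j /= ji bj]; have := Hi j (asboolT bj).
by rewrite leqNgt ji.
Qed.

End FiniteCells.

Section BarrierBounds.
Context {R : realType} {d : nat} (Om : set 'rV[R]_d) (g : 'rV[R]_d -> R).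
Implicit Types (x y z p q b : 'rV[R]_d) (A K D e : set 'rV[R]_d) (u v w : 'rV[R]_d -> R)
  (c r s t eps m M B lo : R).

(* [K] carries the mass and [lo] is an a priori lower bound of [u]. *)
Definition barrier_bounds K lo D u :=
  (forall c q, (forall y, bdry Om y -> g y <= c + dotp q y) ->
     forall x, D x -> u x <= c + dotp q x) /\
  (forall c q, (forall y, bdry Om y -> c + dotp q y <= g y) ->
     (forall x, K x -> c + dotp q x <= lo) -> forall x, D x -> c + dotp q x <= u x).

Lemma barrier_bounds_limit K lo A w :
  (forall x eps, A x -> 0 < eps -> exists D v, [/\ barrier_bounds K lo D v, D x &
     `|v x - w x| <= eps]) -> barrier_bounds K lo A w.
Proof.
move=> H; split => [c q Hg x Ax|c q H1 H2 x Ax]; apply/ler_addgt0Pr => eps eps0;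
  have [D [v [[B1 B2] Dx]]] := H x eps Ax eps0; rewrite ler_norml => /andP [h1 h2].
  by have := B1 _ _ Hg _ Dx; lra.
by have := B2 _ _ H1 H2 _ Dx; lra.
Qed.

Lemma barrier_bounds_range K lo D u gm gM :
  (forall x, bdry Om x -> gm <= g x <= gM) -> lo <= gm -> barrier_bounds K lo D u ->
  forall x, D x -> lo <= u x <= gM.
Proof.
move=> bg log [B1 B2] x Dx.
have := B1 gM 0 _ x Dx; have := B2 lo 0 _ _ x Dx; rewrite dotp0l !addr0 => h1 h2.
rewrite h1 ?h2 // => [y by'|y by'|y _]; rewrite dotp0l addr0 //.
  by have /andP [] := bg _ by'.
by have /andP [h _] := bg _ by'; exact: le_trans h.
Qed.

(** [barrier] at [y] with [N = g y - lo] puts the lower affine function below [lo] on [K], as the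
    second half of [barrier_bounds] requires. *)
Lemma barrier_bounds_bdry K lo B u y eps : open Om -> (forall x, Om x -> `|x| <= B) ->
  strictly_supported Om -> {within bdry Om, continuous g} -> compact K -> K `<=` Om ->
  barrier_bounds K lo Om u -> bdry Om y -> 0 < eps ->
  exists2 r, 0 < r & forall x, Om x -> `|x - y| < r -> `|u x - g y| <= eps.
Proof.
move=> oO bO ssO cg cK KO [B1 B2] by' eps0; have e2 : 0 < eps / 2 by lra.
have [q [q0 qb qK]] := barrier (g y - lo) oO bO ssO cg by' e2 cK KO.
have [rp rp0 Hrp] := dotp_near q e2.
exists rp => // x Ox xb.
have := Hrp _ _ xb; rewrite ler_norml => /andP [_ h2].
have U1 : u x <= (g y + eps / 2 - dotp q y) + dotp q x.
  apply: B1 => // z bz; have := qb _ bz; rewrite dotpBr ler_norml => /andP [_ h]; lra.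
have U2 : (g y - eps / 2 + dotp q y) + dotp (- q) x <= u x.
  apply: B2 => // z bz; rewrite dotpNl.
    by have := qb _ bz; rewrite dotpBr ler_norml => /andP [h _]; lra.
  by have := qK _ bz; rewrite dotpBr; lra.
by rewrite dotpNl in U2; rewrite ler_norml; apply/andP; split; lra.
Qed.

End BarrierBounds.

Section CompactlySupported.
Context {R : realType} {d : nat} (Om : set 'rV[R]_d) (B gm gM : R) (g : 'rV[R]_d -> R)
  (d0 : (0 < d)%N) (oO : open Om) (cO : convex_setE Om) (bO : forall x, Om x -> `|x| <= B)
  (O0 : Om !=set0) (ssO : strictly_supported Om) (cg : {within bdry Om, continuous g})
  (bg : forall x, bdry Om x -> gm <= g x <= gM)
  (Rf : 'rV[R]_d -> R) (rho : {measure set (BorelRd R d) -> \bar R})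
  (Hrho : is_density Rf rho) (rad : R) (rad0 : 0 <= rad).
Implicit Types (x y z p q b : 'rV[R]_d) (A K D e : set 'rV[R]_d) (u v w : 'rV[R]_d -> R)
  (c r s t eps m M : R) (nu : {measure set (BorelRd R d) -> \bar R}).
Local Notation W D u e := (wint (subdiff_img D u e) Rf).
Local Notation lo := (gm - 2 * (d%:R * rad * B)).

Lemma lo_le : lo <= gm.
Proof.
have [x Ox] := O0; rewrite gerBl.
have h : 0 <= B by have := bO Ox; exact: le_trans.
by rewrite !mulr_ge0.
Qed.

(** The mass of each cell is placed at its centre and so moves by less than [s]; hence the two
    comparisons up to a fattening. *)
Lemma discretized_solution nu K s : compact K -> K `<=` Om -> nu (~` K) = 0%E ->
  (nu K < rho [set p | (`|p| <= rad)%R])%E -> 0 < s ->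
  exists u, [/\ bcf Om u, barrier_bounds Om g K lo Om u &
    forall e r, measurable (e : set (BorelRd R d)) -> s <= r -> fatten e r `<=` Om ->
      (W Om u e <= nu (fatten e r))%E /\ (nu e <= W Om u (fatten e r))%E].
Proof.
move=> cK KO K0 mK s0; have [n [a [E [inja Ka mE Ea [tE covE]]]]] := finite_cells cK s0.
have mKb : measurable (K : set (BorelRd R d)).
  by apply: closed_borel; apply: compact_closed => //; exact: Rhausdorff || exact: norm_hausdorff.
pose P (e : set 'rV[R]_d) (i : 'I_n) := `[< e (a i) >].
have sumE (e : set 'rV[R]_d) : (\sum_(i < n | P e i) nu (E i))%E =
    nu (\big[setU/set0]_(i < n | P e i) E i).
  by rewrite -(measure_bigsetU_ord nu (P e)).
have mS (e : set 'rV[R]_d) : measurable (\big[setU/set0]_(i < n | P e i) E i : set (BorelRd R d)).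
  exact: bigsetU_measurable.
have inS (e : set 'rV[R]_d) x : (\big[setU/set0]_(i < n | P e i) E i) x <->
    exists i, e (a i) /\ E i x.
  rewrite -bigcup_seq_cond; split => [[i /= /andP [_ /asboolP h] h2]|[i [h h2]]]; exists i => //=.
  by rewrite mem_index_enum; apply/asboolP.
have msum : (\sum_i nu (E i) < rho [set p | (`|p| <= rad)%R])%E.
  apply: le_lt_trans mK; rewrite (eq_bigl (P setT)); last by move=> i; apply/esym/asboolP.
  rewrite sumE; apply: le_trans (measure_setU_null mKb (measurableC mKb) K0).
  apply: le_measure; rewrite ?inE //; first exact: measurableU (measurableC _).
  by rewrite setUv.
have [u [bu Wu ru u1 u2]] := discrete_solution d0 oO cO bO O0 ssO cg bg (fun i => KO _ (Ka i))
  Hrho inja (fun i => measure_ge0 nu (E i)) rad0 msum.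
exists u; split => //; first by split => // c q h1 h2; apply: u2 => // i; exact: h2.
move=> e r me sr eO; have r0 : 0 < r by exact: lt_le_trans sr.
have mf : measurable (fatten e r : set (BorelRd R d)).
  by apply: open_borel; exact: fatten_open.
split.
  rewrite Wu //; last by move=> x ex; apply: eO; exact: sub_fatten.
  rewrite sumE; apply: le_measure; rewrite ?inE //.
  by move=> x /inS [i [ei Ei]]; exists (a i) => //; exact: lt_le_trans (Ea _ _ Ei) sr.
rewrite Wu // sumE; apply: le_trans (measure_setU_null (mS _) (measurableC mKb) K0).
apply: le_measure; rewrite ?inE //; first by apply: measurableU => //; exact: measurableC.
move=> x ex; have [Kx|nK] := pselect (K x); last by right.
left; have [i Ei] := covE x Kx; apply/inS; exists i; split => //.
by exists x => //; rewrite distrC; exact: lt_le_trans (Ea _ _ Ei) sr.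
Qed.

Lemma compact_solution nu K : compact K -> K `<=` Om -> nu (~` K) = 0%E ->
  (nu K < rho [set p | (`|p| <= rad)%R])%E ->
  exists u, [/\ bcf Om u, barrier_bounds Om g K lo Om u & MA_eq Om Rf nu u].
Proof.
move=> cK KO K0 mK.
have mKb : measurable (K : set (BorelRd R d)).
  by apply: closed_borel; apply: compact_closed => //; exact: norm_hausdorff.
have /choice [u Hu] (s : R) : exists u, 0 < s -> [/\ bcf Om u, barrier_bounds Om g K lo Om u &
    forall e r, measurable (e : set (BorelRd R d)) -> s <= r -> fatten e r `<=` Om ->
      (W Om u e <= nu (fatten e r))%E /\ (nu e <= W Om u (fatten e r))%E].
  have [s0|s0] := ltP 0 s; last by exists (fun=> 0).
  by have [u Hu] := discretized_solution cK KO K0 mK s0; exists u.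
have near0 : \forall s \near 0^'+, 0 < s :> R by exact: nbhs_right_gt.
have [s s0||w [bw mw Hw]] := @convex_cluster R d R (0^'+) _ Om B lo gM (fun=> Om) u oO cO bO.
- by near=> t; exact: erode_sub s0.
- near=> s.
  have s0 : 0 < s by near: s.
  have [bu Bu _] := Hu s s0; split => //; exact: barrier_bounds_range bg lo_le Bu.
have BB : barrier_bounds Om g K lo Om w.
  apply: barrier_bounds_limit => x eps Ox eps0.
  have [k Hk] := open_erode oO Ox.
  have k0 : 0 < k.+1%:R^-1 :> R by rewrite invr_gt0 ltr0n.
  have [s [s0 _ _ _ h]] := Hw _ _ _ near0 k0 eps0.
  by have [_ bs _] := Hu s s0; exists Om, (u s); split => //; exact: h.
exists w; split => //; apply: (@MA_limit _ _ _ _ Hrho _ _ _ lo gM bw).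
  apply: le_lt_trans (_ : nu K < +oo)%E; last exact: lt_le_trans mK (leey _).
  apply: le_trans (measure_setU_null mKb (measurableC mKb) K0).
  apply: le_measure; rewrite ?inE; [exact: open_borel|exact: measurableU (measurableC _)|].
  by rewrite setUv.
move=> s eps s0 eps0.
have nears : (0^'+) [set t : R | 0 < t < s].
  by near=> t; apply/andP; split; near: t; [exact: nbhs_right_gt|exact: nbhs_right_lt].
have [t [/= /andP [t0 ts] b1 b2 b3 b4]] := Hw _ _ _ nears s0 eps0.
have [_ _ Wt] := Hu t t0.
exists Om, (u t); split => // e r me sr eO; apply: Wt => //.
  by apply: le_trans sr; exact: ltW.
by move=> x /eO; exact: erode_sub.
Unshelve. all: by end_near.
Qed.

End CompactlySupported.

(** * The maximal solution *)

Section GeneralisedSolution.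
Context {R : realType} {d : nat} (Om : set 'rV[R]_d) (B gm gM : R) (g : 'rV[R]_d -> R)
  (d0 : (0 < d)%N) (oO : open Om) (cO : convex_setE Om) (bO : forall x, Om x -> `|x| <= B)
  (O0 : Om !=set0) (ssO : strictly_supported Om) (cg : {within bdry Om, continuous g})
  (bg : forall x, bdry Om x -> gm <= g x <= gM)
  (Rf : 'rV[R]_d -> R) (rho : {measure set (BorelRd R d) -> \bar R})
  (Hrho : is_density Rf rho) (rad : R) (rad0 : 0 <= rad).
Implicit Types (x y z p q b : 'rV[R]_d) (A K D e : set 'rV[R]_d) (u v w : 'rV[R]_d -> R)
  (c r s t eps m M : R).
Local Notation W D u e := (wint (subdiff_img D u e) Rf).
Local Notation lo := (gm - 2 * (d%:R * rad * B)).

Lemma measure_restr (mu : {measure set (BorelRd R d) -> \bar R}) (D : set (BorelRd R d)) :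
  measurable D -> exists nu : {measure set (BorelRd R d) -> \bar R}, forall e, nu e = mu (e `&` D).
Proof. by move=> mD; exists (mrestr mu mD). Qed.

Lemma MA_comparison nu1 nu2 u v : bcf Om u -> bcf Om v -> MA_eq Om Rf nu1 u -> MA_eq Om Rf nu2 v ->
  (forall O, open O -> O `<=` Om -> (nu1 O <= nu2 O)%E) ->
  (forall y t, bdry Om y -> 0 < t -> exists2 r, 0 < r & forall x, Om x -> `|x - y| < r ->
     v x - u x < t) ->
  forall x, Om x -> v x <= u x.
Proof.
move=> bu bv mu1 mu2 nn Hb; apply: (comparison Hrho d0 bu bv) => [V oV VO|t t0].
  by rewrite mu1 ?mu2 //; [exact: nn|exact: open_borel|exact: open_borel].
by apply: (comparison_boundary bu bv) => y by'; exact: Hb.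
Qed.

Let bdry0 : bdry Om !=set0.
Proof. by have [x Ox] := O0; have [b bb _] := affine_exit 0 d0 oO bO Ox; exists b. Qed.

Lemma inner_compact (delta : R) : 0 < delta -> compact (closure (inner_set Om delta)) /\
  closure (inner_set Om delta) `<=` Om.
Proof.
move=> del0; split; first by apply: (@closure_compact _ _ _ B) => x [/bO].
move=> x /(closure_inner_set d0 oO del0); apply: erode_sub.
by rewrite divr_gt0 // ltr0n.
Qed.

(** The function [u^delta], to which the finite element solutions converge at fixed [delta]. *)
Definition approximate_solution (mu : set 'rV[R]_d -> \bar R) (delta : R) v :=
  [/\ bcf Om v, barrier_bounds Om g (closure (inner_set Om delta)) lo Om v &
      MA_eq Om Rf (fun e => mu (e `&` inner_set Om delta)) v].

Lemma approximate_solution_bdry mu delta v y eps : 0 < delta ->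
  approximate_solution mu delta v -> bdry Om y -> 0 < eps ->
  exists2 r, 0 < r & forall x, Om x -> `|x - y| < r -> `|v x - g y| <= eps.
Proof.
move=> del0 [_ bb _] by' eps0; have [cK KO] := inner_compact del0.
exact: barrier_bounds_bdry oO bO ssO cg cK KO bb by' eps0.
Qed.

Context (mu : {measure set (BorelRd R d) -> \bar R})
  (mrad : (mu Om < rho [set p | (`|p| <= rad)%R])%E).

Lemma approximate_solution_exists (delta : R) : 0 < delta -> exists v, approximate_solution mu delta v.
Proof.
move=> del0; have [cK KO] := inner_compact del0; set K := closure _ in cK KO *.
have mI : measurable (inner_set Om delta : set (BorelRd R d)) by exact: inner_set_borel.
have [nu Hnu] := measure_restr mu mI.
have [||v [bv Bv Mv]] := compact_solution d0 oO cO bO O0 ssO cg bg Hrho rad0 cK KO (nu := nu).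
- rewrite Hnu (_ : _ `&` _ = set0) ?measure0 //; apply/seteqP; split => // x [nK Ix].
  by apply: nK; exact: subset_closure.
- rewrite Hnu; apply: le_lt_trans mrad; apply: le_measure; rewrite ?inE.
  + apply: measurableI => //; apply: closed_borel; exact: closed_closure.
  + exact: open_borel.
  + by move=> x [/KO].
by exists v; split => // e me eO; rewrite Mv // Hnu.
Qed.

(** A smaller parameter keeps more of [mu]; with equal boundary values, more mass means a lower
    function. *)
Lemma approximate_solution_mono (delta delta' : R) v v' : 0 < delta' -> delta' <= delta ->
  approximate_solution mu delta v -> approximate_solution mu delta' v' ->
  forall x, Om x -> v' x <= v x.
Proof.
move=> del0 dd Hv Hv'; have [bv Bv Mv] := Hv; have [bv' Bv' Mv'] := Hv'.
apply: (MA_comparison bv bv' Mv Mv') => [V oV VO|y t by' t0].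
  apply: le_measure; rewrite ?inE.
  - by apply: measurableI; [exact: open_borel|apply: inner_set_borel => //; exact: lt_le_trans dd].
  - by apply: measurableI; [exact: open_borel|exact: inner_set_borel].
  by move=> x [Vx [Ox h]]; split => //; split => //; exact: le_lt_trans h.
have t3 : 0 < t / 3 by lra.
have [r1 r10 H1] := approximate_solution_bdry (lt_le_trans del0 dd) Hv by' t3.
have [r2 r20 H2] := approximate_solution_bdry del0 Hv' by' t3.
exists (Num.min r1 r2); first by rewrite lt_min r10.
move=> x Ox; rewrite lt_min => /andP [x1 x2].
have := H1 x Ox x1; have := H2 x Ox x2; rewrite !ler_norml => /andP [? ?] /andP [? ?]; lra.
Qed.

(** The source of maximality. The weak condition on [v] is enough because [w] attains [g]
    continuously and comparison only needs [v] bounded above at the boundary. *)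
Lemma solution_le_approximate v (delta : R) w : convex_fun_on Om v -> MA_eq Om Rf mu v ->
  weak_bc Om g v -> 0 < delta -> approximate_solution mu delta w ->
  forall x, Om x -> v x <= w x.
Proof.
move=> cv Mv wv del0 Hw; have [bw Bw Mw] := Hw.
have bv : bcf Om v.
  apply: (bcf_of_bounded_above oO cO bO cv (M := gM)) => x Ox.
  have := weak_bc_le d0 oO cO bO cv wv (c := gM) (q := 0) _ Ox.
  rewrite dotp0l addr0; apply => y by'; rewrite dotp0l addr0.
  by have /andP [] := bg by'.
apply: (MA_comparison bw bv Mw Mv) => [V oV VO|y t by' t0].
  apply: le_measure; rewrite ?inE; [|exact: open_borel|by move=> x []].
  by apply: measurableI; [exact: open_borel|exact: inner_set_borel].
have t3 : 0 < t / 3 by lra.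
have [r1 r10 H1] := approximate_solution_bdry del0 Hw by' t3.
have [r2 [r20 H2]] := wv y by' _ t3.
have dR : 0 < d%:R :> R by rewrite ltr0n.
exists (Num.min r1 (r2 / d%:R)); first by rewrite lt_min r10 divr_gt0.
move=> x Ox; rewrite lt_min => /andP [x1 x2].
have e2 : enorm (x - y) < r2.
  by apply: le_lt_trans (enorm_le_norm _) _; rewrite mulrC -ltr_pdivlMr.
by have := H1 x Ox x1; have := H2 x Ox e2; rewrite !ler_norml => ? /andP [? ?]; lra.
Qed.

Theorem generalised_solution : exists (v : R -> 'rV[R]_d -> R) u,
  [/\ forall delta : R, 0 < delta -> approximate_solution mu delta (v delta),
      gen_sol Om g Rf mu u &
      forall s eps, 0 < s -> 0 < eps -> exists2 eta : R, 0 < eta &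
        forall (delta : R), 0 < delta < eta -> forall x, erode Om s x -> `|v delta x - u x| <= eps].
Proof.
have /choice [v Hv] (delta : R) : exists v, 0 < delta -> approximate_solution mu delta v.
  have [s0|s0] := ltP 0 delta; last by exists (fun=> 0).
  by have [v Hv] := approximate_solution_exists s0; exists v.
have near0 : \forall s \near 0^'+, 0 < s :> R by exact: nbhs_right_gt.
have [s s0||u [bu mu' Hu]] := @convex_cluster R d R (0^'+) _ Om B lo gM (fun=> Om) v oO cO bO.
- by near=> t; exact: erode_sub s0.
- near=> t.
  have t0 : 0 < t by near: t.
  have [bv Bv _] := Hv t t0; split => //.
  have ll : lo <= gm by exact: (lo_le gm bO O0 rad0).
  exact: barrier_bounds_range bg ll Bv.
have small (s : R) : 0 < s -> (0^'+) [set t : R | 0 < t < s].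
  by move=> s0; near=> t; apply/andP; split; near: t; [exact: nbhs_right_gt|exact: nbhs_right_lt].
(* By monotonicity in [delta] the cluster point lies below the whole family, so closeness of one
   member carries over to all smaller parameters. *)
have uv (delta : R) x : 0 < delta -> Om x -> u x <= v delta x.
  move=> del0 Ox; apply/ler_addgt0Pr => eps eps0.
  have [k Hk] := open_erode oO Ox.
  have k0 : 0 < k.+1%:R^-1 :> R by rewrite invr_gt0 ltr0n.
  have [t [/= /andP [t0 ts] _ _ _ h]] := Hu _ _ _ (small _ del0) k0 eps0.
  have := approximate_solution_mono t0 (ltW ts) (Hv _ del0) (Hv _ t0) Ox.
  by have := h x Hk; rewrite ler_norml => /andP [? ?]; lra.
exists v, u; split => //; last first.
  move=> s eps s0 eps0; have [t [/= t0 _ _ _ h]] := Hu _ _ _ near0 s0 eps0.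
  exists t => // delta /andP [del0 dt] x ex.
  have Ox : Om x by exact: erode_sub s0 _ ex.
  have := approximate_solution_mono del0 (ltW dt) (Hv _ t0) (Hv _ del0) Ox.
  have := uv _ _ del0 Ox; have := h x ex; rewrite !ler_norml => /andP [h1 h2] h3 h4.
  by apply/andP; split; lra.
have UB c q : (forall y, bdry Om y -> g y <= c + dotp q y) -> forall x, Om x -> u x <= c + dotp q x.
  move=> H x Ox; have [_ [B1 _] _] := Hv 1 ltr01.
  exact: le_trans (uv _ _ ltr01 Ox) (B1 _ _ H _ Ox).
split.
- by case: bu.
- apply: (@MA_limit _ _ _ _ Hrho _ _ _ lo gM bu); first exact: lt_le_trans mrad (leey _).
  move=> s eps s0 eps0.
  have [t [/= /andP [t0 ts] b1 b2 b3 b4]] := Hu _ _ _ (small _ s0) s0 eps0.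
  have [_ _ Mt] := Hv t t0.
  exists Om, (v t); split => // e r me sr eO; have r0 : 0 < r by exact: lt_le_trans sr.
  have fO : fatten e r `<=` Om by move=> x /eO; exact: erode_sub.
  have mf : measurable (fatten e r : set (BorelRd R d)) by apply: open_borel; exact: fatten_open.
  have mI : measurable (inner_set Om t : set (BorelRd R d)) by exact: inner_set_borel.
  (* On sets of depth [s > t] the restriction to the inner set changes nothing: there [v t] has the
     measure [mu] itself. *)
  have fI : fatten e r `<=` inner_set Om t.
    by move=> x /eO; apply: erode_inner_set => //; rewrite t0.
  have ef : e `<=` fatten e r by exact: sub_fatten.
  rewrite !Mt //; last exact: subset_trans fO.
  split; apply: le_measure; rewrite ?inE //; try exact: measurableI.
    by move=> x [/ef].
  by move=> x ex; split; [exact: ef|apply: fI; exact: ef].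
(* Only the upper barriers are uniform in [delta], since the lower ones depend on the compact set
   that carries the mass; they give exactly the weak condition. *)
- move=> y by' eps eps0; have e2 : 0 < eps / 2 by lra.
  have [q [q0 qb _]] := barrier 0 oO bO ssO cg by' e2 compact0 (@sub0set _ Om).
  have [rp rp0 Hrp] := dotp_near q e2.
  exists rp; split => // x Ox xb.
  have h : forall z, bdry Om z -> g z <= (g y + eps / 2 - dotp q y) + dotp q z.
    by move=> z bz; have := qb _ bz; rewrite dotpBr ler_norml => /andP [_ h]; lra.
  have := UB _ _ h x Ox => h1.
  have := Hrp x y (le_lt_trans (norm_le_enorm _) xb); rewrite ler_norml => /andP [_ h2].
  lra.
move=> w cw Mw ww x Ox; apply/ler_addgt0Pr => eps eps0.
have [k Hk] := open_erode oO Ox.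
have k0 : 0 < k.+1%:R^-1 :> R by rewrite invr_gt0 ltr0n.
have [t [/= t0 _ _ _ h]] := Hu _ _ _ near0 k0 eps0.
have := solution_le_approximate cw Mw ww t0 (Hv _ t0) Ox.
by have := h x Hk; rewrite ler_norml => /andP [? ?]; lra.
Unshelve. all: by end_near.
Qed.

End GeneralisedSolution.

(** * Nodal functions *)

Section NodalFunctions.
Context {R : realType} {d : nat} (Rf : 'rV[R]_d -> R)
  (rho : {measure set (BorelRd R d) -> \bar R}) (Hrho : is_density Rf rho).
Implicit Types (x y z p q b : 'rV[R]_d) (A K D Om : set 'rV[R]_d) (u v w g : 'rV[R]_d -> R)
  (c r s t eps m M B rad lo : R).
Local Notation W D u e := (wint (subdiff_img D u e) Rf).

(** Allows [weak_bc_le] to be applied on a mesh domain with [v] as its own boundary datum. *)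
Lemma closure_weak_bc D v : {within closure D, continuous v} -> open D -> weak_bc D v v.
Proof.
move=> cv oD b; rewrite bdry_open // => -[cb _] eps eps0.
have [r r0 Hr] := within_continuous_dist cv cb eps0.
exists r; split => // x Dx xb.
have := Hr x (subset_closure Dx) (le_lt_trans (norm_le_enorm _) xb).
by rewrite ltr_norml => /andP [_ h]; lra.
Qed.

Lemma bcf_closure D B v : open D -> convex_setE D -> (forall x, D x -> `|x| <= B) -> D !=set0 ->
  convex_fun_on D v -> {within closure D, continuous v} -> bcf D v.
Proof.
move=> oD cD bD [x0 Dx0] cvx cv; split => //; first by exists B.
have cK : compact (closure D) by exact: closure_compact bD.
have K0 : closure D !=set0 by exists x0; exact: subset_closure.
have [x1 _ H1] := compact_min 0 K0 cK cv.
have cNv : {within closure D, continuous (fun x => - v x)}.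
  by move=> x; apply: continuousN; exact: cv.
have [x2 _ H2] := compact_min 0 K0 cK cNv.
exists (v x1), (v x2) => x /subset_closure Dx; have := H1 x Dx; have := H2 x Dx.
by rewrite !dotp0l => h1 h2; apply/andP; split; lra.
Qed.

Lemma interior_minimum D B v x0 p : open D -> (forall x, D x -> `|x| <= B) ->
  {within closure D, continuous v} -> D x0 ->
  (forall b, bdry D b -> v x0 - dotp p x0 < v b - dotp p b) ->
  exists x, [/\ D x, subdiff D v x p & v x - dotp p x <= v x0 - dotp p x0].
Proof.
move=> oD bD cv Dx0 Hb.
have cK : compact (closure D) by exact: closure_compact bD.
have K0 : closure D !=set0 by exists x0; exact: subset_closure.
have [x cx Hx] := compact_min p K0 cK cv.
have h0 := Hx _ (subset_closure Dx0).
exists x; split => //; last by apply: subdiff_minE => y Dy; exact/Hx/subset_closure.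
apply: contrapT => nD; have := Hb x; rewrite bdry_open //.
by move=> /(_ (conj cx nD)); rewrite ltNge h0.
Qed.

Lemma affine_closure_le D v c p b : open D -> {within closure D, continuous v} ->
  (forall y, D y -> c + dotp p y <= v y) -> closure D b -> c + dotp p b <= v b.
Proof.
move=> oD cv H cb; apply/ler_addgt0Pr => eps eps0; have e2 : 0 < eps / 2 by lra.
have [r r0 Hr] := within_continuous_dist cv cb e2.
have [rp rp0 Hrp] := dotp_near p e2.
have m0 : 0 < Num.min r rp by rewrite lt_min r0.
have [y [Dy]] := (closureP _ _).1 cb _ m0; rewrite lt_min => /andP [yr ye].
have := Hr y (subset_closure Dy) yr; rewrite ltr_norml => /andP [_ h1].
have := H y Dy.
have := Hrp _ _ ye; rewrite ler_norml => /andP [h3 _].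
lra.
Qed.

(** Passes from bounds on [bdry D] to bounds inside; in the hypothesis the set is empty, so its
    lower level [0] is a dummy. If [v] fell below [lo], it would attain all slopes of the ball of
    radius [rad], against the mass bound. If it fell below an admissible plane of slope [q], it
    would attain all slopes near [q] on the set [S] where it is lower; these have positive measure,
    yet the nodes in [S] lie outside [K] and carry no mass. *)
Lemma nodal_barrier_bounds Om g gm gM D B v n (a : 'I_n -> 'rV[R]_d) K rad : (0 < d)%N ->
  (forall x, bdry Om x -> gm <= g x <= gM) -> bdry Om !=set0 ->
  open D -> convex_setE D -> (forall x, D x -> `|x| <= B) -> D !=set0 ->
  convex_fun_on D v -> {within closure D, continuous v} ->
  injective a -> (forall i, D (a i)) ->
  (forall x p, D x -> subdiff D v x p -> ~ nonuniq D v p -> exists i, x = a i) ->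
  barrier_bounds Om g set0 0 (bdry D) v -> 0 <= rad ->
  (\sum_i wint (subdiff D v (a i)) Rf < rho [set p | (`|p| <= rad)%R])%E ->
  (forall i, ~ K (a i) -> wint (subdiff D v (a i)) Rf = 0%E) ->
  barrier_bounds Om g K (gm - 2 * (d%:R * rad * B)) D v.
Proof.
move=> d0 bg bdry0 oD cD bD D0 cvx cv inja Da atoms [Hup Hlow] rad0 msum mK.
have bv : bcf D v by exact: bcf_closure bD D0 cvx cv.
have cbB b : bdry D b -> `|b| <= B by move=> [cb _]; exact: closure_bounded cb.
have lowc (b : 'rV[R]_d) c q : bdry D b -> (forall y, bdry Om y -> c + dotp q y <= g y) ->
    c + dotp q b <= v b by move=> bb H; exact: Hlow.
have bgm (b : 'rV[R]_d) : bdry D b -> gm <= v b.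
  move=> bb; have := lowc b gm 0 bb; rewrite dotp0l addr0; apply => y by'.
  by rewrite dotp0l addr0; have /andP [] := bg y by'.
set lo := gm - _.
have lov x : D x -> lo <= v x.
  move=> Dx; rewrite leNgt; apply/negP => vx.
  suff : (rho [set p | (`|p| <= rad)%R] <= \sum_i wint (subdiff D v (a i)) Rf)%E.
    by rewrite leNgt msum.
  have mD : measurable (D : set (BorelRd R d)) by exact: open_borel.
  have mB : measurable ([set p : 'rV[R]_d | `|p| <= rad] : set (BorelRd R d)).
    by apply: closed_borel; exact: closed_norm_le.
  apply: le_trans (rho_le_W Hrho bv mD (@subset_refl _ D) mB _) _.
    move=> p /= pr.
    have dr y : `|y| <= B -> `|dotp p y| <= d%:R * rad * B.
      move=> yB; apply: le_trans (dotp_le p y) _.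
      by apply: ler_pM => //; rewrite ?mulr_ge0 // ler_wpM2l.
    have [b bb|y [Dy py _]] := interior_minimum oD bD cv Dx (p := p); last by exists y.
    have := bgm b bb; have := dr _ (cbB _ bb); have := dr _ (bD _ Dx).
    rewrite !ler_norml => /andP [h1 h2] /andP [h3 h4] h5; move: vx; rewrite /lo; lra.
  rewrite (W_atoms Hrho bv inja Da atoms) //; apply: lee_sum_nneg_subset => //= i _.
  rewrite (_ : subdiff D v (a i) = subdiff_img D v [set a i]); last by rewrite /subdiff_img bigcup_set1.
  by apply: (W_ge0 Hrho bv) => [|y ->]; [apply: closed_borel; exact: point_closed|exact: Da].
split => [c q H x Dx|c q H1 H2 x0 Dx0].
  apply: weak_bc_le d0 oD cD bD cvx (closure_weak_bc cv oD) _ x Dx => b bb.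
  exact: Hup.
rewrite leNgt; apply/negP => v0.
pose S := [set x | D x /\ v x < c + dotp q x].
pose gam := c + dotp q x0 - v x0.
have gam0 : 0 < gam by rewrite subr_gt0.
have B0 : 0 <= B by have := bD _ Dx0; exact: le_trans.
(* Moving the slope by [gam / 2 / L] changes its pairing with differences of points of norm at most
   [B] by at most half of [gam], the depth of [v] below the plane at [x0]. *)
pose L := 2 * (d%:R * B) + 1.
have L0 : 0 < L by rewrite /L ltr_wpDl // !mulr_ge0.
have mS : measurable (S : set (BorelRd R d)).
  rewrite (_ : S = [set x | D x /\ - c < (dotp q x) - v x]); last first.
    by apply/seteqP; split => x [? ?]; split => //; lra.
  apply: open_borel; apply: bcf_superlevel_open bv _.
  split => //; [by exists B|by move=> x y _ _ t _; rewrite dotpDr !dotpZr|].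
  exists (- (d%:R * `|q| * B)), (d%:R * `|q| * B) => x Dx.
  rewrite -ler_norml; apply: le_trans (dotp_le q x) _.
  by rewrite ler_wpM2l ?mulr_ge0 //; exact: bD.
have [_ _ ballp _] := Hrho.
have r0 : 0 < gam / 2 / L by rewrite !divr_gt0.
have := ballp q _ r0; rewrite ltNge => /negP; apply.
have mB : measurable ([set y | `|q - y| < gam / 2 / L] : set (BorelRd R d)).
  by apply: open_borel; exact: oball_open.
apply: le_trans (rho_le_W Hrho bv mS _ mB _) _; first by move=> x [].
  move=> p /= pq.
  have dr x y : `|x| <= B -> `|y| <= B -> `|dotp (p - q) (x - y)| <= gam / 2.
    move=> xB yB; apply: le_trans (dotp_le _ _) _.
    apply: le_trans (_ : `|p - q| * L <= _); last first.
      by rewrite -ler_pdivlMr // distrC ltW.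
    rewrite (mulrC d%:R) -mulrA ler_wpM2l // /L.
    apply: le_trans (_ : d%:R * (2 * B) <= _); last lra.
    rewrite ler_wpM2l //; apply: le_trans (ler_normB _ _) _; lra.
  have [b bb|y [Dy py hy]] := interior_minimum oD bD cv Dx0 (p := p).
    have := lowc b c q bb H1; have := dr b x0 (cbB _ bb) (bD _ Dx0).
    rewrite dotpBr !dotpBl ler_norml => /andP [h1 h2] h3; move: gam0 h1 h2; rewrite /gam; lra.
  exists y => //; split => //; move: hy; have := dr y x0 (bD _ Dy) (bD _ Dx0).
  rewrite dotpBr !dotpBl ler_norml => /andP [h1 h2] h3; move: gam0 h1 h2; rewrite /gam; lra.
rewrite (W_atoms Hrho bv inja Da atoms) //; last by move=> x [].
rewrite big1 // => i /asboolP [Di vi]; apply: mK => Ki.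
by have := lov _ Di; have := H2 _ Ki; move: vi; rewrite -/lo; lra.
Qed.

End NodalFunctions.

(** * Barycentric coordinates *)

Section ConvexCombinations.
Context {R : realType} {d : nat}.
Implicit Types (x y z p q b : 'rV[R]_d) (A K D Om : set 'rV[R]_d) (u v w g : 'rV[R]_d -> R)
  (r s t e eps m M B : R).

Lemma interior_ballP A x : interior A x <-> exists2 e, 0 < e & forall y, `|y - x| < e -> A y.
Proof.
split.
  move=> h; have /nbhs_ballP [e e0 He] : nbhs x A by exact: h.
  by exists e => // y yx; apply: He; rewrite ball_rVE /= distrC.
by move=> [e e0 He]; apply/nbhs_ballP; exists e => // y; rewrite ball_rVE /= distrC => /He.
Qed.

Lemma affine_comb n (k : 'I_n -> R) (f : 'I_n -> 'rV[R]_d) c p : \sum_i k i = 1 ->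
  \sum_i k i * (c + dotp p (f i)) = c + dotp p (\sum_i k i *: f i).
Proof.
move=> k1; rewrite -[in RHS](mulr1 c) -k1 mulr_sumr.
have -> : dotp p (\sum_i k i *: f i) = \sum_i k i * dotp p (f i).
  elim/big_rec2: _ => [|i y1 y2 _ <-]; first by rewrite dotp0r.
  by rewrite dotpDr dotpZr.
by rewrite -big_split /=; apply: eq_bigr => i _; rewrite mulrDr (mulrC c).
Qed.

Lemma convex_comb A n (k : 'I_n -> R) (f : 'I_n -> 'rV[R]_d) : convex_setE A ->
  (forall i, A (f i)) -> (forall i, 0 <= k i) -> \sum_i k i = 1 -> A (\sum_i k i *: f i).
Proof.
move=> cA; elim: n k f => [|n IH] k f Af k0 k1.
  by move: k1; rewrite big_ord0 => /eqP; rewrite eq_sym oner_eq0.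
move: k1; rewrite !big_ord_recl => k1.
have [K1|K1] := eqVneq (k ord0) 1.
  rewrite [X in _ + X]big1 ?addr0; first by rewrite K1 scale1r.
  have h : \sum_(i < n) k (lift ord0 i) = 0 by rewrite K1 in k1; lra.
  by move=> i _; rewrite (psumr_eq0P _ h) ?scale0r // => j _; exact: k0.
have S0 : 0 <= \sum_(i < n) k (lift ord0 i) by apply: sumr_ge0 => i _; exact: k0.
have K0 : 0 < 1 - k ord0 by rewrite lt_neqAle eq_sym subr_eq0 eq_sym K1 /=; lra.
have -> : \sum_(i < n) k (lift ord0 i) *: f (lift ord0 i) =
    (1 - k ord0) *: \sum_(i < n) (k (lift ord0 i) / (1 - k ord0)) *: f (lift ord0 i).
  rewrite scaler_sumr; apply: eq_bigr => i _.
  by rewrite scalerA mulrCA mulfV ?mulr1 // gt_eqF.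
apply: cA => //; last by rewrite k0; lra.
apply: IH => [i|i|]; first exact: Af.
  by rewrite divr_ge0 ?k0 // ltW.
by rewrite -mulr_suml (_ : \sum_(i < n) _ = 1 - k ord0) ?mulfV ?gt_eqF //; lra.
Qed.

(** A point of the open convex set [D] with positive weight would pull the combination into [D], the
    others averaging to a point of the closure. It shows that boundary points are combinations of
    boundary vertices only. *)
Lemma comb_outside D n (k : 'I_n -> R) (f : 'I_n -> 'rV[R]_d) i : open D -> convex_setE D ->
  (forall i, closure D (f i)) -> (forall i, 0 <= k i) -> \sum_i k i = 1 ->
  ~ D (\sum_i k i *: f i) -> 0 < k i -> ~ D (f i).
Proof.
move=> oD cD cf k0 k1 nD ki Df; apply: nD; rewrite (bigD1 i) //=.
move: (k1); rewrite (bigD1 i) //= => k1'.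
have S0 : 0 <= \sum_(j < n | j != i) k j by apply: sumr_ge0 => j _; exact: k0.
have [K1|K1] := eqVneq (k i) 1.
  rewrite [X in _ + X]big1 ?addr0; first by rewrite K1 scale1r.
  have h : \sum_(j < n | j != i) k j = 0 by rewrite K1 in k1'; lra.
  by move=> j ji; rewrite (psumr_eq0P _ h) ?scale0r.
have K0 : 0 < 1 - k i by rewrite lt_neqAle eq_sym subr_eq0 eq_sym K1 /=; lra.
pose k' j := if j == i then 0 else k j / (1 - k i).
have -> : \sum_(j < n | j != i) k j *: f j = (1 - k i) *: \sum_j k' j *: f j.
  rewrite [in RHS](bigD1 i) //= {1}/k' eqxx scale0r add0r scaler_sumr.
  apply: eq_bigr => j ji; rewrite /k' (negPf ji).
  by rewrite scalerA mulrCA mulfV ?mulr1 // gt_eqF.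
apply: open_closure_segment => //; last by rewrite ki; lra.
apply: convex_comb => //; first exact: convex_closure.
  by move=> j; rewrite /k'; case: ifP => // _; rewrite divr_ge0 ?k0 // ltW.
rewrite (bigD1 i) //= {1}/k' eqxx add0r (eq_bigr (fun j => k j / (1 - k i))); last first.
  by move=> j ji; rewrite /k' (negPf ji).
by rewrite -mulr_suml (_ : \sum_(j < n | _) _ = 1 - k i) ?mulfV ?gt_eqF //; lra.
Qed.

End ConvexCombinations.

Section Barycentric.
Context {R : realType} {d : nat} (T : 'M[R]_(d.+1, d)) (indT : aff_indep T).
Implicit Types (x y : 'rV[R]_d).

Definition bary_mx : 'M[R]_(1 + d) := row_mx (const_mx 1 : 'M[R]_(1 + d, 1)) (T : 'M[R]_(1 + d, d)).
(** The coordinates of [(1, x)] in the basis of the vectors [(1, row i T)]. They are affine on the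
    whole space, so their signs describe the simplex and its interior. *)
Definition bary x : 'rV[R]_(1 + d) := (row_mx (const_mx 1 : 'M[R]_(1, 1)) x : 'rV[R]_(1 + d)) *m invmx bary_mx.

Lemma mul_bary_mx (c : 'rV[R]_(1 + d)) :
  c *m bary_mx = row_mx (const_mx (\sum_i c 0 i) : 'M[R]_(1, 1)) (\sum_i c 0 i *: row i T).
Proof.
rewrite /bary_mx mul_mx_row; congr row_mx; last exact: mulmx_sum_row.
apply/matrixP => i j; rewrite !mxE; apply: eq_bigr => k _.
by rewrite !mxE mulr1 ord1.
Qed.

Lemma bary_mx_unit : bary_mx \in unitmx.
Proof.
rewrite -row_free_unit -kermx_eq0; apply/rowV0P => c /sub_kermxP.
rewrite mul_bary_mx -row_mx0 => /eq_row_mx [h1 h2].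
have c0 : \sum_i c 0 i = 0 by move: h1 => /matrixP /(_ 0 0); rewrite !mxE.
apply/rowP => i; rewrite (indT (c := fun i => c 0 i) c0 h2 i).
by rewrite row_mx0 mxE.
Qed.

Lemma bary_mul x : bary x *m bary_mx = row_mx (const_mx 1 : 'M[R]_(1, 1)) x.
Proof. by rewrite /bary mulmxKV // bary_mx_unit. Qed.

Lemma bary_sum x : \sum_i bary x 0 i = 1.
Proof.
have := bary_mul x; rewrite mul_bary_mx => /eq_row_mx [/matrixP /(_ 0 0)].
by rewrite !mxE.
Qed.

Lemma bary_comb x : \sum_i bary x 0 i *: row i T = x.
Proof. by have := bary_mul x; rewrite mul_bary_mx => /eq_row_mx []. Qed.

Lemma bary_uniq x (c : 'I_d.+1 -> R) : \sum_i c i = 1 -> \sum_i c i *: row i T = x ->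
  forall i, bary x 0 i = c i.
Proof.
move=> c1 cx i; pose cv : 'rV[R]_(1 + d) := \row_i c i.
have -> : bary x = cv; last by rewrite mxE.
rewrite /bary -[RHS](mulmxK bary_mx_unit) mul_bary_mx; congr (row_mx _ _ *m _).
  by congr const_mx; rewrite -c1; apply: eq_bigr => j _; rewrite mxE.
by rewrite -cx; apply: eq_bigr => j _; rewrite mxE.
Qed.

Lemma bary_row j i : bary (row j T) 0 i = (i == j)%:R.
Proof.
apply: (bary_uniq (c := fun i => (i == j)%:R)).
  by rewrite (bigD1 j) //= eqxx big1 ?addr0 // => k /negPf ->.
by rewrite (bigD1 j) //= eqxx scale1r big1 ?addr0 // => k /negPf ->; rewrite scale0r.
Qed.

Definition bary_lin i : 'rV[R]_d := \row_j invmx bary_mx (rshift 1 j) i.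
Definition bary_cst i : R := invmx bary_mx (lshift d (0 : 'I_1)) i.

Lemma baryE x i : bary x 0 i = bary_cst i + dotp (bary_lin i) x.
Proof.
rewrite /bary mxE big_split_ord /= big_ord1 (row_mxEl _ x) mxE mul1r.
by congr (_ + _); rewrite /dotp; apply: eq_bigr => j _; rewrite (row_mxEr _ x) !mxE mulrC.
Qed.

Lemma bary_affine n (k : 'I_n -> R) (f : 'I_n -> 'rV[R]_d) i : \sum_j k j = 1 ->
  bary (\sum_j k j *: f j) 0 i = \sum_j k j * bary (f j) 0 i.
Proof.
move=> k1; rewrite baryE -affine_comb //; apply: eq_bigr => j _; by rewrite baryE.
Qed.

Lemma simplex_bary x : simplex_set T x <-> forall i, 0 <= bary x 0 i.
Proof.
split=> [[n [p [c [Hp [c0 [c1 ->]]]]]] i|H].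
  rewrite bary_affine //; apply: sumr_ge0 => j _; apply: mulr_ge0 => //.
  by have [k _ <-] := Hp j; rewrite bary_row.
exists d.+1, (fun i => row i T), (fun i => bary x 0 i); split; first by move=> i; exists i.
by do 2!split => //; rewrite ?bary_sum ?bary_comb.
Qed.

Lemma simplex_row i : simplex_set T (row i T).
Proof. by apply/simplex_bary => j; rewrite bary_row. Qed.

Lemma simplex_closed : closed (simplex_set T).
Proof.
rewrite (_ : simplex_set T = \bigcap_(i in [set: 'I_d.+1]) [set x | - bary_cst i <= dotp (bary_lin i) x]).
  apply: closed_bigI => i _; apply: closed_le_fun; [exact: cst_continuous|exact: dotp_continuous].
apply/seteqP; split => x.
  by move=> /simplex_bary H i _ /=; have := H i; rewrite baryE; lra.
by move=> H; apply/simplex_bary => i; have := H i I; rewrite /= baryE; lra.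
Qed.

Lemma simplex_interior x : (forall i, 0 < bary x 0 i) -> interior (simplex_set T) x.
Proof.
move=> H.
pose L i := d%:R * `|bary_lin i| + 1.
have L0 i : 0 < L i by rewrite /L ltr_wpDl // mulr_ge0.
have [e e0 He] : exists2 e, 0 < e & forall i, e <= bary x 0 i / L i.
  by apply: finite_gap => i; rewrite divr_gt0.
apply/interior_ballP; exists e => // y yx; apply/simplex_bary => i.
have := dotp_le (bary_lin i) (y - x); rewrite dotpBr ler_norml => /andP [h _].
have h2 : d%:R * `|bary_lin i| * `|y - x| <= bary x 0 i.
  apply: le_trans (_ : L i * `|y - x| <= _); first by rewrite ler_wpM2r // /L lerDl.
  by rewrite mulrC -ler_pdivlMr //; apply: le_trans (He i); exact: ltW.
by move: h2; rewrite !baryE; lra.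
Qed.

(** Move from the vertex towards the centroid [c]: all barycentric coordinates become positive. *)
Lemma simplex_row_closure i : closure (interior (simplex_set T)) (row i T).
Proof.
pose c := \sum_(j < d.+1) (d.+1%:R^-1 : R) *: row j T.
have c1 : \sum_(j < d.+1) (d.+1%:R^-1 : R) = 1.
  by rewrite sumr_const card_ord -[_ *+ _]mulr_natr mulVf // pnatr_eq0.
apply/closureP => e e0.
pose t := Num.min 1 (e / 2 / (`|c - row i T| + 1)).
have n0 : 0 < `|c - row i T| + 1 by rewrite ltr_wpDl.
have t0 : 0 < t by rewrite lt_min ltr01 /= !divr_gt0.
have t1 : t <= 1 by rewrite ge_min lexx.
exists (\sum_(j < d.+1) (t * d.+1%:R^-1 + (1 - t) * (j == i)%:R) *: row j T); split.
  apply: simplex_interior => j; rewrite (bary_uniq (c := fun j => t * d.+1%:R^-1 + (1 - t) * (j == i)%:R)) //.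
    apply: ltr_pwDl; first by rewrite mulr_gt0 // invr_gt0 ltr0n.
    by rewrite mulr_ge0 // ?ler0n // subr_ge0.
  have d1 : \sum_(j < d.+1) (j == i)%:R = 1 :> R.
    by rewrite (bigD1 i) //= eqxx big1 ?addr0 // => k /negPf ->.
  by rewrite big_split /= -!mulr_sumr c1 d1; ring.
have -> : \sum_(j < d.+1) (t * d.+1%:R^-1 + (1 - t) * (j == i)%:R) *: row j T - row i T =
    t *: (c - row i T).
  rewrite (eq_bigr (fun j => t *: (d.+1%:R^-1 *: row j T) + (1 - t) *: ((j == i)%:R *: row j T))); last first.
    by move=> j _; rewrite scalerDl !scalerA.
  have d1 : \sum_(j < d.+1) (j == i)%:R *: row j T = row i T.
    by rewrite (bigD1 i) //= eqxx scale1r big1 ?addr0 // => k /negPf ->; rewrite scale0r.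
  rewrite big_split /= -!scaler_sumr d1 /c -scaler_sumr.
  move: (_ *: \sum_(_ < _) _) (row i T) => w1 w2.
  by apply/rowP => k; rewrite !mxE; ring.
rewrite normrZ gtr0_norm //; apply: le_lt_trans (_ : t * (`|c - row i T| + 1) < _).
  by rewrite ler_wpM2l ?lerDl // ltW.
apply: le_lt_trans (_ : e / 2 < e); last lra.
by rewrite -ler_pdivlMr // ge_min lexx orbT.
Qed.

End Barycentric.

(** * Meshes and hat functions *)

Section Hats.
Context {R : realType} {d : nat}.
Implicit Types (x y v p q b A : 'rV[R]_d) (T : 'M[R]_(d.+1, d)) (M : seq 'M[R]_(d.+1, d)).

Definition verts M : seq 'rV[R]_d := undup [seq row i T | T <- M, i <- enum 'I_d.+1].

Lemma mem_verts M v : (v \in verts M) <-> mesh_verts M v.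
Proof.
rewrite mem_undup; split.
  by move=> /allpairsP [[T i] /= [TM _ ->]]; exists T, i.
by move=> [T [i [TM ->]]]; apply/allpairsP; exists (T, i); rewrite mem_enum.
Qed.

(** The nodal basis function of the vertex [A] on [T], extended affinely to the whole space. The sum
    also covers an [A] that is not a vertex of [T], where it is 0. *)
Definition psi T A x : R := \sum_(i | row i T == A) bary T x 0 i.

Lemma psiE T A x : psi T A x =
  \sum_(i | row i T == A) bary_cst T i + dotp (\sum_(i | row i T == A) bary_lin T i) x.
Proof.
have -> : dotp (\sum_(i | row i T == A) bary_lin T i) x = \sum_(i | row i T == A) dotp (bary_lin T i) x.
  elim/big_rec2: _ => [|i y1 y2 _ <-]; first by rewrite dotp0l.
  by rewrite dotpDl.
by rewrite -big_split /=; apply: eq_bigr => i _; rewrite baryE.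
Qed.

Lemma psi_comb T A n (k : 'I_n -> R) (f : 'I_n -> 'rV[R]_d) : \sum_j k j = 1 ->
  psi T A (\sum_j k j *: f j) = \sum_j k j * psi T A (f j).
Proof.
by move=> k1; rewrite psiE -affine_comb //; apply: eq_bigr => j _; rewrite psiE.
Qed.

Lemma psi_row T A j : aff_indep T -> psi T A (row j T) = (row j T == A)%:R.
Proof.
move=> iT; rewrite /psi (eq_bigr (fun i => (i == j)%:R)); last by move=> i _; rewrite bary_row.
have [jA|jA] := boolP (row j T == A).
  by rewrite (bigD1 j) //= eqxx big1 ?addr0 // => k /andP [_ /negPf ->].
rewrite big1 // => k kA; have [kj|//] := eqVneq k j.
by move: jA; rewrite -kj kA.
Qed.

(** The first simplex of the list that contains [x], with the zero matrix as default; by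
    [psi_conform] the choice does not affect [hat] on the mesh. *)
Definition tri M x : 'M[R]_(d.+1, d) := nth 0 M (find (fun T => `[< simplex_set T x >]) M).

Lemma triP M x : mesh_union M x -> tri M x \in M /\ simplex_set (tri M x) x.
Proof.
move=> [T TM Tx]; have hT : has (fun T => `[< simplex_set T x >]) M.
  by apply/hasP; exists T => //; apply/asboolP.
by split; [rewrite mem_nth // -has_find|apply/asboolP; exact: (nth_find 0 hT)].
Qed.

Definition hat M A x : R := psi (tri M x) A x.

End Hats.

Section Mesh.
Context {R : realType} {d : nat} (Om : set 'rV[R]_d) (B : R) (M : seq 'M[R]_(d.+1, d)) (h : R)
  (oO : open Om) (cO : convex_setE Om) (bO : forall x, Om x -> `|x| <= B)
  (O0 : Om !=set0) (HM : is_mesh Om M h) (h0 : 0 < h).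
Implicit Types (x y v p q b A : 'rV[R]_d) (T : 'M[R]_(d.+1, d)).
Local Notation D := (mesh_dom M).

Let indT T : T \in M -> aff_indep T.
Proof. by case: HM => H _ _ _ _ /H []. Qed.

Lemma mesh_union_closed : closed (mesh_union M).
Proof.
apply: closed_bigcup; first exact: finite_seq.
by move=> T /= TM; apply: simplex_closed; exact: indT.
Qed.

Lemma mesh_dom_open : open D.
Proof. exact: open_interior. Qed.

Lemma mesh_dom_union x : D x -> mesh_union M x.
Proof. exact: interior_subset. Qed.

Lemma mesh_union_closure x : mesh_union M x -> closure Om x.
Proof. by move=> [T TM Tx]; case: HM => H _ _ _ _; have [_] := H _ TM; apply. Qed.

Lemma closure_mesh_dom x : closure D x -> mesh_union M x.
Proof. by move=> cx; apply: mesh_union_closed; apply: closure_subset cx; exact: interior_subset. Qed.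

Lemma mesh_dom_sub x : D x -> Om x.
Proof.
move=> /interior_ballP [e e0 He]; apply: interior_closure_convex => //.
by exists e => // y yx; apply: mesh_union_closure; exact: He.
Qed.

Lemma simplex_interior_dom T : T \in M -> interior (simplex_set T) `<=` D.
Proof. by move=> TM; apply: interiorS => x Tx; exists T. Qed.

Lemma vert_closure v : mesh_verts M v -> closure D v.
Proof.
move=> [T [i [TM ->]]].
by apply: (closure_subset (simplex_interior_dom TM)); apply: simplex_row_closure; exact: indT.
Qed.

Lemma vert_bdry v : mesh_verts M v -> ~ D v -> bdry D v.
Proof. by move=> Mv nD; rewrite bdry_open; [split => //; exact: vert_closure|exact: mesh_dom_open]. Qed.

Lemma mesh_nonempty : exists T, T \in M.
Proof.
have [_ _ + _ _] := HM; case: (M) => [|T s _]; last by exists T; rewrite inE eqxx.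
rewrite /meshsize (_ : [set _ | _ in _] = set0) ?sup0 => [h1|].
  by move: h0; rewrite -h1 ltxx.
by apply/seteqP; split => // y [].
Qed.

Lemma mesh_dom_nonempty : D !=set0.
Proof.
have [T TM] := mesh_nonempty.
have [e [De _]] := (closureP _ _).1 (vert_closure (ex_intro _ T (ex_intro _ ord0 (conj TM erefl)))) 1 ltr01.
by exists e.
Qed.

Lemma simplex_diam T x y : T \in M -> simplex_set T x -> simplex_set T y -> `|x - y| <= h.
Proof.
move=> TM Tx Ty; have [H _ <- _ _] := HM.
have cB z : closure Om z -> `|z| <= B by exact: closure_bounded bO z.
have bd T' : T' \in M -> ubound [set r | exists x y, simplex_set T' x /\ simplex_set T' y /\
    r = enorm (x - y)] (d%:R * (B + B)).
  move=> T'M r [x' [y' [Tx' [Ty' ->]]]]; apply: le_trans (enorm_le_norm _) _.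
  rewrite ler_wpM2l //; apply: le_trans (ler_normB _ _) _.
  by have [_ S] := H _ T'M; apply: lerD; apply: cB; exact: S.
apply: le_trans (norm_le_enorm _) _; apply: le_trans (_ : diamE (simplex_set T) <= _).
  by apply: ub_le_sup; [exists (d%:R * (B + B)); exact: bd|exists x, y].
apply: ub_le_sup; last by exists T.
exists (d%:R * (B + B)) => _ [T' T'M <-]; apply: ge_sup; last exact: bd.
by exists (enorm (row ord0 T' - row ord0 T')), (row ord0 T'), (row ord0 T'); do ?split => //;
  exact: (simplex_row (indT T'M)).
Qed.

(** Both functions are affine and agree at the common vertices, whose hull is the intersection of
    the two simplices. *)
Lemma psi_conform T T' A x : T \in M -> T' \in M -> simplex_set T x -> simplex_set T' x ->
  psi T A x = psi T' A x.
Proof.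
move=> TM T'M Tx T'x; have [->//|TT'] := eqVneq T T'.
have [_ H _ _ _] := HM; have [s [Hs [_ sE]]] := H _ _ TM T'M TT'.
have : (simplex_set T `&` simplex_set T') x by [].
rewrite sE => -[n [p [c [ps [_ [c1 ->]]]]]].
rewrite !psi_comb //; apply: eq_bigr => j _; congr (_ * _).
have [i [i' [e1 e2]]] := Hs _ (ps j).
by rewrite {1}e1 e2 !psi_row; [rewrite -e1 -e2|exact: indT|exact: indT].
Qed.

Lemma hatE T A x : T \in M -> simplex_set T x -> hat M A x = psi T A x.
Proof.
move=> TM Tx; have [tM tx] := triP (ex_intro2 _ _ T TM Tx : mesh_union M x).
exact: psi_conform.
Qed.

Lemma psi_continuous T A : continuous (psi T A : 'rV[R]_d -> R).
Proof.
rewrite (_ : psi T A = fun x => \sum_(i | row i T == A) bary_cst T i +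
    dotp (\sum_(i | row i T == A) bary_lin T i) x); last by apply/funext => x; exact: psiE.
move=> x; apply: (@cvgD R R 'rV[R]_d (nbhs x) (nbhs_filter x) (fun=> _) (dotp _) _ _).
  exact: cvg_cst.
exact: dotp_continuous.
Qed.

Lemma finite_min (I : eqType) (s : seq I) (P : I -> R -> Prop) :
  (forall i r r', r' <= r -> P i r -> P i r') -> (forall i, i \in s -> exists2 r, 0 < r & P i r) ->
  exists2 r, 0 < r & forall i, i \in s -> P i r.
Proof.
move=> mono; elim: s => [|i s IH] H; first by exists 1.
have [r1 r10 H1] := H i (mem_head _ _).
have [r2 r20 H2] := IH (fun j js => H j (mem_behead (s := i :: s) js)).
exists (Num.min r1 r2); first by rewrite lt_min r10.
move=> j; rewrite inE => /orP [/eqP ->|js]; first by apply: mono H1; rewrite ge_min lexx.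
by apply: mono (H2 _ js); rewrite ge_min lexx orbT.
Qed.

(** Near [x] only simplices containing [x] occur, the finitely many others being closed; on each of
    them the hat is affine, with the same value at [x]. *)
Lemma hat_continuous A : {within closure D, continuous (hat M A)}.
Proof.
apply/subspace_continuousP => x cx; apply/cvgrPdist_lt => e e0.
have Mx := closure_mesh_dom cx.
have [r r0 Hr] : exists2 r, 0 < r & forall T, T \in M -> forall y, `|y - x| < r -> simplex_set T y ->
    simplex_set T x /\ `|psi T A x - psi T A y| < e.
  apply: finite_min => [T r r' rr HT y yx|T TM]; first by apply: HT; exact: lt_le_trans rr.
  have [Tx|nTx] := pselect (simplex_set T x).
    have /cvgrPdist_lt /(_ e e0) := psi_continuous (T := T) (A := A) (x := x).
    move=> /nbhs_ballP [r r0 Hr]; exists r => // y yx Ty; split => //.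
    by apply: Hr; rewrite ball_rVE /= distrC.
  have oT : open (~` simplex_set T) by rewrite openC; apply: simplex_closed; exact: indT.
  have [r r0 Hr] := (open_ballP _).1 oT x nTx.
  by exists r => // y yx Ty; exfalso; exact: Hr yx Ty.
apply/nbhs_ballP; exists r => // y; rewrite ball_rVE /= distrC => yx cy.
have [tM ty] := triP (closure_mesh_dom cy).
have [tx lt] := Hr _ tM _ yx ty.
change (`|hat M A x - hat M A y| < e).
by rewrite (hatE A tM tx) (hatE A tM ty).
Qed.

Lemma hat_is_hat A : mesh_verts M A -> is_hat M A (hat M A).
Proof.
move=> [T0 [i0 [T0M A0]]]; split.
- exact: hat_continuous.
- move=> T TM; exists (\sum_(i | row i T == A) bary_lin T i), (\sum_(i | row i T == A) bary_cst T i).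
  by move=> x Tx; rewrite (hatE A TM Tx) psiE addrC.
- rewrite {2}A0 (hatE _ T0M); last by apply: simplex_row; exact: indT.
  by rewrite psi_row ?A0 ?eqxx //; exact: indT.
- move=> v [T [i [TM ->]]] vA; rewrite (hatE _ TM); last by apply: simplex_row; exact: indT.
  by rewrite psi_row ?(negPf vA) //; exact: indT.
Qed.

Lemma sum_unique n (Q : pred 'I_n) (a : 'I_n -> 'rV[R]_d) v (c : R) : injective a ->
  \sum_(k | Q k && (v == a k)) c = if [exists k, Q k && (v == a k)] then c else 0.
Proof.
move=> inja; case: ifP => [/existsP [k /andP [Qk /eqP vk]]|/negbT/existsPn H]; last first.
  by rewrite big1 // => k; rewrite (negPf (H k)).
rewrite (bigD1 k) /=; last by rewrite Qk vk eqxx.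
rewrite big1 ?addr0 // => j /andP [/andP [_ /eqP vj]]; rewrite vk in vj.
by rewrite (inja _ _ vj) eqxx.
Qed.

Lemma hat_sum T n (a : 'I_n -> 'rV[R]_d) (Q : pred 'I_n) x : injective a -> T \in M ->
  simplex_set T x -> \sum_(k | Q k) hat M (a k) x =
    \sum_i if [exists k, Q k && (row i T == a k)] then bary T x 0 i else 0.
Proof.
move=> inja TM Tx; rewrite (eq_bigr (fun k => psi T (a k) x)); last by move=> k _; rewrite (hatE _ TM Tx).
rewrite /psi (exchange_big_dep xpredT) //=; apply: eq_bigr => i _.
by rewrite sum_unique.
Qed.

Definition interior_verts : seq 'rV[R]_d := [seq v <- verts M | `[< D v >]].

(** Only interior vertices are listed, so the hats need not sum to 1 near the boundary: the last
    clause asks that every vertex within [h] of [x] be listed and selected by [Q]. *)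
Lemma hat_partition : exists n (a : 'I_n -> 'rV[R]_d), 
  [/\ injective a, forall i, mesh_verts M (a i) /\ D (a i),
      forall v, mesh_verts M v -> D v -> exists i, v = a i &
      forall x, D x -> [/\ forall i, 0 <= hat M (a i) x,
        forall i, hat M (a i) x != 0 -> `|x - a i| <= h,
        forall Q : pred 'I_n, \sum_(i | Q i) hat M (a i) x <= 1 &
        forall Q : pred 'I_n, (forall y, mesh_verts M y -> `|y - x| <= h -> exists2 i, y = a i & Q i) ->
           \sum_(i | Q i) hat M (a i) x = 1]].
Proof.
pose iv := interior_verts.
pose a (k : 'I_(size iv)) := nth 0 iv k.
have ivP v : v \in iv <-> mesh_verts M v /\ D v.
  rewrite mem_filter; split => [/andP [/asboolP h1 /mem_verts h2] //|[/mem_verts h1 h2]].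
  by rewrite h1 andbT; apply/asboolP.
have inja : injective a.
  move=> i j /eqP; rewrite nth_uniq ?filter_uniq ?undup_uniq // => /eqP; exact: val_inj.
exists _, a; split => // [i|v Mv Dv|x Dx].
- by apply/ivP; rewrite mem_nth.
- have vi : v \in iv by apply/ivP.
  have vs : (index v iv < size iv)%N by rewrite index_mem.
  by exists (Ordinal vs); rewrite /a /= nth_index.
have [T TM Tx] := mesh_dom_union Dx.
have b0 := (simplex_bary (indT TM) x).1 Tx.
split => [i|i|Q|Q HQ].
- rewrite (hatE _ TM Tx); apply: sumr_ge0 => j _; exact: b0.
- rewrite (hatE _ TM Tx); have [/existsP [j /eqP ja] _|/existsPn H] := boolP [exists j, row j T == a i].
    by rewrite -ja; exact: simplex_diam TM Tx (simplex_row (indT TM) j).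
  by rewrite /psi big1 ?eqxx // => j /(negP (H j)).
- rewrite (hat_sum _ inja TM Tx) -(bary_sum (indT TM) x); apply: ler_sum => i _.
  by case: ifP => // _; exact: b0.
rewrite (hat_sum _ inja TM Tx) -[RHS](bary_sum (indT TM) x); apply: eq_bigr => i _.
have ri : simplex_set T (row i T) by apply: simplex_row; exact: indT.
have [|k rk Qk] := HQ (row i T) _ (simplex_diam TM ri Tx); first by exists T, i.
by case: ifP => // /negbT/existsPn /(_ k); rewrite Qk rk eqxx.
Qed.

Context (g : 'rV[R]_d -> R).
Implicit Types (w z : 'rV[R]_d -> R) (c r s t e eps : R).

Definition vert_height z v := if `[< D v >] then z v else g v.

Definition hull_heights z x : set R := [set t | convhull (lifted_pts g M z) (x, t)].

Lemma lifted_ptsP z (q : 'rV[R]_d * R) : lifted_pts g M z q <->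
  mesh_verts M q.1 /\ q.2 = vert_height z q.1.
Proof.
rewrite /vert_height; split => [[Mq [[Dq ->]|[bq ->]]]|[Mq qE]]; split => //.
- by rewrite asboolT.
- rewrite asboolF // => Dq; move: bq; rewrite bdry_open; [by case|exact: mesh_dom_open].
have [Dq|Dq] := pselect (D q.1); [left|right]; split => //.
- by rewrite qE asboolT.
- exact: vert_bdry.
- by rewrite qE asboolF.
Qed.

Lemma hull_heightsP z x t : hull_heights z x t <->
  exists (n : nat) (p : 'I_n -> 'rV[R]_d) (c : 'I_n -> R), [/\ forall i, mesh_verts M (p i),
    forall i, 0 <= c i, \sum_i c i = 1, x = \sum_i c i *: p i &
    t = \sum_i c i * vert_height z (p i)].
Proof.
have sumE n (c : 'I_n -> R) (q : 'I_n -> 'rV[R]_d * R) :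
    \sum_i c i *: q i = (\sum_i c i *: (q i).1, \sum_i c i * (q i).2).
  by elim/big_rec3: _ => // i y1 y2 y3 _ ->.
split => [[n [q [c [Hq [c0 [c1]]]]]]|[n [p [c [Hp c0 c1 -> ->]]]]].
  rewrite sumE => -[-> ->]; exists n, (fun i => (q i).1), c; split => //.
    by move=> i; have /lifted_ptsP [] := Hq i.
  by apply: eq_bigr => i _; have /lifted_ptsP [_ ->] := Hq i.
exists n, (fun i => (p i, vert_height z (p i))), c; split.
  by move=> i; apply/lifted_ptsP; split => //; exact: Hp.
by rewrite sumE.
Qed.

Lemma hull_heights_ge z x t c q : (forall v, mesh_verts M v -> c + dotp q v <= vert_height z v) ->
  hull_heights z x t -> c + dotp q x <= t.
Proof.
move=> H /hull_heightsP [n [p [k [Hp k0 k1 -> ->]]]].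
by rewrite -affine_comb //; apply: ler_sum => i _; rewrite ler_wpM2l //; exact: H.
Qed.

Lemma hull_heights_union z x T : T \in M -> simplex_set T x ->
  hull_heights z x (\sum_i bary T x 0 i * vert_height z (row i T)).
Proof.
move=> TM Tx; apply/hull_heightsP; exists d.+1, (fun i => row i T), (fun i => bary T x 0 i); split => //.
- by move=> i; exists T, i.
- by apply/(simplex_bary (indT TM)).
- exact: bary_sum (indT TM) x.
- by rewrite bary_comb //; exact: indT.
Qed.

Lemma hull_heights_lbound z x : has_lbound (hull_heights z x).
Proof.
pose c := - \sum_(v <- verts M) `|vert_height z v|.
exists c => t /(hull_heights_ge (c := c) (q := 0)); rewrite dotp0l addr0; apply => v /mem_verts vM.
rewrite dotp0l addr0 /c lerNl; apply: le_trans (_ : `|vert_height z v| <= _).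
  by rewrite -normrN ler_norm.
by rewrite (bigD1_seq v) ?undup_uniq //= lerDl sumr_ge0.
Qed.

Context (w z : 'rV[R]_d -> R)
  (wz : forall x, closure D x -> w x = inf (hull_heights z x)).

Lemma nodal_le_hull x t : closure D x -> hull_heights z x t -> w x <= t.
Proof. by move=> cx Ht; rewrite wz //; apply: ge_inf Ht; exact: hull_heights_lbound. Qed.

Lemma nodal_ge_hull x c : closure D x -> (forall t, hull_heights z x t -> c <= t) -> c <= w x.
Proof.
move=> cx H; rewrite wz //; apply: lb_le_inf => //.
by have [T TM Tx] := closure_mesh_dom cx; eexists; exact: hull_heights_union TM Tx.
Qed.

Lemma nodal_le_height v : mesh_verts M v -> w v <= vert_height z v.
Proof.
move=> Mv; apply: nodal_le_hull; first exact: vert_closure.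
apply/hull_heightsP; exists 1%N, (fun=> v), (fun=> 1); split => //; rewrite big_ord1 //.
  by rewrite scale1r.
by rewrite mul1r.
Qed.

Let convD : convex_setE D.
Proof. by case: HM. Qed.

Lemma bdry_vert_height v : mesh_verts M v -> ~ D v -> bdry Om v /\ vert_height z v = g v.
Proof.
move=> Mv nD; have [_ _ _ _ H] := HM; split; first by apply: H => //; exact: vert_bdry.
by rewrite /vert_height asboolF.
Qed.

(** A boundary point of [D] is a combination of vertices, and by [comb_outside] those of positive
    weight lie off [D], hence on [bdry Om] with height [g]. A simplex containing the point gives the
    upper bound, arbitrary combinations the lower one. *)
Lemma nodal_bdry : barrier_bounds Om g set0 0 (bdry D) w.
Proof.
have vb n (p : 'I_n -> 'rV[R]_d) (k : 'I_n -> R) i : (forall i, mesh_verts M (p i)) ->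
    (forall i, 0 <= k i) -> \sum_i k i = 1 -> bdry D (\sum_i k i *: p i) -> k i != 0 ->
    bdry Om (p i) /\ vert_height z (p i) = g (p i).
  move=> Hp k0 k1; rewrite bdry_open; last exact: mesh_dom_open.
  move=> [_ nD] ki; apply: bdry_vert_height => //.
  have ki0 : 0 < k i by rewrite lt_neqAle eq_sym ki k0.
  apply: (comb_outside mesh_dom_open convD _ k0 k1 nD ki0).
  by move=> j; exact: vert_closure.
split => [c q Hg b bb|c q Hg _ b bb]; have [cb _] := bb.
  have [T TM Tb] := closure_mesh_dom cb.
  apply: le_trans (nodal_le_hull cb (hull_heights_union z TM Tb)) _.
  rewrite -{2}(bary_comb (indT TM) b) -affine_comb; last exact: bary_sum (indT TM) b.
  apply: ler_sum => i _; have [->|bi] := eqVneq (bary T b 0 i) 0; first by rewrite !mul0r.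
  have [| | | |b1 ->] := vb _ (fun i => row i T) (fun i => bary T b 0 i) i _ _ _ _ bi.
  - by move=> j; exists T, j.
  - exact: (simplex_bary (indT TM) b).1 Tb.
  - exact: bary_sum (indT TM) b.
  - by rewrite bary_comb //; exact: indT.
  by rewrite ler_wpM2l ?Hg //; exact: (simplex_bary (indT TM) b).1 Tb i.
apply: nodal_ge_hull => // t /hull_heightsP [n [p [k [Hp k0 k1 bE ->]]]].
rewrite bE -affine_comb //; apply: ler_sum => i _.
have [->|ki] := eqVneq (k i) 0; first by rewrite !mul0r.
have [|b1 ->] := vb _ p k i Hp k0 k1 _ ki; first by rewrite -bE.
by rewrite ler_wpM2l ?Hg.
Qed.

(** A supporting plane strictly below all vertex values could be raised under the hull, so it
    touches at some vertex. If [x] is not a vertex, that is a second contact point. *)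
Lemma nodal_atoms x p : bcf D w -> {within closure D, continuous w} -> D x ->
  subdiff D w x p -> ~ nonuniq D w p -> mesh_verts M x.
Proof.
move=> bw cw Dx px nn; apply: contrapT => nM; apply: nn.
pose c := w x - dotp p x.
have aw y : closure D y -> c + dotp p y <= w y.
  apply: affine_closure_le cw _ => [|y' Dy']; first exact: mesh_dom_open.
  by have := px _ Dy'; rewrite dotpBr /c; lra.
have [v [Mv wv]] : exists v, mesh_verts M v /\ w v <= c + dotp p v.
  apply: contrapT => H; pose f (k : 'I_(size (verts M))) := nth 0 (verts M) k.
  have [e e0 He] : exists2 e, 0 < e & forall k, e <= vert_height z (f k) - (c + dotp p (f k)).
    apply: finite_gap => k; have Mk : mesh_verts M (f k) by apply/mem_verts; rewrite mem_nth.
    rewrite subr_gt0; apply: lt_le_trans (nodal_le_height Mk); rewrite ltNge; apply/negP => wle.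
    by apply: H; exists (f k).
  have : c + e + dotp p x <= w x; last by rewrite /c; lra.
  apply: nodal_ge_hull => [|t]; first exact: subset_closure.
  apply: hull_heights_ge => v /mem_verts vM.
  have vs : (index v (verts M) < size (verts M))%N by rewrite index_mem.
  by have := He (Ordinal vs); rewrite /f /= nth_index //; lra.
have xv : x != v by apply/eqP => xE; apply: nM; rewrite xE.
apply: (contact_nonuniq bw Dx (vert_closure Mv) xv px) => eps eps0; have e2 : 0 < eps / 2 by lra.
have [r r0 Hr] := within_continuous_dist cw (vert_closure Mv) e2.
have [rp rp0 Hrp] := dotp_near p e2.
exists (Num.min r rp); first by rewrite lt_min r0.
move=> y Dy; rewrite lt_min => /andP [yr ye].
have := Hr y (subset_closure Dy) yr; rewrite ltr_norml => /andP [_ h1].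
have := Hrp _ _ ye; rewrite ler_norml => /andP [h3 _].
by rewrite dotpBr; move: wv; rewrite /c; lra.
Qed.

End Mesh.

(** * Convergence of the finite element solutions *)

Section FiniteElements.
Context {R : realType} {d : nat} (Om : set 'rV[R]_d) (B gm gM : R) (g : 'rV[R]_d -> R)
  (d0 : (0 < d)%N) (oO : open Om) (cO : convex_setE Om) (bO : forall x, Om x -> `|x| <= B)
  (O0 : Om !=set0) (ssO : strictly_supported Om) (cg : {within bdry Om, continuous g})
  (bg : forall x, bdry Om x -> gm <= g x <= gM)
  (Rf : 'rV[R]_d -> R) (rho : {measure set (BorelRd R d) -> \bar R})
  (Hrho : is_density Rf rho) (rad : R) (rad0 : 0 <= rad)
  (mu : {measure set (BorelRd R d) -> \bar R})
  (mrad : (mu Om < rho [set p | (`|p| <= rad)%R])%E).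
Implicit Types (x y z p q b : 'rV[R]_d) (A K D e : set 'rV[R]_d) (u v w : 'rV[R]_d -> R)
  (c r s t eps m : R).
Local Notation W D u e := (wint (subdiff_img D u e) Rf).
Local Notation lo := (gm - 2 * (d%:R * rad * B)).

Let bdry0 : bdry Om !=set0.
Proof. by have [x Ox] := O0; have [b bb _] := affine_exit 0 d0 oO bO Ox; exists b. Qed.

Lemma hat_measurable (M : seq 'M[R]_(d.+1, d)) h b : is_mesh Om M h ->
  measurable_fun (mesh_dom M : set (BorelRd R d)) (hat M b : BorelRd R d -> R).
Proof.
move=> HM; have cf := @hat_continuous _ _ _ _ _ HM b; have oD := @mesh_dom_open R d M.
move=> mD; apply: (measurability _ (RGenOInfty.measurableE R)) => // _ [_ [c ->] <-].
apply: open_borel; apply/open_ballP => x [Dx]; rewrite /= in_itv /= andbT => cx.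
have e0 : 0 < hat M b x - c by rewrite subr_gt0.
have [r r0 Hr] := within_continuous_dist cf (subset_closure Dx) e0.
have [r1 r10 Hr1] := (open_ballP _).1 oD x Dx.
exists (Num.min r r1); first by rewrite lt_min r0.
move=> y; rewrite lt_min => /andP [y1 y2]; have Dy := Hr1 y y2; split => //.
rewrite /= in_itv /= andbT; have := Hr y (subset_closure Dy) y1.
by rewrite ltr_norml => /andP [h1 _]; lra.
Qed.

(** The mass at a node is the integral of its hat. The hats of nodes in [e] sum to at most 1 and
    vanish outside [fatten e r], while those of nodes in [fatten e r] sum to 1 on [e]; this gives
    the two comparisons. *)
Lemma nodal_approximation (M : seq 'M[R]_(d.+1, d)) h delta v K : is_mesh Om M h -> 0 < h ->
  0 < delta ->
  fe_sol g Rf M (fun phi => \int[mu]_(x in mesh_dom M `&` inner_set Om delta) (phi x)%:E)%E v ->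
  (forall x y, inner_set Om delta x -> `|x - y| <= h -> K y) ->
  [/\ bcf (mesh_dom M) v, barrier_bounds Om g K lo (mesh_dom M) v &
    forall e r, measurable (e : set (BorelRd R d)) -> h < r -> fatten e r `<=` mesh_dom M ->
      (W (mesh_dom M) v e <= mu (fatten e r `&` inner_set Om delta))%E /\
      (mu (e `&` inner_set Om delta) <= W (mesh_dom M) v (fatten e r))%E].
Proof.
move=> HM h0 del0 [[cv wv [z zE]] Hfe] HK.
have oD := @mesh_dom_open R d M; have D0 := mesh_dom_nonempty HM h0.
have cD : convex_setE (mesh_dom M) by case: HM.
have DO := mesh_dom_sub oO cO O0 HM.
have bD x : mesh_dom M x -> `|x| <= B by move=> /DO /bO.
have bv : bcf (mesh_dom M) v by exact: bcf_closure oD cD bD D0 cv wv.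
have [n [a [inja Da allv Hhat]]] := hat_partition bO HM.
pose mass i := wint (subdiff (mesh_dom M) v (a i)) Rf.
set DI := mesh_dom M `&` inner_set Om delta in Hfe.
have mDb : measurable (mesh_dom M : set (BorelRd R d)) by exact: open_borel.
have mI : measurable (inner_set Om delta : set (BorelRd R d)) by exact: inner_set_borel.
have mDI : measurable (DI : set (BorelRd R d)) by exact: measurableI.
have massE i : mass i = (\int[mu]_(x in DI) (hat M (a i) x)%:E)%E.
  by have [Ma Dai] := Da i; apply: Hfe => //; exact: (hat_is_hat HM).
have mhat i : measurable_fun (DI : set (BorelRd R d)) (fun x : BorelRd R d => (hat M (a i) x)%:E).
  apply/measurable_EFinP; apply: (measurable_funS mDb _ (hat_measurable (a i) HM)).
  by move=> x [].
have hat0 i x : DI x -> (0 <= (hat M (a i) x)%:E)%E.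
  by move=> [Dx _]; have [H _ _ _] := Hhat x Dx; rewrite lee_fin.
have sumE (Q : pred 'I_n) : (\sum_(i < n | Q i) mass i)%E =
    (\int[mu]_(x in DI) (\sum_(i < n | Q i) hat M (a i) x)%:E)%E.
  rewrite -big_filter (eq_bigr (fun i => \int[mu]_(x in DI) (hat M (a i) x)%:E)%E); last first.
    by move=> i _; exact: massE.
  rewrite -(ge0_integral_sum mu mDI) //; apply: eq_integral => x _.
  by rewrite big_filter sumEFin.
have msum (Q : pred 'I_n) : measurable_fun (DI : set (BorelRd R d))
    (fun x : BorelRd R d => (\sum_(i < n | Q i) hat M (a i) x)%:E).
  rewrite (_ : (fun x => _) = (fun x => (\sum_(i <- [seq i <- index_enum _ | Q i]) (hat M (a i) x)%:E)%E)); last first.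
    by apply/funext => x; rewrite sumEFin big_filter.
  exact: emeasurable_sum.
have sum0 (Q : pred 'I_n) x : DI x -> (0 <= (\sum_(i < n | Q i) hat M (a i) x)%:E)%E.
  by move=> [Dx _]; have [H _ _ _] := Hhat x Dx; rewrite lee_fin sumr_ge0.
have mind (E : set (BorelRd R d)) : measurable E ->
    measurable_fun (DI : set (BorelRd R d)) (fun x : BorelRd R d => (\1_E x : R)%:E).
  by move=> mE; apply/measurable_EFinP; exact: measurable_indic.
have sum_le (Q : pred 'I_n) (E : set (BorelRd R d)) : measurable E ->
    (forall x, DI x -> ~ E x -> \sum_(i < n | Q i) hat M (a i) x = 0) ->
    (\sum_(i < n | Q i) mass i <= mu (E `&` DI))%E.
  move=> mE HE; rewrite sumE -(integral_indic mu mDI mE).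
  apply: ge0_le_integral => //; [exact: sum0|exact: mind|].
  move=> x DIx; have [Dx _] := DIx; have [_ _ H _] := Hhat x Dx.
  rewrite lee_fin indicE; have [xE|xE] := boolP (x \in E); first exact: H.
  by rewrite HE // => Ex; case/negP: xE; rewrite inE.
have sum_ge (Q : pred 'I_n) (E : set (BorelRd R d)) : measurable E ->
    (forall x, DI x -> E x -> \sum_(i < n | Q i) hat M (a i) x = 1) ->
    (mu (E `&` DI) <= \sum_(i < n | Q i) mass i)%E.
  move=> mE HE; rewrite sumE -(integral_indic mu mDI mE).
  apply: ge0_le_integral => //; [exact: mind|].
  move=> x DIx; have := sum0 Q x DIx; rewrite !lee_fin => s0.
  rewrite indicE; have [|xE] := boolP (x \in E); last exact: s0.
  by rewrite inE => xE; rewrite HE.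
have atoms x p : mesh_dom M x -> subdiff (mesh_dom M) v x p -> ~ nonuniq (mesh_dom M) v p ->
    exists i, x = a i.
  move=> Dx px nn; apply: allv => //.
  exact: (nodal_atoms HM zE bv wv Dx px nn).
have Daa i : mesh_dom M (a i) by case: (Da i).
split => // [|e r me hr eD].
  apply: (nodal_barrier_bounds Hrho d0 bg bdry0 oD cD bD D0 cv wv inja Daa atoms) => //.
  - exact: (nodal_bdry HM zE).
  - apply: le_lt_trans (sum_le predT _ (@measurableT _ (BorelRd R d)) _) _; first by move=> x _ [].
    apply: le_lt_trans mrad; apply: le_measure; rewrite ?inE; [exact: measurableI|exact: open_borel|].
    by move=> x [_ [/DO]].
  (* A node outside [K] is farther than [h] from every point of the inner set, so its hat vanishes
     there. *)
  move=> i nK; apply/le_anti/andP; split; last first.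
    by rewrite -/(mass i) massE; apply: integral_ge0 => x DIx; exact: hat0.
  have := sum_le (pred1 i) set0 measurable0; rewrite set0I measure0 (big_pred1 i) //; apply.
  move=> x [Dx Ix] _; rewrite (big_pred1 i) //; apply/eqP/negPn/negP => hx.
  by have [_ H _ _] := Hhat x Dx; apply: nK; apply: HK Ix (H i hx).
have r0 : 0 < r by exact: lt_trans hr.
have mf : measurable (fatten e r : set (BorelRd R d)) by apply: open_borel; exact: fatten_open.
have fDI (E : set 'rV[R]_d) : E `<=` mesh_dom M -> E `&` DI = E `&` inner_set Om delta.
  by move=> ED; rewrite /DI setIA; congr (_ `&` _); apply/setIidPl.
have eD' : e `<=` mesh_dom M by move=> x ex; apply: eD; exact: sub_fatten.
rewrite -(fDI _ eD) -(fDI _ eD'); split; rewrite (W_atoms Hrho bv inja Daa atoms) //.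
  apply: sum_le => // x [Dx _] nf; rewrite big1 // => i /asboolP ei.
  apply/eqP/negPn/negP => hx; apply: nf; exists (a i) => //.
  by have [_ H _ _] := Hhat x Dx; exact: le_lt_trans (H i hx) hr.
apply: sum_ge => // x [Dx _] ex; have [_ _ _ H] := Hhat x Dx; apply: H => y My yx.
have fy : fatten e r y by exists x => //; exact: le_lt_trans yx hr.
by have [i yi] := allv y My (eD _ fy); exists i => //; apply/asboolP; rewrite -yi.
Qed.

(** Both functions attain [g] continuously, each through its own compact set and lower level, so
    comparison applies in both directions. The finite element limit and [u^delta] come with
    different compact sets. *)
Lemma bounded_solution_unique nu K1 K2 lo1 lo2 u v : compact K1 -> K1 `<=` Om ->
  compact K2 -> K2 `<=` Om -> bcf Om u -> bcf Om v -> barrier_bounds Om g K1 lo1 Om u ->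
  barrier_bounds Om g K2 lo2 Om v -> MA_eq Om Rf nu u -> MA_eq Om Rf nu v ->
  forall x, Om x -> u x = v x.
Proof.
move=> cK1 K1O cK2 K2O bu bv Bu Bv Mu Mv x Ox.
have H y t : bdry Om y -> 0 < t -> exists2 r, 0 < r & forall x, Om x -> `|x - y| < r ->
    `|u x - v x| < t.
  move=> by' t0; have t3 : 0 < t / 3 by lra.
  have [r1 r10 H1] := barrier_bounds_bdry oO bO ssO cg cK1 K1O Bu by' t3.
  have [r2 r20 H2] := barrier_bounds_bdry oO bO ssO cg cK2 K2O Bv by' t3.
  exists (Num.min r1 r2); first by rewrite lt_min r10.
  move=> y' Oy'; rewrite lt_min => /andP [y1 y2].
  have := H1 _ Oy' y1; have := H2 _ Oy' y2; rewrite !ler_norml ltr_norml => /andP [? ?] /andP [? ?].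
  by apply/andP; split; lra.
apply/le_anti/andP; split.
  apply: (MA_comparison d0 Hrho bv bu Mv Mu) => // y t by' t0.
  have [r r0 Hr] := H y t by' t0; exists r => // y' Oy' y'y.
  by have := Hr _ Oy' y'y; rewrite ltr_norml => /andP [? ?]; lra.
apply: (MA_comparison d0 Hrho bu bv Mu Mv) => // y t by' t0.
have [r r0 Hr] := H y t by' t0; exists r => // y' Oy' y'y.
by have := Hr _ Oy' y'y; rewrite ltr_norml => /andP [? ?]; lra.
Qed.

(** Otherwise there are bad mesh sizes arbitrarily near 0. The filter they generate has a cluster
    point with the measure and the barriers that determine [v]; hence it equals [v], and some bad
    mesh size turns out to be close to [v]. *)
Lemma fe_converges (J : set R) (Mh : R -> seq 'M[R]_(d.+1, d)) (V : R -> 'rV[R]_d -> R) delta v :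
  admissible Om J Mh -> 0 < delta -> approximate_solution Om B gm g Rf rad mu delta v ->
  (forall h, J h -> fe_sol g Rf (Mh h)
     (fun phi => \int[mu]_(x in mesh_dom (Mh h) `&` inner_set Om delta) (phi x)%:E)%E (V h)) ->
  forall s eps, 0 < s -> 0 < eps -> exists2 eta : R, 0 < eta & forall h, J h -> h < eta ->
    forall x, erode Om s x -> `|V h x - v x| <= eps.
Proof.
move=> [J01 [accJ _] mJ dJ] del0 [bv Bv Mv] HV s0 eps0 s00 eps00.
have dR : 0 < d%:R :> R by rewrite ltr0n.
(* Half the depth of the inner set in the sup norm: for [h <= k0] all nodes carrying mass lie in
   [K]. *)
pose k0 := delta / d%:R / 2; have k00 : 0 < k0 by rewrite /k0 !divr_gt0.
pose K := erode Om k0.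
have cK : compact K by exact: erode_compact k00 bO.
have KO : K `<=` Om by exact: erode_sub.
have HK h x y : h <= k0 -> inner_set Om delta x -> `|x - y| <= h -> K y.
  move=> hk /(inner_set_erode d0 oO del0) ex xy.
  have -> : K = erode Om (delta / d%:R - k0).
    by rewrite /K; congr (erode _ _); rewrite /k0; move: (delta / d%:R) => q; lra.
  by apply: (erode_near ex); rewrite distrC; exact: le_trans hk.
apply: contrapT => H.
pose Bad h := exists x, erode Om s0 x /\ eps0 < `|V h x - v x|.
have Hbad eta : 0 < eta -> exists h, [/\ J h, h < eta & Bad h].
  move=> eta0; apply: contrapT => nb; apply: H; exists eta => // h Jh hh x ex.
  by rewrite leNgt; apply/negP => lt; apply: nb; exists h; split => //; exists x.
pose F := filter_from [set eta : R | 0 < eta] (fun eta => [set h | [/\ J h, h < eta & Bad h]]).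
have FF : Filter F.
  apply: filter_from_filter; first by exists 1; exact: ltr01.
  move=> i j i0 j0; exists (Num.min i j); first by rewrite /= lt_min i0.
  by move=> h [Jh]; rewrite lt_min => /andP [h1 h2] bh.
have PF : ProperFilter F.
  by apply: filter_from_proper => eta eta0; have [h Hh] := Hbad eta eta0; exists h.
have FJ eta : 0 < eta -> F [set h | [/\ J h, h < eta & Bad h]] by move=> eta0; exists eta.
have app h : J h -> h <= k0 -> [/\ bcf (mesh_dom (Mh h)) (V h),
    barrier_bounds Om g K lo (mesh_dom (Mh h)) (V h) &
    forall e r, measurable (e : set (BorelRd R d)) -> h < r -> fatten e r `<=` mesh_dom (Mh h) ->
      (W (mesh_dom (Mh h)) (V h) e <= mu (fatten e r `&` inner_set Om delta))%E /\
      (mu (e `&` inner_set Om delta) <= W (mesh_dom (Mh h)) (V h) (fatten e r))%E].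
  move=> Jh hk; have /andP [h0 _] := J01 h Jh.
  by apply: (nodal_approximation (mJ h Jh) h0 del0 (HV h Jh)) => x y; exact: HK.
have ll : lo <= gm by exact: (lo_le gm bO O0 rad0).
have [s s00'||w [bw mw Hw]] := @convex_cluster R d R F PF Om B lo gM (fun h => mesh_dom (Mh h)) V oO cO bO.
- have s2 : 0 < s / 2 by lra.
  have [hd [hd0 Hd]] := dJ _ s2.
  exists hd => // h [Jh hh _] x ex; apply: Hd Jh hh _ _; apply: subset_closure.
  by apply: (erode_inner_set bdry0 oO _ ex); apply/andP; split; lra.
- exists k0 => // h [Jh hh _]; have [bV BV _] := app h Jh (ltW hh).
  by split => //; exact: barrier_bounds_range bg ll BV.
have Bw : barrier_bounds Om g K lo Om w.
  apply: barrier_bounds_limit => x eps Ox e0.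
  have [k Hk] := open_erode oO Ox.
  have kk : 0 < k.+1%:R^-1 :> R by rewrite invr_gt0 ltr0n.
  have [h [[Jh hh _] _ _ sub lt]] := Hw _ _ _ (FJ _ k00) kk e0.
  have [_ BV _] := app h Jh (ltW hh).
  by exists (mesh_dom (Mh h)), (V h); split => //; [exact: sub|exact: lt].
have mI : measurable (inner_set Om delta : set (BorelRd R d)) by exact: inner_set_borel.
have [nu Hnu] := measure_restr mu mI.
have Mw : MA_eq Om Rf nu w.
  apply: (@MA_limit _ _ _ _ Hrho _ _ _ lo gM bw).
    rewrite Hnu; apply: le_lt_trans (lt_le_trans mrad (leey _)).
    apply: le_measure; rewrite ?inE; [|exact: open_borel|by move=> x []].
    by apply: measurableI => //; exact: open_borel.
  move=> s eps sp ep.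
  have ms : 0 < Num.min s k0 by rewrite lt_min sp.
  have [h [[Jh + _] b1 b2 b3 b4]] := Hw _ _ _ (FJ _ ms) sp ep.
  rewrite lt_min => /andP [hs hk]; have [_ _ HVh] := app h Jh (ltW hk).
  exists (mesh_dom (Mh h)), (V h); split => // e r me sr eO.
  rewrite !Hnu; apply: HVh => //; first exact: lt_le_trans hs sr.
  by move=> x /eO; exact: b3.
have [cK' KO'] := inner_compact d0 oO bO del0.
have wv x : Om x -> w x = v x.
  apply: (bounded_solution_unique cK KO cK' KO' bw bv Bw Bv Mw).
  by move=> e me eO; rewrite Mv // Hnu.
have [h [[Jh _ [x [ex lt]]] _ _ _ le]] := Hw _ _ _ (FJ _ ltr01) s00 eps00.
have := le x ex; rewrite wv; last exact: erode_sub s00 _ ex.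
by rewrite leNgt lt.
Qed.

End FiniteElements.

(** * Sup norms and the double limit *)

Section SupNorm.
Context {R : realType} {d : nat}.
Implicit Types (x y : 'rV[R]_d) (K : set 'rV[R]_d) (f : 'rV[R]_d -> R) (c : R).

Lemma Linf_sup K f c : (forall x, K x -> `|f x| <= c) -> exists l, [/\ Linf K f = l%:E, 0 <= l,
  forall x, K x -> `|f x| <= l & forall c', 0 <= c' -> (forall x, K x -> `|f x| <= c') -> l <= c'].
Proof.
move=> Hc.
have ub c' : 0 <= c' -> (forall x, K x -> `|f x| <= c') -> (Linf K f <= c'%:E)%E.
  move=> c0 H; apply: ge_ereal_sup => _ [->|[x Kx <-]]; rewrite lee_fin //; exact: H.
have lb0 : (0 <= Linf K f)%E by apply: ereal_sup_ubound; left.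
have lb x : K x -> (`|f x|%:E <= Linf K f)%E by move=> Kx; apply: ereal_sup_ubound; right; exists x.
(* [K] may be empty, and then nothing is known of the sign of [c]. *)
have ubc : (Linf K f <= (Num.max 0 c)%:E)%E.
  by apply: ub => [|x Kx]; rewrite le_max ?lexx // Hc // orbT.
have fin : Linf K f \is a fin_num.
  by rewrite ge0_fin_numE //; exact: le_lt_trans ubc (ltry _).
exists (fine (Linf K f)); split; first by rewrite fineK.
- by rewrite -lee_fin fineK.
- by move=> x Kx; rewrite -lee_fin fineK //; exact: lb.
- by move=> c' c0 H; rewrite -lee_fin fineK //; exact: ub.
Qed.

End SupNorm.

Theorem theorem7p1 (R : realType) (d : nat) (Om : set 'rV[R]_d)
  (g Rf : 'rV[R]_d -> R) (mu : {measure set (BorelRd R d) -> \bar R})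
  (tau k C0 r0 : R) :
  (0 < d)%N -> Om !=set0 -> open Om -> convex_setE Om -> bdd_setE Om ->
  {within bdry Om, continuous g} ->
  (forall p, 0 < Rf p) ->
  (* (A) *)
  0 <= tau -> (forall a0, bdry Om a0 -> parabolic_support Om tau a0) ->
  (* (B) *)
  L1loc Rf -> 0 <= k -> 0 < C0 -> 0 < r0 ->
  (forall p, r0 <= enorm p -> C0 * powR (enorm p) (- (2 * k)) <= Rf p) ->
  (* (C) *)
  (mu Om < wint setT Rf)%E ->
  exists u : 'rV[R]_d -> R,
    [/\ gen_sol Om g Rf mu u,
        (forall v, gen_sol Om g Rf mu v -> forall x, Om x -> v x = u x) &
        forall (I : set R) (Mh : R -> seq 'M[R]_(d.+1, d)),
          admissible Om I Mh ->
          forall U : R -> R -> 'rV[R]_d -> R,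
            (forall delta h, 0 < delta -> I h ->
               fe_sol g Rf (Mh h)
                 (fun phi => (\int[mu]_(x in mesh_dom (Mh h) `&` inner_set Om delta)
                                (phi x)%:E)%E)
                 (U delta h)) ->
            forall sigma : R, 0 < sigma ->
              exists L : R -> R,
                (forall delta, 0 < delta -> forall eps : R, 0 < eps ->
                   exists eta : R, 0 < eta /\ forall h, I h -> h < eta ->
                     (`| Linf (closure (inner_set Om sigma))
                             (fun x => (U delta h x - u x)%R) - (L delta)%:E | < eps%:E)%E) /\
                (forall eps : R, 0 < eps -> exists eta : R, 0 < eta /\
                   forall delta, 0 < delta < eta -> `|L delta| < eps)].
Proof.
move=> d0 O0 oO cO [B bB] cg Rf0 tau0 HA HB _ _ _ _ HC.
have bO x : Om x -> `|x| <= B by move=> Ox; apply: le_trans (norm_le_enorm x) (bB x Ox).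
have ssO : strictly_supported Om by move=> y by'; exact: parabolic_strict oO cO tau0 by' (HA y by').
have [rho Hrho] := density_exists Rf0 HB.
have bdry0 : bdry Om !=set0.
  by have [x Ox] := O0; have [b bb _] := affine_exit 0 d0 oO bO Ox; exists b.
have cbd := bdry_compact oO bO.
have [x1 _ H1] := compact_min 0 bdry0 cbd cg.
have cNg : {within bdry Om, continuous (fun x => - g x)} by move=> x; apply: continuousN; exact: cg.
have [x2 _ H2] := compact_min 0 bdry0 cbd cNg.
have bg x : bdry Om x -> g x1 <= g x <= g x2.
  by move=> bx; have := H1 x bx; have := H2 x bx; rewrite !dotp0l => h1 h2; apply/andP; split; lra.
(* Condition (C) is strict and the balls exhaust the space, so continuity from below gives a finite
   radius. *)
have [rad mrad] : exists n : nat, (mu Om < rho [set p | (`|p| <= n%:R)%R])%E.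
  apply: measure_lt_bigcup => [n|n m nm p /= pn|].
  - by apply: closed_borel; exact: closed_norm_le.
  - by apply: le_trans pn _; rewrite ler_nat.
  have [sw _ _ _] := Hrho.
  rewrite (_ : \bigcup_n _ = setT) -?(sw setT setT set0) //.
  apply/seteqP; split => // p _; exists (Num.truncn `|p|).+1 => //=; exact: ltW (truncnS_gt _).
have rad0 : 0 <= rad%:R :> R by [].
have [v [u [Hv Hu vu]]] := generalised_solution d0 oO cO bO O0 ssO cg bg Hrho rad0 mrad.
have [cu Mu wu maxu] := Hu.
exists u; split => // [w [cw Mw ww maxw] x Ox|I Mh adm U HU sigma sig0].
  (* Each of two generalised solutions is maximal against the other. *)
  by apply/le_anti; rewrite maxu ?maxw.
set K := closure (inner_set Om sigma).
have KE : K `<=` erode Om (sigma / d%:R) by exact: closure_inner_set.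
have sd0 : 0 < sigma / d%:R by rewrite divr_gt0 // ltr0n.
have [cK KO] := inner_compact d0 oO bO sig0.
(* [u] is bounded on [K] because there it is within 1 of a bounded [v delta]. *)
have [e1 e10 He1] := vu _ _ sd0 ltr01.
have bu : exists c, forall x, K x -> `|u x| <= c.
  have e2 : 0 < e1 / 2 < e1 by apply/andP; split; lra.
  have [e20 _] := andP e2.
  have [[_ _ _ _ [m [M bv]]] _ _] := Hv _ e20.
  exists (`|m| + `|M| + 1) => x Kx; have := He1 _ e2 _ (KE _ Kx); have := bv _ (KO _ Kx).
  have := ler_norm M; have := ler_norm (- m); rewrite normrN => h1 h2 /andP [h3 h4].
  have := normr_ge0 m; have := normr_ge0 M => h5 h6.
  by rewrite !ler_norml => /andP [h7 h8]; apply/andP; split; lra.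
have [cu' Hcu] := bu.
(* [L delta] is the norm of [v delta - u] on [K], which is the limit in [h] at fixed [delta]; 0 is a
   default for nonpositive [delta]. *)
have Hl (delta : R) : exists l, 0 < delta -> [/\ 0 <= l,
    forall x, K x -> `|v delta x - u x| <= l &
    forall c', 0 <= c' -> (forall x, K x -> `|v delta x - u x| <= c') -> l <= c'].
  have [del0|del0] := ltP 0 delta; last by exists 0.
  have [[_ _ _ _ [m [M bv]]] _ _] := Hv _ del0.
  have [|l [_ h1 h2 h3]] := @Linf_sup R d K (fun x => v delta x - u x) (`|m| + `|M| + cu').
    move=> x Kx; have := bv _ (KO _ Kx); have := Hcu _ Kx.
    have := ler_norm M; have := ler_norm (- m); rewrite normrN => h1 h2.
    have := normr_ge0 m; have := normr_ge0 M => h5 h6.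
    by rewrite !ler_norml => /andP [h7 h8] /andP [h3 h4]; apply/andP; split; lra.
  by exists l.
have [L HL] := choice Hl; exists L; split; last first.
  move=> eps eps0; have e2 : 0 < eps / 2 by lra.
  have [eta eta0 Heta] := vu _ _ sd0 e2; exists eta; split => // delta Hd; have [del0 _] := andP Hd.
  have [h1 h2 h3] := HL _ del0; rewrite ger0_norm //.
  apply: le_lt_trans (h3 (eps / 2) (ltW e2) _) _; last lra.
  by move=> x Kx; apply: Heta Hd _ (KE _ Kx).
move=> delta del0 eps eps0; have e2 : 0 < eps / 2 by lra.
have [h1 h2 h3] := HL _ del0.
have [eta eta0 Heta] := fe_converges d0 oO cO bO O0 ssO cg bg Hrho rad0 mrad adm del0 (Hv _ del0)
  (fun h Ih => HU _ _ del0 Ih) sd0 e2.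
exists eta; split => // h Ih hh; have near := Heta h Ih hh.
have tri x : K x -> `|U delta h x - u x| <= `|v delta x - u x| + eps / 2 /\
    `|v delta x - u x| <= `|U delta h x - u x| + eps / 2.
  move=> Kx; have := near x (KE _ Kx) => n1; split.
    rewrite (_ : U delta h x - u x = (v delta x - u x) + (U delta h x - v delta x)); last by lra.
    by apply: le_trans (ler_normD _ _) _; rewrite lerD2l.
  rewrite (_ : v delta x - u x = (U delta h x - u x) + (v delta x - U delta h x)); last by lra.
  by apply: le_trans (ler_normD _ _) _; rewrite lerD2l distrC.
have [|l [-> l0 l1 l2]] := @Linf_sup R d K (fun x => U delta h x - u x) (L delta + eps / 2).
  by move=> x Kx; have [t1 _] := tri x Kx; have := h2 x Kx; lra.
have le1 : l <= L delta + eps / 2.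
  by apply: l2 => [|x Kx]; [lra|have [t1 _] := tri x Kx; have := h2 x Kx; lra].
have le2 : L delta <= l + eps / 2.
  by apply: h3 => [|x Kx]; [lra|have [_ t1] := tri x Kx; have := l1 x Kx; lra].
by rewrite -EFinB /= lte_fin ltr_norml; apply/andP; split; lra.
Qed.
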